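(* Let the delay differential algebraic system $$E\dot{\mathbf x}(t)=\sum_{k=0}^m A_k\mathbf x(t-\tau_k)+B\mathbf v(t),\qquad \mathbf z(t)=C\mathbf x(t)$$ be strongly exponentially stable with finite strong $H^2$-norm. Let $G$ be its transfer function and $G_N^{\rm spl}$ the transfer function of its spline-based Lanczos tau discretization with knots at the delays and Legendre basis on each segment. Then $\|G_N^{\rm spl}\|_{H^2}\to\|G\|_{H^2}$ as $N\to\infty$.
   Context: **System.** $E,A_0,\dots,A_m\in\mathbb C^{n\times n}$, $B\in\mathbb C^{n\times p}$, $C\in\mathbb C^{q\times n}$; $E$ may be singular; $0=\tau_0<\tau_1<\dots<\tau_m<\infty$, $\boldsymbol\tau=(\tau_1,\dots,\tau_m)$. Standing assumption (differentiation index at most one, semi-explicit system): if the columns of $\hat V$ form a basis of $\ker E$ and the columns of $\hat U^*$ form a basis of $\ker E^*$, then $\hat U A_0\hat V$ is nonsingular. The transfer function is $G(s)=C\big(sE-\sum_{k=0}^m A_ke^{-\tau_ks}\big)^{-1}B$; $G(s;\boldsymbol\theta)$ denotes the one with delays $\boldsymbol\tau$ replaced by $\boldsymbol\theta\in\mathbb R_+^m$. **Stability and norms.** The spectral abscissa $\alpha(\boldsymbol\theta)$ is the supremum of the real parts of the zeros of $\det\big(sE-A_0-\sum_{k=1}^mA_ke^{-\theta_ks}\big)$. Let $B_\delta(\boldsymbol\tau)=\{\boldsymbol\theta\in\mathbb R_+^m:\|\boldsymbol\theta-\boldsymbol\tau\|<\delta\}$. The system is strongly exponentially stable if there is $\delta>0$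 with $\sup_{\boldsymbol\theta\in B_\delta(\boldsymbol\tau)}\alpha(\boldsymbol\theta)<0$. For a transfer function $H$, $\|H\|_{H^2}=\sup_{0<\alpha<\infty}\big(\frac1{2\pi}\int_{-\infty}^\infty\|H(\alpha+i\omega)\|_F^2\,d\omega\big)^{1/2}$ ($\|\cdot\|_F$ Frobenius norm; infinite for systems that are not exponentially stable). The strong $H^2$-norm is $\|G\|^{\mathrm s}_{H^2}=\lim_{\delta\to0^+}\sup\{\|G(\cdot;\boldsymbol\theta)\|_{H^2}:\boldsymbol\theta\in B_\delta(\boldsymbol\tau)\}$. **Spline discretization.** For $k=1,\dots,m$ and $N\ge1$ let $\mathbb P_{N}^{(k)}$ be the space of polynomials of degree at most $N$ from $[-\tau_k,-\tau_{k-1}]$ to $\mathbb C^n$, and let $\mathbb S_N=\prod_{k=1}^m\mathbb P_N^{(k)}$, with elements $\Xi=(\xi^{(1)},\dots,\xi^{(m)})$. Write $\varepsilon^{(k)}_\theta\Xi=\xi^{(k)}(\theta)$ and $\mathcal D^{(k)}\Xi=(\xi^{(k)})'$. Let $\varphi_N^{(k)}$ be the degree-$N$ Legendre polynomial shifted and scaled to $[-\tau_k,-\tau_{k-1}]$, and let $\mathcal T^{(k)}_{N-1}\Xi\in\mathbb P^{(k)}_{N-1}$ be $\xi^{(k)}$ with its component along $\varphi_N^{(k)}$ removed, componentwise $(\xi^{(k)})_j-\langle(\xi^{(k)})_j,\varphi^{(k)}_N\rangle\varphi_N^{(k)}/\|\varphi^{(k)}_N\|^2$ in the $L^2$ inner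 product on $[-\tau_k,-\tau_{k-1}]$. Define linear maps $\mathcal E_N^{\rm spl},\mathcal A_N^{\rm spl}:\mathbb S_N\to\mathbb C^n\times\prod_{k=1}^m\mathbb P^{(k)}_{N-1}\times(\mathbb C^n)^{m-1}$ by $$\mathcal E_N^{\rm spl}\Xi=\Big(E\varepsilon_0^{(1)}\Xi,\ \big(\mathcal T_{N-1}^{(k)}\Xi\big)_{k=1}^m,\ (\mathbf 0)_{k=1}^{m-1}\Big),$$ $$\mathcal A_N^{\rm spl}\Xi=\Big(A_0\varepsilon_0^{(1)}\Xi+\sum_{k=1}^mA_k\varepsilon^{(k)}_{-\tau_k}\Xi,\ \big(\mathcal D^{(k)}\Xi\big)_{k=1}^m,\ \big(\varepsilon^{(k)}_{-\tau_k}\Xi-\varepsilon^{(k+1)}_{-\tau_k}\Xi\big)_{k=1}^{m-1}\Big).$$ The discretization is $\mathcal E_N^{\rm spl}\dot\Xi_{tN}=\mathcal A_N^{\rm spl}\Xi_{tN}+\mathcal B_N^{\rm spl}\mathbf v(t)$, $\mathbf z_N(t)=C\varepsilon_0^{(1)}\Xi_{tN}$, with $\mathcal B_N^{\rm spl}\mathbf v=(B\mathbf v,\mathbf 0,\mathbf 0)$, and its transfer function is $G_N^{\rm spl}(s)=C\varepsilon_0^{(1)}\big(s\mathcal E_N^{\rm spl}-\mathcal A_N^{\rm spl}\big)^{-1}\mathcal B_N^{\rm spl}$. *)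

(* Defs.v *)
From HB Require Import structures.
From mathcomp Require Import all_boot all_order all_algebra.
From mathcomp Require Import complex.
From mathcomp Require Import all_classical all_reals all_analysis.

Set Implicit Arguments.
Unset Strict Implicit.
Unset Printing Implicit Defensive.

Import Order.TTheory GRing.Theory Num.Theory numFieldNormedType.Exports.

Local Open Scope classical_set_scope.
Local Open Scope ring_scope.
Local Open Scope complex_scope.
Local Open Scope sesquilinear_scope.

(* Indexing: there are m.+1 >= 1 positive delays, stored in a row vector
   tau : 'rV_m.+1, and tau 0 k is the delay tau_(k+1) of the usual 1-based
   numbering; likewise A k is the matrix A_(k+1), and A0 (delay 0) is kept
   apart. *)

Section Complex.
Variable R : realType.

Definition cexp (z : R[i]) : R[i] :=
  (expR (complex.Re z) * cos (complex.Im z))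
  +i* (expR (complex.Re z) * sin (complex.Im z)).

Definition frobenius (q p : nat) (M : 'M[R[i]]_(q, p)) : R :=
  Num.sqrt (\sum_i \sum_j Normc.normc (M i j) ^+ 2).

Definition l2dot (a b : R) (f g : R -> R[i]) : R[i] :=
  (\int[lebesgue_measure]_(t in `[a, b]) complex.Re (f t * (g t)^*))%R
  +i* (\int[lebesgue_measure]_(t in `[a, b]) complex.Im (f t * (g t)^*))%R.

(* MathComp row spaces represent spaces of row vectors, hence the
   transpositions. *)
Definition columns_basis_ker (n d : nat) (M : 'M[R[i]]_n) (V : 'M[R[i]]_(n, d))
  : bool :=
  row_free V^T && (V^T == kermx M^T)%MS.

Definition index_le1 (n : nat) (E A0 : 'M[R[i]]_n) : Prop :=
  forall (d : nat) (V : 'M[R[i]]_(n, d)) (U : 'M[R[i]]_(d, n)),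
    columns_basis_ker E V -> columns_basis_ker (E ^t*) (U ^t*) ->
    U *m A0 *m V \in unitmx.

End Complex.

Section DelaySystem.
Variables (R : realType) (n p q m : nat).
Variables (E A0 : 'M[R[i]]_n) (A : 'I_m.+1 -> 'M[R[i]]_n).
Variables (B : 'M[R[i]]_(n, p)) (C : 'M[R[i]]_(q, n)).
Implicit Type theta tau : 'rV[R]_m.+1.

Definition charmx theta (s : R[i]) : 'M[R[i]]_n :=
  s *: E - A0 - \sum_k cexp (- ((theta 0 k)%:C * s)) *: A k.

(* The value at a zero of the characteristic determinant is a dummy (invmx is
   the identity on singular matrices). *)
Definition transfer theta (s : R[i]) : 'M[R[i]]_(q, p) :=
  C *m invmx (charmx theta s) *m B.

(* ereal_sup set0 = -oo: without characteristic roots the abscissa is -oo. *)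
Definition abscissa theta : \bar R :=
  ereal_sup [set (complex.Re s)%:E | s in [set s | \det (charmx theta s) = 0]].

Definition delay_ball tau (delta : R) : set 'rV[R]_m.+1 :=
  [set theta | (forall k, 0 <= theta 0 k) /\
    Num.sqrt (\sum_k (theta 0 k - tau 0 k) ^+ 2) < delta].

Definition strongly_exp_stable tau : Prop :=
  exists2 delta : R, 0 < delta &
    (ereal_sup [set abscissa theta | theta in delay_ball tau delta] < 0)%E.

End DelaySystem.

Section H2Norm.
Variables (R : realType) (q p : nat).

Definition hardy2 (H : R[i] -> 'M[R[i]]_(q, p)) : \bar R :=
  ereal_sup [set sqrte (((2 * pi)^-1)%:E *
                 \int[lebesgue_measure]_w (frobenius (H (a +i* w)) ^+ 2)%:E)%E
            | a in [set a : R | 0 < a]].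

(* The norm of a system with spectral abscissa alpha and transfer function H.
   It is infinite by convention when the system is not exponentially stable,
   even if its unstable modes cancel in H. *)
Definition h2norm (alpha : \bar R) (H : R[i] -> 'M[R[i]]_(q, p)) : \bar R :=
  if (alpha < 0)%E then hardy2 H else +oo%E.

End H2Norm.

Section DelaySystemNorms.
Variables (R : realType) (n p q m : nat).
Variables (E A0 : 'M[R[i]]_n) (A : 'I_m.+1 -> 'M[R[i]]_n).
Variables (B : 'M[R[i]]_(n, p)) (C : 'M[R[i]]_(q, n)).

Definition delay_h2norm (theta : 'rV[R]_m.+1) : \bar R :=
  h2norm (abscissa E A0 A theta) (transfer E A0 A B C theta).

Definition strong_h2norm (tau : 'rV[R]_m.+1) : \bar R :=
  lim (ereal_sup [set delay_h2norm theta | theta in delay_ball tau delta]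
        @[delta --> 0^'+]).

End DelaySystemNorms.

Section Spline.
Variables (R : realType) (n p q m : nat).
Variables (E A0 : 'M[R[i]]_n) (A : 'I_m.+1 -> 'M[R[i]]_n).
Variables (B : 'M[R[i]]_(n, p)) (C : 'M[R[i]]_(q, n)).
Variable tau : 'rV[R]_m.+1.

(* tau_0 = 0, tau_1, ..., tau_(m+1) *)
Definition knot (k : nat) : R := if k is k'.+1 then tau 0 (inord k') else 0.

(* Rodrigues' formula, P_N = (2^N N!)^-1 d^N/dx^N (x^2 - 1)^N *)
Definition legendre (N : nat) : {poly R} :=
  (2 ^+ N * N`!%:R)^-1 *: (('X ^+ 2 - 1) ^+ N)^`(N).

(* Segment k : 'I_m.+1 is [- knot k.+1, - knot k]; the affine map below sends
   it onto [-1, 1]. *)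
Definition seg_legendre (N : nat) (k : 'I_m.+1) : {poly R[i]} :=
  map_poly (real_complex R)
    (legendre N \Po ((knot k.+1 - knot k)^-1 *:
                      (2 *: 'X + (knot k.+1 + knot k)%:P))).

Definition seg_dot (k : 'I_m.+1) (f g : {poly R[i]}) : R[i] :=
  l2dot (- knot k.+1) (- knot k) (fun t => f.[t%:C]) (fun t => g.[t%:C]).

(* vpoly N is the space of C^n-valued polynomials of degree < N, component by
   component. *)
Definition vpoly (N : nat) : vectType R[i] := {ffun 'I_n -> {poly_N R[i]}}.

Definition spline (N : nat) : vectType R[i] := {ffun 'I_m.+1 -> vpoly N.+1}.

Definition spline_cod (N : nat) : vectType R[i] :=
  (('cV[R[i]]_n * {ffun 'I_m.+1 -> vpoly N}) *
   {ffun 'I_m -> 'cV[R[i]]_n})%type.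

Definition seg_eval (N : nat) (k : 'I_m.+1) (t : R) (Xi : spline N)
  : 'cV[R[i]]_n :=
  \col_j (Xi k j : {poly R[i]}).[t%:C].

(* npolyp N truncates at degree < N; nothing is lost here, since a polynomial
   of degree <= N minus its component along the degree-N Legendre polynomial
   is a combination of Legendre polynomials of degree < N. *)
Definition seg_trunc (N : nat) (k : 'I_m.+1) (Xi : spline N) : vpoly N :=
  [ffun j => npolyp N ((Xi k j : {poly R[i]}) -
     (seg_dot k (Xi k j) (seg_legendre N k) /
      seg_dot k (seg_legendre N k) (seg_legendre N k)) *: seg_legendre N k)].

Definition seg_deriv (N : nat) (k : 'I_m.+1) (Xi : spline N) : vpoly N :=
  [ffun j => npolyp N (Xi k j : {poly R[i]})^`()].

(* linfun f is the linear map agreeing with f on a basis, hence everywhere,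
   since the functions below are linear. *)
Definition spl_E (N : nat) : 'Hom(spline N, spline_cod N) :=
  linfun (fun Xi : spline N =>
    (E *m seg_eval ord0 0 Xi, [ffun k => seg_trunc k Xi], 0) : spline_cod N).

(* The interior knot number k : 'I_m is - knot k.+1, between the segments
   widen_ord _ k and lift ord0 k (of values k and k.+1). *)
Definition spl_A (N : nat) : 'Hom(spline N, spline_cod N) :=
  linfun (fun Xi : spline N =>
    (A0 *m seg_eval ord0 0 Xi + \sum_k A k *m seg_eval k (- knot k.+1) Xi,
     [ffun k => seg_deriv k Xi],
     [ffun k : 'I_m => seg_eval (widen_ord (leqnSn m) k) (- knot k.+1) Xi
                       - seg_eval (lift ord0 k) (- knot k.+1) Xi])
    : spline_cod N).

Definition spl_B (N : nat) (v : 'cV[R[i]]_p) : spline_cod N :=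
  (B *m v, 0, 0).

Definition spl_pencil (N : nat) (s : R[i]) : 'Hom(spline N, spline_cod N) :=
  s *: spl_E N - spl_A N.

Definition spl_transfer (N : nat) (s : R[i]) : 'M[R[i]]_(q, p) :=
  \matrix_(i, j)
    (C *m seg_eval ord0 0
            ((spl_pencil N s)^-1%VF (spl_B N (delta_mx j 0)))) i 0.

(* The pencil acts between spaces of equal dimension, so that it is singular
   at s iff it has a nonzero kernel. *)
Definition spl_abscissa (N : nat) : \bar R :=
  ereal_sup [set (complex.Re s)%:E | s in [set s | lker (spl_pencil N s) != 0%VS]].

Definition spl_h2norm (N : nat) : \bar R :=
  h2norm (spl_abscissa N) (spl_transfer N).

End Spline.

(* Main.v *)
Require Import Defs.
From HB Require Import structures.
From mathcomp Require Import all_boot all_order all_algebra.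
From mathcomp Require Import complex polyrcf.
From mathcomp Require Import ring lra.
From mathcomp Require Import all_classical all_reals all_analysis.
From mathcomp Require Import measurable_realfun.
From mathcomp Require cauchyreals.

Set Implicit Arguments.
Unset Strict Implicit.
Unset Printing Implicit Defensive.

Import Order.TTheory GRing.Theory Num.Theory numFieldNormedType.Exports.
Import Normc.

Local Open Scope classical_set_scope.
Local Open Scope ring_scope.
Local Open Scope complex_scope.

(** The transfer function depends on the delays only through the numbers
    [exp (- tau_k s)]: it is [F(s, z) = C (s E - A0 - sum_k z_k A_k)^-1 B] at
    these values of [z]. The tau method acts on every segment as a scalar
    equation, which multiplies each component by the same rational function of
    [s] from the right end to the left end. Hence the transfer function of the
    discretization is [F(s, z_N)], where [z_N] collects products of these
    factors ([spl_transferE]), and the theorem is a statement about [F].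

    On the half-plane [Re s >= 0], two facts on one segment suffice. The factors
    have modulus at most one ([tau_ratio_le1]): the derivative of [|xi|^2]
    integrates to [2 Re (s) |T xi|^2]. And they converge to the exponential of
    the segment uniformly on bounded sets: comparison with the Taylor polynomial
    leaves a residual with a factorial in the denominator, which controls the
    error at the left end by an energy estimate ([tau_error],
    [tau_ratio_error]). Thus both [z_N] and the true exponentials stay in the
    closed unit polydisc, and bounds for [F] that are uniform on the polydisc
    apply to both.

    Far from the origin, such a bound is [|F(s, z)| <= K / |s|] ([far_field]). It
    rests on two consequences of the hypotheses. Firstly, the determinant
    [alg_det] of the algebraic equations has no zero in the closed polydisc
    ([alg_det_polydisc]). A zero could be moved to a torus with radii
    [exp (- a tau'_k)] for commensurate delays [tau'] near [tau], [a >= 0]; since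
    the phases of the exponentials are at our disposal at high frequencies, at
    the price of a small change of the delays, there would be delay systems
    arbitrarily near the given one with characteristic roots arbitrarily close
    to the line [Re s = a], contrary to strong stability. The minimum modulus
    principle replaces the argument principle here. Secondly, the direct
    feedthrough vanishes identically as a polynomial in [z] ([feedthrough_eq0]):
    for commensurate delays the transfer function is asymptotically periodic
    along vertical lines, and it can be square integrable there only if its
    limit is zero; finiteness of the strong norm provides enough such delays.

    On a disc of radius [rho] the characteristic determinant is bounded away
    from zero by compactness and stability, so that the values of [F] at [z_N]
    and at the exponentials are close for large [N] ([near_field]). Together, the
    squared Frobenius norms differ by at most [2 kappa / (rho^2 + w^2)] on every
    vertical line ([transfer_close]), where [kappa] does not depend on [rho]; the
    integral of this bound is a multiple of [1 / rho], so that the Hardy norms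
    are close ([hardy2_le]). The same bounds show that the pencil is injective
    on the closed half-plane; its finitely many singular points then lie in the
    open left half-plane ([pencil_abscissa_lt0]), and the discretization is
    stable. *)

(** * The modulus of a complex number *)

Section Modulus.
Variable R : realType.
Implicit Types (x y z : R[i]) (a : R).

Lemma normc_def z : `|z| = (normc z)%:C. Proof. by []. Qed.

Lemma normc_ge0 z : 0 <= normc z.
Proof. by rewrite -ler0c -normc_def normr_ge0. Qed.

Lemma normcD x y : normc (x + y) <= normc x + normc y.
Proof. by rewrite -lecR rmorphD /= -!normc_def ler_normD. Qed.

Lemma normcN z : normc (- z) = normc z.
Proof. by apply: complexI; rewrite /= -!normc_def normrN. Qed.

Lemma normcB x y : normc (x - y) <= normc x + normc y.
Proof. by rewrite -(normcN y) normcD. Qed.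

Lemma normc_eq0 z : (normc z == 0) = (z == 0).
Proof.
apply/eqP/eqP => [/eq0_normc //|->]; exact: normc0.
Qed.

Lemma normc_gt0 z : (0 < normc z) = (z != 0).
Proof. by rewrite lt_def normc_ge0 normc_eq0 andbT. Qed.

Lemma normcX z k : normc (z ^+ k) = normc z ^+ k.
Proof.
by elim: k => [|k IH]; rewrite ?expr0 ?normc1 // !exprS normcM IH.
Qed.

Lemma normc_prod (I : Type) (s : seq I) (P : pred I) (F : I -> R[i]) :
  normc (\prod_(i <- s | P i) F i) = \prod_(i <- s | P i) normc (F i).
Proof. by elim/big_rec2: _ => [|i y x _ <-]; rewrite ?normc1 ?normcM. Qed.

Lemma normc_sum (I : Type) (s : seq I) (P : pred I) (F : I -> R[i]) :
  normc (\sum_(i <- s | P i) F i) <= \sum_(i <- s | P i) normc (F i).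
Proof.
elim/big_rec2: _ => [|i y x _ h]; rewrite ?normc0 //.
by rewrite (le_trans (normcD _ _)) // lerD2l.
Qed.

Lemma normc_real a : normc a%:C = `|a|.
Proof. by rewrite /= expr0n addr0 sqrtr_sqr. Qed.

Lemma normc_nat k : normc (k%:R : R[i]) = k%:R.
Proof. by rewrite -(rmorph_nat (real_complex R)) normc_real ger0_norm ?ler0n. Qed.

Lemma normc_sqr z : normc z ^+ 2 = complex.Re z ^+ 2 + complex.Im z ^+ 2.
Proof. by case: z => a b /=; rewrite sqr_sqrtr // addr_ge0 ?sqr_ge0. Qed.

Lemma Re_le_normc z : `|complex.Re z| <= normc z.
Proof.
rewrite -ler_sqr ?nnegrE ?normc_ge0 // normc_sqr real_normK ?num_real //.
by rewrite lerDl sqr_ge0.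
Qed.

Lemma Im_le_normc z : `|complex.Im z| <= normc z.
Proof.
rewrite -ler_sqr ?nnegrE ?normc_ge0 // normc_sqr real_normK ?num_real //.
by rewrite lerDr sqr_ge0.
Qed.

Lemma normc_le_ReIm z : normc z <= `|complex.Re z| + `|complex.Im z|.
Proof.
rewrite -ler_sqr ?nnegrE ?normc_ge0 ?addr_ge0 // normc_sqr sqrrD.
by rewrite !real_normK ?num_real // addrAC lerDl mulrn_wge0 // mulr_ge0.
Qed.

Lemma normc_conj z : normc z^* = normc z.
Proof. by case: z => a b /=; rewrite sqrrN. Qed.

Lemma normc_dist x y : normc x - normc y <= normc (x - y).
Proof. by rewrite lerBlDr -{1}(subrK y x) normcD. Qed.

Lemma normcC x y : normc (x - y) = normc (y - x).
Proof. by rewrite -opprB normcN. Qed.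

Lemma mulc_conj z : z * z^* = (normc z ^+ 2)%:C.
Proof.
by rewrite normc_sqr; case: z => a b; simpc => /=; congr (_ +i* _); ring.
Qed.

End Modulus.

Arguments normc {R} x : simpl never.

(** * The minimum modulus principle *)

Section MinimumModulus.
Variable R : realType.

Lemma prod_const_seq (K : comNzRingType) (I : Type) (s : seq I) (c : K) :
  \prod_(z <- s) c = c ^+ size s.
Proof. by rewrite big_const_seq count_predT iter_mulr_1. Qed.

Lemma roots_of_unity_prod (M : nat) : (0 < M)%N ->
  exists rs : seq R[i], [/\ size rs = M, forall z, z \in rs -> normc z = 1 &
    forall y, \prod_(z <- rs) (y - z) = y ^+ M - 1].
Proof.
move=> M0; pose p : {poly R[i]} := 'X^M - 1.
have monp : p \is monic by rewrite /p monicXnsubC.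
have [rs rsE] := closed_field_poly_normal p.
rewrite (monicP monp) scale1r in rsE.
exists rs; split.
- have := size_XnsubC (1 : R[i]) M0; rewrite polyC1 -/p rsE size_prod_XsubC.
  by case.
- move=> z zrs; have : root p z by rewrite rsE root_prod_XsubC.
  rewrite /root !hornerE ?hornerXn subr_eq0 => /eqP zM.
  have : normc z ^+ M = 1 by rewrite -normcX zM normc1.
  by move/eqP; rewrite pexpr_eq1 ?normc_ge0 // => /eqP.
- move=> y; have := congr1 (horner^~ y) rsE; rewrite !hornerE ?hornerXn => ->.
  by rewrite horner_prod; apply: eq_bigr => z _; rewrite !hornerE.
Qed.

(** A zero-free polynomial is averaged, multiplicatively, over the [M]-th roots
    of unity: its values there multiply up to [c^M] times the product of the
    [r_i^M - r^M] over the roots [r_i], which have modulus at least [r].  This is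
    at most [2^d] times the [M]-th power of the value at the centre, and [2^d]
    is lost when [M] grows. *)
Lemma poly_minimum_modulus (P : {poly R[i]}) (r m : R) : 0 < r ->
  (forall x, normc x <= r -> P.[x] != 0) ->
  (forall x, normc x = r -> m <= normc P.[x]) -> m <= normc P.[0].
Proof.
move=> r0 Pn0 Pm.
have [//|mP0] := leP m (normc P.[0]).
have P0 : 0 < normc P.[0] by rewrite normc_gt0 Pn0 // normc0 ltW.
have [s sE] := closed_field_poly_normal P.
set c := lead_coef P in sE.
have PE x : P.[x] = c * \prod_(z <- s) (x - z).
  rewrite sE hornerZ horner_prod; congr (_ * _).
  by apply: eq_bigr => z _; rewrite hornerXsubC.
have sr z : z \in s -> r <= normc z.
  move=> zs; rewrite leNgt; apply/negP => zr.
  have := Pn0 z (ltW zr); rewrite PE (big_rem z) //= subrr mul0r mulr0.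
  by rewrite eqxx.
have key M : (0 < M)%N -> m ^+ M <= 2 ^+ size s * normc P.[0] ^+ M.
  move=> M0; have [rs [szrs rs1 rsE]] := roots_of_unity_prod M0.
  have m0 : 0 <= m by rewrite ltW // (lt_trans P0).
  have h1 : m ^+ M <= \prod_(z <- rs) normc P.[r%:C * z].
    rewrite -szrs -[X in X <= _](_ : \prod_(z <- rs) m = _); last exact: prod_const_seq.
    rewrite !big_seq; apply: ler_prod => z zrs; rewrite m0 /=.
    by apply: Pm; rewrite normcM (rs1 z zrs) mulr1 normc_real gtr0_norm.
  apply: le_trans h1 _.
  have -> : \prod_(z <- rs) normc P.[r%:C * z] =
      normc c ^+ M * \prod_(y <- s) normc (y ^+ M - r%:C ^+ M).
    under eq_bigr do rewrite PE normcM normc_prod.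
    rewrite big_split /= prod_const_seq szrs.
    congr (_ * _); rewrite exchange_big /=; apply: eq_bigr => y _.
    have rn0 : r%:C != 0 :> R[i] by rewrite -normc_eq0 normc_real normr_eq0 gt_eqF.
    have -> : y ^+ M - r%:C ^+ M = r%:C ^+ M * ((y / r%:C) ^+ M - 1).
      by rewrite mulrBr mulr1 -exprMn mulrCA divff // mulr1.
    rewrite -rsE normcM normcX normc_prod -szrs.
    rewrite -prod_const_seq -big_split /=.
    apply: eq_bigr => z _; rewrite -normcM mulrBr mulrCA divff // mulr1.
    by rewrite normcC.
  have -> : normc P.[0] ^+ M = normc c ^+ M * \prod_(y <- s) normc y ^+ M.
    rewrite PE normcM exprMn normc_prod -prodrXl; congr (_ * _).
    by apply: eq_bigr => y _; rewrite sub0r normcN.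
  rewrite mulrCA ler_wpM2l ?exprn_ge0 ?normc_ge0 //.
  rewrite -prod_const_seq -big_split /=.
  rewrite !big_seq; apply: ler_prod => y ys; rewrite normc_ge0 /=.
  rewrite (le_trans (normcB _ _)) // !normcX normc_real gtr0_norm //.
  rewrite mulr_natl mulr2n lerD2l.
  by rewrite lerXn2r ?nnegrE ?normc_ge0 ?(ltW r0) ?sr.
have [k kP] : exists k, 2 ^+ size s < (m / normc P.[0]) ^+ k.+1.
  set b := m / normc P.[0]; have b1 : 1 < b by rewrite ltr_pdivlMr // mul1r.
  have b10 : 0 < b - 1 by rewrite subr_gt0.
  have := archi_boundP (ltW (divr_gt0 (exprn_gt0 (size s) (ltr0n R 2)) b10)).
  set k := Num.bound _ => hk; exists k.
  rewrite ltr_pdivrMr // mulrC in hk.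
  have bern j : 1 + (b - 1) * j%:R <= b ^+ j.
    elim: j => [|j IH]; first by rewrite mulr0 addr0 expr0.
    have bj : 1 <= b ^+ j by rewrite exprn_ege1 // ltW.
    by rewrite -natr1 exprS; nra.
  by have := bern k.+1; rewrite -natr1; nra.
have := key k.+1 isT; rewrite leNgt; apply: contraNT => _.
by move: kP; rewrite expr_div_n ltr_pdivlMr // exprn_gt0.
Qed.
End MinimumModulus.

Section MinimumModulusMore.
Variable R : realType.

Lemma poly_minimum_modulus_at (P : {poly R[i]}) (x0 : R[i]) (r m : R) : 0 < r ->
  (forall x, normc x <= r -> P.[x0 + x] != 0) ->
  (forall x, normc x = r -> m <= normc P.[x0 + x]) -> m <= normc P.[x0].
Proof.
move=> r0 Pn0 Pm.
have E x : (P \Po ('X + x0%:P)).[x] = P.[x0 + x].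
  by rewrite horner_comp !hornerE addrC.
rewrite -[x0]addr0 -E; apply: (poly_minimum_modulus r0) => x; rewrite E; auto.
Qed.

(** Each linear factor [x - z] is [x - x0] itself or stays away from zero. *)
Lemma poly_lower_bound (P : {poly R[i]}) (x0 : R[i]) : P != 0 ->
  exists k : nat, exists r c : R, [/\ 0 < r, 0 < c &
    forall x, normc (x - x0) <= r -> c * normc (x - x0) ^+ k <= normc P.[x]].
Proof.
move=> Pn0; have [s sE] := closed_field_poly_normal P.
have lc : 0 < normc (lead_coef P) by rewrite normc_gt0 lead_coef_eq0.
have [k [r [c [r0 c0 H]]]] : exists k : nat, exists r c : R, [/\ 0 < r, 0 < c &
    forall x, normc (x - x0) <= r ->
      c * normc (x - x0) ^+ k <= normc (\prod_(z <- s) (x - z))].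
  elim: s {sE} => [|z s [k [r [c [r0 c0 H]]]]].
    exists 0%N, 1, 1; split=> // x _.
    by rewrite big_nil normc1 expr0 mulr1.
  have [->|zx0] := eqVneq z x0.
    exists k.+1, r, c; split=> // x xr.
    by rewrite big_cons normcM exprS mulrCA ler_wpM2l ?normc_ge0 ?H.
  have d0 : 0 < normc (z - x0) / 2 by rewrite divr_gt0 // normc_gt0 subr_eq0.
  pose d : R := normc (z - x0) / 2; rewrite -/d in d0.
  exists k, (Num.min r d), (d * c).
  split; [by rewrite lt_min r0 | exact: mulr_gt0 |].
  move=> x; rewrite le_min => /andP[xr xd].
  rewrite big_cons normcM -mulrA ler_pM ?(ltW d0) ?H //.
    by rewrite mulr_ge0 ?(ltW c0) ?exprn_ge0 ?normc_ge0.
  have := normc_dist (z - x0) (x - x0); rewrite opprB addrA subrK => h.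
  have : normc (z - x0) = d + d by rewrite /d -splitr.
  by rewrite (normcC x); lra.
exists k, r, (normc (lead_coef P) * c); split=> // [|x xr]; first exact: mulr_gt0.
rewrite -mulrA [leRHS](_ : _ =
  normc (lead_coef P) * normc (\prod_(z <- s) (x - z))); last first.
  rewrite {1}sE hornerZ horner_prod normcM.
  by under eq_bigr do rewrite hornerXsubC.
by rewrite ler_wpM2l ?normc_ge0 // H.
Qed.

End MinimumModulusMore.

(** * The complex exponential *)

Section Exponential.
Variable R : realType.
Implicit Types (z : R[i]) (t : R).

Lemma cexpD x y : cexp (x + y) = cexp x * cexp y :> R[i].
Proof.
case: x y => [a b] [c d]; rewrite /cexp /= cosD sinD expRD.
by congr (_ +i* _); ring.
Qed.

Lemma cexp0 : cexp 0 = 1 :> R[i].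
Proof. by rewrite /cexp /= cos0 sin0 expR0 mulr1 mulr0. Qed.

Lemma cexpMn z k : cexp (k%:R * z) = cexp z ^+ k.
Proof.
by elim: k => [|k IH]; rewrite ?mul0r ?cexp0 // -natr1 mulrDl mul1r cexpD IH exprSr.
Qed.

Lemma normc_cexp z : normc (cexp z) = expR (complex.Re z).
Proof.
rewrite /normc /cexp !exprMn -mulrDr cos2Dsin2 mulr1 sqrtr_sqr.
by rewrite ger0_norm ?expR_ge0.
Qed.

Lemma normc_cexp_le z : normc (cexp z) <= expR (normc z).
Proof.
rewrite normc_cexp ler_expR (le_trans (ler_norm _)) //; exact: Re_le_normc.
Qed.

Definition cexp_taylor (N : nat) z : R[i] := \sum_(j < N) z ^+ j / j`!%:R.

Lemma is_derive_pow (t : R) N :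
  is_derive t 1 (fun x : R => x ^+ N.+1) (N.+1%:R * t ^+ N).
Proof.
have := is_derive_poly ('X^(N.+1) : {poly R}) t.
rewrite derivXn hornerMn hornerXn mulr_natl /=.
by rewrite (_ : horner _ = fun x => x ^+ N.+1) //; apply/funext => x; rewrite hornerXn.
Qed.

(** Real and imaginary part are differentiated separately, along a real
    parameter. *)
Definition cderive (f : R -> R[i]) (d : R[i]) t :=
  is_derive t 1 (fun x => complex.Re (f x)) (complex.Re d) /\
  is_derive t 1 (fun x => complex.Im (f x)) (complex.Im d).

Lemma cderive_cexp z t : cderive (fun t => cexp (t%:C * z)) (z * cexp (t%:C * z)) t.
Proof.
case: z => a b; rewrite /cderive /cexp /=.
split; apply: is_derive_eq; rewrite /GRing.scale /=; ring.
Qed.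

Lemma cderive_mul (u : R[i]) f d t : cderive f d t -> 
  is_derive t 1 (fun x => complex.Re (u * f x)) (complex.Re (u * d)).
Proof.
case: u => a b [h1 h2].
have -> : (fun x => complex.Re ((a +i* b) * f x)) =
   (fun x => a * complex.Re (f x) - b * complex.Im (f x)).
  by apply/funext => x; case: (f x).
have -> : complex.Re ((a +i* b) * d) = a * complex.Re d - b * complex.Im d.
  by case: d {h1 h2}.
by apply: is_derive_eq.
Qed.

Lemma ReB (x y : R[i]) : complex.Re (x - y) = complex.Re x - complex.Re y.
Proof. by case: x y => [a b] [c d]. Qed.
Lemma ImB (x y : R[i]) : complex.Im (x - y) = complex.Im x - complex.Im y.
Proof. by case: x y => [a b] [c d]. Qed.

Lemma cderive_taylor N z t :
  cderive (fun t => cexp_taylor N.+1 (t%:C * z)) (z * cexp_taylor N (t%:C * z)) t.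
Proof.
elim: N => [|N [IH1 IH2]].
  rewrite /cexp_taylor big_ord0 mulr0.
  under eq_fun do rewrite big_ord_recr big_ord0 /= add0r expr0 fact0 divr1.
  by split; apply: is_derive_eq.
have E x : cexp_taylor N.+2 (x%:C * z) = cexp_taylor N.+1 (x%:C * z) +
     (x ^+ N.+1)%:C * (z ^+ N.+1 / (N.+1)`!%:R).
  by rewrite /cexp_taylor big_ord_recr /= exprMn rmorphXn mulrA.
have E' : z * cexp_taylor N.+1 (t%:C * z) = z * cexp_taylor N (t%:C * z) +
     (N.+1%:R * t ^+ N)%:C * (z ^+ N.+1 / (N.+1)`!%:R).
  rewrite /cexp_taylor big_ord_recr /= mulrDr; congr (_ + _).
  rewrite exprMn exprS factS natrM rmorphM rmorph_nat rmorphXn /=.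
  have h1 : N.+1%:R != 0 :> R[i] by rewrite pnatr_eq0.
  have h2 : N`!%:R != 0 :> R[i] by rewrite pnatr_eq0 -lt0n fact_gt0.
  move: (N.+1%:R : R[i]) (N`!%:R : R[i]) (t%:C : R[i]) h1 h2 => a b c h1 h2.
  by field; rewrite h1 h2.
set w := z ^+ N.+1 / _ in E E' *.
rewrite E' /cderive; split.
  have -> : (fun x => complex.Re (cexp_taylor N.+2 (x%:C * z))) =
      (fun x => complex.Re (cexp_taylor N.+1 (x%:C * z)) + complex.Re w * x ^+ N.+1).
    apply/funext => x; rewrite E; case: w {E E'} => a b; simpc.
    by case: (cexp_taylor _ _) => c d /=; ring.
  have -> : complex.Re (z * cexp_taylor N (t%:C * z) + (N.+1%:R * t ^+ N)%:C * w)
    = complex.Re (z * cexp_taylor N (t%:C * z)) + complex.Re w * (N.+1%:R * t ^+ N).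
    case: w {E E'} => a b; simpc.
    by case: (z * _) => c d /=; ring.
  exact: (is_deriveD IH1 (is_deriveZ _ (is_derive_pow t N))).
have -> : (fun x => complex.Im (cexp_taylor N.+2 (x%:C * z))) =
    (fun x => complex.Im (cexp_taylor N.+1 (x%:C * z)) + complex.Im w * x ^+ N.+1).
  apply/funext => x; rewrite E; case: w {E E'} => a b; simpc.
  by case: (cexp_taylor _ _) => c d /=; ring.
have -> : complex.Im (z * cexp_taylor N (t%:C * z) + (N.+1%:R * t ^+ N)%:C * w)
  = complex.Im (z * cexp_taylor N (t%:C * z)) + complex.Im w * (N.+1%:R * t ^+ N).
  case: w {E E'} => a b; simpc.
  by case: (z * _) => c d /=; ring.
exact: (is_deriveD IH2 (is_deriveZ _ (is_derive_pow t N))).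
Qed.

Lemma ge0_is_derive_le (f f' : R -> R) : (forall t, is_derive t 1 f (f' t)) ->
  (forall t, 0 < t -> t < 1 -> 0 <= f' t) ->
  forall t, 0 <= t -> t <= 1 -> f 0 <= f t.
Proof.
move=> df f'0 t t0 t1.
apply: (@ger0_derive1_le_cc R f 0 1) => //.
- move=> x; rewrite in_itv /= => /andP[x0 x1].
  by rewrite derive1E (@derive_val _ _ _ _ _ _ _ (df x)) f'0.
- apply: continuous_subspaceT => x; apply: differentiable_continuous.
  by apply/derivable1_diffP; case: (df x).
- by rewrite in_itv /= lexx ler01.
- by rewrite in_itv /= t0.
Qed.

(** Testing against phases turns estimates of a modulus into estimates of real
    parts. *)
Lemma exists_phase z : exists2 u : R[i], normc u = 1 & u * z = (normc z)%:C.
Proof.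
have [->|z0] := eqVneq z 0; first by exists 1; rewrite ?normc1 // mulr0 normc0.
have nz : normc z != 0 by rewrite normc_eq0.
have nzC : (normc z)%:C != 0 :> R[i] by rewrite -normc_eq0 normc_real normr_eq0.
exists (z^* / (normc z)%:C).
  by rewrite normcM normcV normc_conj normc_real ger0_norm ?normc_ge0 // divff.
by rewrite mulrAC [_ * z]mulrC mulc_conj rmorphXn /= expr2 mulfK.
Qed.

(** The remainder of order [N.+1] along the segment from [0] to [z] has the
    remainder of order [N] as derivative, up to the factor [z]; testing against
    all phases reduces the integration of this to monotonicity of a real
    function. *)
Lemma cexp_taylor_le N z :
  normc (cexp z - cexp_taylor N z) <= expR (normc z) * normc z ^+ N / N`!%:R.
Proof.
suff H : forall t, 0 <= t -> t <= 1 ->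
    normc (cexp (t%:C * z) - cexp_taylor N (t%:C * z)) <=
    expR (normc z) * (t * normc z) ^+ N / N`!%:R.
  by have := H 1 ler01 (lexx _); rewrite !mul1r.
elim: N => [|N IH] t t0 t1.
  rewrite /cexp_taylor big_ord0 subr0 expr0 fact0 divr1 mulr1.
  apply: le_trans (normc_cexp_le _) _; rewrite ler_expR normcM normc_real ger0_norm //.
  by rewrite ler_piMl ?normc_ge0.
have [u u1 uE] := exists_phase (cexp (t%:C * z) - cexp_taylor N.+1 (t%:C * z)).
pose g (x : R) : R := expR (normc z) * (x * normc z) ^+ N.+1 / (N.+1)`!%:R -
  complex.Re (u * (cexp (x%:C * z) - cexp_taylor N.+1 (x%:C * z))).
pose g' (x : R) : R := normc z * (expR (normc z) * (x * normc z) ^+ N / N`!%:R) -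
  complex.Re (u * (z * cexp (x%:C * z) - z * cexp_taylor N (x%:C * z))).
have dg (x : R) : is_derive x 1 g (g' x).
  have h : cderive (fun x => cexp (x%:C * z) - cexp_taylor N.+1 (x%:C * z))
     (z * cexp (x%:C * z) - z * cexp_taylor N (x%:C * z)) x.
    have [h1 h2] := cderive_cexp z x; have [h3 h4] := cderive_taylor N z x.
    rewrite /cderive; under eq_fun do rewrite ReB; under [X in _ /\ is_derive _ _ X _]eq_fun do rewrite ImB.
    by rewrite ReB ImB; split; apply: is_derive_eq.
  have {}h := cderive_mul u h.
  have := is_deriveB (is_deriveZ (expR (normc z) * normc z ^+ N.+1 / (N.+1)`!%:R) (is_derive_pow x N)) h.
  rewrite [X in is_derive _ _ X _](_ : _ = g); last first.
    apply/funext => y; rewrite /g /= exprMn; congr (_ - _).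
    rewrite -[LHS]/(_ * _).
    by move: (y ^+ _) (normc z ^+ _) (_%:R^-1) (expR _) => a b c d; ring.
  rewrite [X in is_derive _ _ _ X](_ : _ = g' x) //.
  rewrite /g' -[_ *: _]/(_ * _) factS natrM; congr (_ - _).
  have h1 : N.+1%:R != 0 :> R by rewrite pnatr_eq0.
  have h2 : N`!%:R != 0 :> R by rewrite pnatr_eq0 -lt0n fact_gt0.
  rewrite exprMn exprS; move: (N.+1%:R : R) (N`!%:R : R) h1 h2 => a b h1 h2; field.
  by rewrite h1 h2.
have g'0 (x : R) : 0 < x -> x < 1 -> 0 <= g' x.
  move=> x0 x1; rewrite /g' subr_ge0 -mulrBr.
  rewrite (le_trans (ler_norm _)) // (le_trans (Re_le_normc _)) //.
  by rewrite !normcM u1 mul1r ler_wpM2l ?normc_ge0 // IH // ltW.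
have g0 : g 0 = 0.
  rewrite /g !mul0r expr0n /= mulr0 mul0r cexp0 /cexp_taylor big_ord_recl /=.
  rewrite expr0 fact0 divr1 big1 ?addr0 ?subrr ?mulr0 ?subr0 // => j _.
  by rewrite exprS mul0r mul0r.
have := ge0_is_derive_le dg g'0 t0 t1.
by rewrite g0 /g uE subr_ge0.
Qed.

End Exponential.

(** * Rings of complex valued functions *)

Section FunctionRing.
Variables (R : realType) (T : Type).
Implicit Types (S : (T -> R[i]) -> Prop) (f g : T -> R[i]).

(** Determinants and adjugates are formed in rings of polynomials, of Lipschitz
    functions, of uniform limits of polynomials and of continuous functions;
    closure under the ring operations is all that these computations use. *)
Definition fring S : Prop := [/\ forall c, S (fun _ => c),
  forall f g, S f -> S g -> S (fun x => f x + g x) &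
  forall f g, S f -> S g -> S (fun x => f x * g x)].

Definition fmx S (a b : nat) (M : T -> 'M[R[i]]_(a, b)) :=
  forall i j, S (fun x => M x i j).

Variable S : (T -> R[i]) -> Prop.
Hypothesis fS : fring S.

Lemma fring_cst c : S (fun _ => c). Proof. by case: fS. Qed.
Lemma fringD f g : S f -> S g -> S (fun x => f x + g x).
Proof. by case: fS => _ + _; exact. Qed.
Lemma fringM f g : S f -> S g -> S (fun x => f x * g x).
Proof. by case: fS => _ _; exact. Qed.
Lemma fringN f : S f -> S (fun x => - f x).
Proof.
move=> Sf; rewrite (_ : (fun _ => _) = (fun x => -1 * f x)).
  exact: (fringM (fring_cst _)).
by apply/funext => x; rewrite mulN1r.
Qed.
Lemma fringB f g : S f -> S g -> S (fun x => f x - g x).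
Proof. by move=> Sf Sg; apply: (fringD Sf (fringN Sg)). Qed.

Lemma fring_sum (I : Type) (s : seq I) (P : pred I) (F : I -> T -> R[i]) :
  (forall k, S (F k)) -> S (fun x => \sum_(k <- s | P k) F k x).
Proof.
move=> SF; elim: s => [|k s IH].
  by under eq_fun do rewrite big_nil; exact: fring_cst.
under eq_fun do rewrite big_cons.
by case: (P k); [apply: (fringD (SF k) IH) | exact: IH].
Qed.

Lemma fring_prod (I : Type) (s : seq I) (P : pred I) (F : I -> T -> R[i]) :
  (forall k, S (F k)) -> S (fun x => \prod_(k <- s | P k) F k x).
Proof.
move=> SF; elim: s => [|k s IH].
  by under eq_fun do rewrite big_nil; exact: fring_cst.
under eq_fun do rewrite big_cons.
by case: (P k); [apply: (fringM (SF k) IH) | exact: IH].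
Qed.

Lemma fringX f k : S f -> S (fun x => f x ^+ k).
Proof.
move=> Sf; elim: k => [|k IH]; first by under eq_fun do rewrite expr0; exact: fring_cst.
by under eq_fun do rewrite exprS; apply: (fringM Sf IH).
Qed.

Lemma fring_det a (M : T -> 'M[R[i]]_a) : fmx S M -> S (fun x => \det (M x)).
Proof.
move=> SM; apply: fring_sum => s; apply: (fringM (fring_cst _)).
by apply: fring_prod => k; apply: SM.
Qed.

Lemma fmx_cst a b (M : 'M[R[i]]_(a, b)) : fmx S (fun _ => M).
Proof. by move=> i j; apply: fring_cst. Qed.

Lemma fmxD a b (M N : T -> 'M[R[i]]_(a, b)) :
  fmx S M -> fmx S N -> fmx S (fun x => M x + N x).
Proof. by move=> SM SN i j; under eq_fun do rewrite mxE; apply: fringD. Qed.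

Lemma fmxB a b (M N : T -> 'M[R[i]]_(a, b)) :
  fmx S M -> fmx S N -> fmx S (fun x => M x - N x).
Proof. by move=> SM SN i j; under eq_fun do rewrite !mxE; apply: fringB. Qed.

Lemma fmxZ a b f (M : T -> 'M[R[i]]_(a, b)) :
  S f -> fmx S M -> fmx S (fun x => f x *: M x).
Proof. by move=> Sf SM i j; under eq_fun do rewrite mxE; apply: fringM. Qed.

Lemma fmx_sum (I : Type) (s : seq I) (P : pred I) a b
    (M : I -> T -> 'M[R[i]]_(a, b)) :
  (forall k, fmx S (M k)) -> fmx S (fun x => \sum_(k <- s | P k) M k x).
Proof.
by move=> SM i j; under eq_fun do rewrite summxE; apply: fring_sum => k; apply: SM.
Qed.

Lemma fmxM a b c (M : T -> 'M[R[i]]_(a, b)) (N : T -> 'M[R[i]]_(b, c)) :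
  fmx S M -> fmx S N -> fmx S (fun x => M x *m N x).
Proof.
move=> SM SN i j; under eq_fun do rewrite mxE.
by apply: fring_sum => k; apply: fringM.
Qed.

Lemma fmx_adj a (M : T -> 'M[R[i]]_a) : fmx S M -> fmx S (fun x => \adj (M x)).
Proof.
move=> SM i j; under eq_fun do rewrite mxE /cofactor.
apply: (fringM (fring_cst _)); apply: fring_det => k l.
by under eq_fun do rewrite !mxE; apply: SM.
Qed.

End FunctionRing.

(** Polynomials in several variables, seen only through their restrictions to
    the coordinate lines; this is what one-variable arguments applied to one
    coordinate after the other can use. *)
Section CoordinatePolynomial.
Variables (R : realType) (J : eqType).

Definition upd (z : J -> R[i]) (k : J) (x : R[i]) : J -> R[i] :=
  fun j => if j == k then x else z j.

Definition coord_poly (f : (J -> R[i]) -> R[i]) :=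
  forall z k, exists P : {poly R[i]}, forall x, P.[x] = f (upd z k x).

Lemma fring_coord_poly : fring coord_poly.
Proof.
split=> [c z k|f g Sf Sg z k|f g Sf Sg z k].
- by exists c%:P => x; rewrite hornerC.
- have [P PE] := Sf z k; have [Q QE] := Sg z k.
  by exists (P + Q) => x; rewrite hornerD PE QE.
- have [P PE] := Sf z k; have [Q QE] := Sg z k.
  by exists (P * Q) => x; rewrite hornerM PE QE.
Qed.

Lemma coord_poly_var j : coord_poly (fun z => z j).
Proof.
move=> z k; rewrite /upd; have [_|_] := eqVneq j k.
  by exists 'X => x; rewrite hornerX.
by exists (z j)%:P => x; rewrite hornerC.
Qed.

Lemma fring_polyfun : fring (fun f : R[i] -> R[i] => exists P : {poly R[i]}, forall x, P.[x] = f x).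
Proof.
split=> [c|f g [P PE] [Q QE]|f g [P PE] [Q QE]].
- by exists c%:P => x; rewrite hornerC.
- by exists (P + Q) => x; rewrite hornerD PE QE.
- by exists (P * Q) => x; rewrite hornerM PE QE.
Qed.

End CoordinatePolynomial.

(** * Lipschitz functions on bounded sets *)

Section Lipschitz.
Variables (R : realType) (J : Type).
Implicit Types (x y : J -> R[i]) (f g : (J -> R[i]) -> R[i]).

Definition bdd (M : R) x := forall j, normc (x j) <= M.
Definition nearby (d : R) x y := forall j, normc (x j - y j) <= d.

(** The bound on [f] itself is part of the definition because products need it. *)
Definition lip f := forall M : R, exists2 K : R, 0 <= K &
  (forall x, bdd M x -> normc (f x) <= K) /\
  (forall x y (d : R), 0 <= d -> bdd M x -> bdd M y -> nearby d x y ->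
     normc (f x - f y) <= K * d).

Lemma fring_lip : fring lip.
Proof.
split=> [c M|f g Sf Sg M|f g Sf Sg M].
- exists (normc c); first exact: normc_ge0.
  by split=> // x y d d0 _ _ _; rewrite subrr normc0 mulr_ge0 ?normc_ge0.
- have [K K0 [bf lf]] := Sf M; have [K' K'0 [bg lg]] := Sg M.
  exists (K + K'); first exact: addr_ge0.
  split=> [x bx|x y d d0 bx byy xy].
    by rewrite (le_trans (normcD _ _)) // lerD ?bf ?bg.
  rewrite opprD addrACA (le_trans (normcD _ _)) // mulrDl.
  by rewrite lerD ?lf ?lg.
- have [K K0 [bf lf]] := Sf M; have [K' K'0 [bg lg]] := Sg M.
  exists (K * K' + K * K'); first by rewrite addr_ge0 ?mulr_ge0.
  split=> [x bx|x y d d0 bx byy xy].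
    rewrite normcM (@le_trans _ _ (K * K')) ?lerDl ?mulr_ge0 //.
    by rewrite ler_pM ?normc_ge0 ?bf ?bg.
  have -> : f x * g x - f y * g y = (f x - f y) * g x + f y * (g x - g y) by ring.
  rewrite (le_trans (normcD _ _)) // !normcM mulrDl lerD //.
    by rewrite mulrAC ler_pM ?normc_ge0 ?bg ?lf.
  by rewrite -mulrA ler_pM ?normc_ge0 ?bf ?lg.
Qed.

Lemma lip_var j : lip (fun x => x j).
Proof.
move=> M; exists (1 + `|M|); first by rewrite addr_ge0.
split=> [x bx|x y d d0 _ _ xy].
  by rewrite (le_trans (bx j)) // (le_trans (ler_norm M)) // lerDr.
by rewrite (le_trans (xy j)) // ler_peMl // lerDl.
Qed.

(** The difference [exp x - exp y] is [exp y] times [exp (x - y) - 1]. *)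
Lemma lip_cexp f : lip f -> lip (fun x => cexp (f x)).
Proof.
move=> Sf M; have [K K0 [bf lf]] := Sf M.
exists (expR (3 * K) * (1 + K)); first by rewrite mulr_ge0 ?expR_ge0 ?addr_ge0.
split=> [x bx|x y d d0 bx byy xy].
  rewrite (le_trans (normc_cexp_le _)) //.
  rewrite (@le_trans _ _ (expR (3 * K))) ?ler_peMr ?expR_ge0 ?lerDl //.
  by rewrite ler_expR (le_trans (bf _ bx)) // ler_peMl // ler1n.
have -> : cexp (f x) - cexp (f y) = cexp (f y) * (cexp (f x - f y) - 1).
  by rewrite mulrBr mulr1 -cexpD [f y + _]addrC subrK.
have := cexp_taylor_le 1 (f x - f y).
rewrite /cexp_taylor big_ord1 expr0 !fact0 divr1 expr1 divr1 => h.
rewrite normcM (le_trans (ler_wpM2l (normc_ge0 _) h)) //.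
rewrite mulrA -[leRHS]mulrA; apply: ler_pM; rewrite ?mulr_ge0 ?normc_ge0 ?expR_ge0 //.
  have -> : 3 * K = K + (K + K) by ring.
  rewrite expRD ler_pM ?normc_ge0 ?expR_ge0 //.
    by rewrite (le_trans (normc_cexp_le _)) // ler_expR bf.
  by rewrite ler_expR (le_trans (normcB _ _)) // lerD ?bf.
by rewrite (le_trans (lf _ _ _ d0 bx byy xy)) // ler_wpM2r // lerDr.
Qed.

End Lipschitz.

Lemma lip_comp (R : realType) (J : finType) (T : Type)
    (f : (J -> R[i]) -> R[i]) (g : J -> (T -> R[i]) -> R[i]) :
  lip f -> (forall j, lip (g j)) -> lip (fun x => f (fun j => g j x)).
Proof.
move=> lf lg M.
have /choice[k kP] j : exists K : R, 0 <= K /\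
   (forall x, bdd M x -> normc (g j x) <= K) /\
   (forall x y (d : R), 0 <= d -> bdd M x -> bdd M y -> nearby d x y ->
     normc (g j x - g j y) <= K * d).
  by have [K] := lg j M; exists K.
pose N := \sum_j k j.
have kN j : k j <= N.
  by rewrite /N (bigD1 j) //= lerDl sumr_ge0 // => l _; case: (kP l).
have N0 : 0 <= N by rewrite sumr_ge0 // => l _; case: (kP l).
have [K K0 [bf ff]] := lf N.
have gb x : bdd M x -> bdd N (fun j => g j x).
  by move=> bx j; have [_ [h _]] := kP j; rewrite (le_trans (h _ bx)).
exists (K * (1 + N)); first by rewrite mulr_ge0 // addr_ge0.
split=> [x bx|x y d d0 bx byy xy].
  by rewrite (le_trans (bf _ (gb _ bx))) // ler_peMr // lerDl.
rewrite -mulrA; apply: ff; rewrite ?mulr_ge0 ?addr_ge0 //; [exact: gb|exact: gb|].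
move=> j; have [_ [_ h]] := kP j; rewrite (le_trans (h _ _ _ d0 bx byy xy)) //.
by rewrite ler_wpM2r // (le_trans (kN j)) // lerDr.
Qed.

(** * Compactness of polydiscs *)

Section Compactness.
Variables (R : realType) (J : finType).
Implicit Types (x y : J -> R[i]).

(** Real and imaginary parts of all coordinates form one real vector, so that
    compactness of boxes applies. *)
Lemma polydisc_cluster (M : R) (u : nat -> J -> R[i]) :
  (forall k, bdd M (u k)) ->
  exists2 x, bdd M x & forall d : R, 0 < d -> forall k0 : nat,
    exists2 k, (k0 <= k)%N & nearby d (u k) x.
Proof.
move=> ub.
pose e (k : 'I_#|{: J * bool}|) := enum_val k : J * bool.
pose v k : 'rV[R]_(#|{: J * bool}|) := \row_j
  (if (e j).2 then complex.Re (u k (e j).1) else complex.Im (u k (e j).1)).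
have cpt := @rV_compact R _ (fun _ : 'I_#|{: J * bool}| => `[- M, M]%classic)
  (fun _ => @segment_compact R (- M) M).
have FA : (v @ \oo) [set w | forall i, `[- M, M]%classic (w ord0 i)].
  exists 0%N => // k _ i /=; rewrite in_itv /= -ler_norml mxE.
  by case: ifP => _; [apply: le_trans (Re_le_normc _) _ | apply: le_trans (Im_le_normc _) _];
    exact: ub.
have [p [_ pcl]] := cpt (v @ \oo) _ FA.
pose x j : R[i] := (p ord0 (enum_rank (j, true))) +i* (p ord0 (enum_rank (j, false))).
have near (d : R) k0 : 0 < d -> exists2 k, (k0 <= k)%N & nearby d (u k) x.
  move=> d0.
  have [||w [[k k0k <-] wp]] := pcl [set v k | k in [set k | (k0 <= k)%N]] (ball p (d / 2)).
  - by exists k0 => // k /= k0k; exists k.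
  - by apply: nbhsx_ballx; rewrite divr_gt0.
  exists k => // j; have [_ h] := wp.
  have h1 := h ord0 (enum_rank (j, true)).
  have h2 := h ord0 (enum_rank (j, false)).
  rewrite /ball /= !mxE /e !enum_rankK /= in h1 h2.
  rewrite (le_trans (normc_le_ReIm _)) // ReB ImB [d]splitr.
  by rewrite lerD // distrC ltW.
exists x => [j|d d0 k0]; last exact: near.
apply/ler_addgt0Pr => d d0; have [k _ kx] := near d 0%N d0.
have := kx j; rewrite normcC => h.
rewrite -(subrK (u k j) (x j)) addrC (le_trans (normcD _ _)) // lerD //.
exact: ub.
Qed.

(** Otherwise points with values tending to zero would have a cluster point in
    the set, and the function would vanish there. *)
Lemma lip_min (f : (J -> R[i]) -> R[i]) (S : (J -> R[i]) -> Prop) (M : R) :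
  lip f -> (forall x, S x -> bdd M x) ->
  (forall x, bdd M x -> (forall d : R, 0 < d -> exists2 y, S y & nearby d y x) -> S x) ->
  (forall x, S x -> f x != 0) ->
  exists2 c : R, 0 < c & forall x, S x -> c <= normc (f x).
Proof.
move=> lf SM clS fn0; have [K K0 [_ fK]] := lf M.
apply: contrapT => noc.
have /choice[u uP] (k : nat) : exists x, S x /\ normc (f x) < k.+1%:R^-1.
  apply: contrapT => nox; apply: noc; exists k.+1%:R^-1; first by rewrite invr_gt0.
  move=> x Sx; rewrite leNgt; apply/negP => h; apply: nox; by exists x.
have [x bx xcl] := polydisc_cluster (fun k => SM _ (uP k).1).
have Sx : S x.
  by apply: clS => // d d0; have [k _ h] := xcl d d0 0%N; exists (u k) => //; case: (uP k).
have fx : 0 < normc (f x) by rewrite normc_gt0 fn0.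
pose d : R := normc (f x) / (2 * (1 + K)).
have K1 : 0 < 1 + K by rewrite ltr_wpDr.
have d0 : 0 < d by rewrite divr_gt0 // mulr_gt0.
have h2 : 0 < 2 / normc (f x) by rewrite divr_gt0.
have [k kk0 kx] := xcl d d0 (Num.bound (2 / normc (f x))).
have [Sk fk] := uP k.
have := fK _ _ d (ltW d0) (SM _ Sk) bx kx; rewrite normcC => h.
have := normc_dist (f x) (f (u k)) => h'.
have h3 : k.+1%:R^-1 <= normc (f x) / 2 :> R.
  rewrite -[_ / 2]invrK lef_pV2 ?posrE ?invr_gt0 ?divr_gt0 // invf_div.
  rewrite (le_trans (ltW (archi_boundP (ltW h2)))) // ler_nat; exact: leqW.
have h4 : K * d < normc (f x) / 2.
  have : (1 + K) * d = normc (f x) / 2 by rewrite /d; field; rewrite gt_eqF.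
  by nra.
have := lt_le_trans fk h3; clear fk h3; lra.
Qed.

End Compactness.

(** * Uniform limits of polynomials on a disc *)

Section PolynomialApproximation.
Variables (R : realType) (r : R).
Hypothesis r0 : 0 < r.

(** This class takes the place of the holomorphic functions: it is a ring,
    contains the exponentials, and inherits the minimum modulus principle. *)
Definition papp (f : R[i] -> R[i]) := forall e : R, 0 < e ->
  exists P : {poly R[i]}, forall x, normc x <= r -> normc (f x - P.[x]) <= e.

Lemma poly_bounded (P : {poly R[i]}) :
  exists2 K : R, 0 <= K & forall x, normc x <= r -> normc P.[x] <= K.
Proof.
exists (\sum_(j < size P) normc P`_j * r ^+ j).
  by rewrite sumr_ge0 // => j _; rewrite mulr_ge0 ?normc_ge0 ?exprn_ge0 // ltW.
move=> x xr; rewrite horner_coef (le_trans (normc_sum _ _ _)) // ler_sum // => j _.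
rewrite normcM normcX ler_wpM2l ?normc_ge0 //.
by rewrite lerXn2r ?nnegrE ?normc_ge0 // ltW.
Qed.

Lemma papp_poly (P : {poly R[i]}) : papp (fun x => P.[x]).
Proof. by move=> e e0; exists P => x _; rewrite subrr normc0 ltW. Qed.

Lemma fring_papp : fring papp.
Proof.
split=> [c|f g Sf Sg e e0|f g Sf Sg e e0].
- by move=> e e0; exists c%:P => x _; rewrite hornerC subrr normc0 ltW.
- have e2 : 0 < e / 2 by rewrite divr_gt0.
  have [P PE] := Sf _ e2; have [Q QE] := Sg _ e2.
  exists (P + Q) => x xr; rewrite hornerD opprD addrACA (le_trans (normcD _ _)) //.
  by rewrite [e]splitr lerD ?PE ?QE.
- have [Q1 Q1E] := Sg 1 ltr01; have [K K0 KP] := poly_bounded Q1.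
  have gK x : normc x <= r -> normc (g x) <= 1 + K.
    move=> xr; rewrite -(subrK Q1.[x] (g x)) (le_trans (normcD _ _)) //.
    by rewrite lerD ?Q1E ?KP.
  have K1 : 0 < 1 + K by rewrite ltr_wpDr.
  have e1 : 0 < e / 2 / (1 + K) by rewrite !divr_gt0.
  have [P PE] := Sf _ e1; have [L L0 LP] := poly_bounded P.
  have L1 : 0 < 1 + L by rewrite ltr_wpDr.
  have e2 : 0 < e / 2 / (1 + L) by rewrite !divr_gt0.
  have [Q QE] := Sg _ e2; exists (P * Q) => x xr; rewrite hornerM.
  have -> : f x * g x - P.[x] * Q.[x] = (f x - P.[x]) * g x + P.[x] * (g x - Q.[x]).
    by ring.
  rewrite (le_trans (normcD _ _)) // !normcM [e]splitr lerD //.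
    rewrite -[leRHS](divfK (lt0r_neq0 K1)) ler_pM ?normc_ge0 ?PE ?gK //.
  rewrite -[leRHS](divfK (lt0r_neq0 L1)) mulrC ler_pM ?normc_ge0 ?QE //.
  by rewrite (le_trans (LP _ xr)) // lerDr.
Qed.

(** Makes the Taylor remainder and the error of the tau method tend to zero. *)
Lemma exp_coeff_small (b e : R) : 0 < e ->
  exists k0, forall k, (k0 <= k)%N -> b ^+ k / k`!%:R <= e.
Proof.
move=> e0; have := cvg_series_cvg_0 (@is_cvg_series_exp_coeff R b).
move/cvgrPdist_le => /(_ e e0) [k0 _ h]; exists k0 => k kk0.
have := h k kk0; rewrite /= sub0r normrN /exp_coeff /= => h1.
exact: le_trans (ler_norm _) h1.
Qed.

Lemma papp_cexp (c : R[i]) : papp (fun x => cexp (c * x)).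
Proof.
move=> e e0; set b := normc c * r.
have E0 : 0 < e / expR b by rewrite divr_gt0 ?expR_gt0.
have [k kP] := exp_coeff_small b E0.
exists (\sum_(j < k) (c ^+ j / j`!%:R) *: 'X^j) => x xr.
have -> : (\sum_(j < k) (c ^+ j / j`!%:R) *: 'X^j).[x] = cexp_taylor k (c * x).
  rewrite horner_sum; apply: eq_bigr => j _.
  by rewrite hornerZ hornerXn exprMn mulrAC.
have xb : normc (c * x) <= b by rewrite normcM ler_wpM2l ?normc_ge0.
have b0 : 0 <= b by rewrite mulr_ge0 ?normc_ge0 // ltW.
rewrite (le_trans (cexp_taylor_le _ _)) //.
have := kP k (leqnn _); rewrite ler_pdivlMr ?expR_gt0 // => h.
apply: le_trans h; rewrite -mulrA mulrC ler_pM ?expR_ge0 //.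
- by rewrite divr_ge0 ?exprn_ge0 ?normc_ge0.
- by rewrite ler_wpM2r ?invr_ge0 // lerXn2r ?nnegrE ?normc_ge0.
- by rewrite ler_expR.
Qed.

(** The limit function is bounded away from zero on the closed disc, hence so
    are the approximating polynomials, to which the principle applies. *)
Lemma papp_minimum_modulus (f : R[i] -> R[i]) (m : R) :
  papp f -> lip (fun x : unit -> R[i] => f (x tt)) ->
  (forall x, normc x <= r -> f x != 0) ->
  (forall x, normc x = r -> m <= normc (f x)) -> m <= normc (f 0).
Proof.
move=> pf lf fn0 fm.
have [c c0 cP] : exists2 c : R, 0 < c & forall x, normc x <= r -> c <= normc (f x).
  have [|||c c0 cP] := lip_min (S := fun x : unit -> R[i] => normc (x tt) <= r) (M := r) lf.
  - by move=> x xr [].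
  - by move=> x h _; apply: h.
  - by move=> x xr; apply: fn0.
  by exists c => // x xr; apply: (cP (fun _ => x)).
apply/ler_addgt0Pr => /= e e0.
pose d : R := Num.min (e / 2) (c / 2).
have d0 : 0 < d by rewrite lt_min !divr_gt0.
have de : d <= e / 2 by rewrite /d ge_min lexx.
have dc : d <= c / 2 by rewrite /d ge_min lexx orbT.
have [P PE] := pf d d0.
have P0 x : normc x <= r -> P.[x] != 0.
  move=> xr; rewrite -normc_gt0; have := normc_dist (f x) (f x - P.[x]).
  by rewrite subKr; have := cP x xr; have := PE x xr; lra.
have : m - d <= normc P.[0].
  apply: (poly_minimum_modulus r0 P0) => x xr; have := normc_dist (f x) (f x - P.[x]).
  rewrite subKr.
  by have := fm x xr; have := PE x (_ : normc x <= r); rewrite xr lexx => /(_ isT); lra.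
have := normc_dist P.[0] (P.[0] - f 0); rewrite subKr normcC.
by have := PE 0 (_ : normc 0 <= r); rewrite normc0 ltW // => /(_ isT); lra.
Qed.

End PolynomialApproximation.

(** * Zeros of polynomials in polydiscs *)

Section PolydiscZeros.
Variables (R : realType) (J : finType).
Implicit Types (z : J -> R[i]) (f : (J -> R[i]) -> R[i]).

Lemma finite_pos_min (d : J -> R) : (forall j, 0 < d j) ->
  exists2 e : R, 0 < e & forall j, e <= d j.
Proof.
move=> d0; have s0 : 0 <= \sum_j (d j)^-1.
  by rewrite sumr_ge0 // => j _; rewrite invr_ge0 ltW.
exists (1 + \sum_j (d j)^-1)^-1; first by rewrite invr_gt0 ltr_wpDr.
move=> j; rewrite -[leRHS]invrK lef_pV2 ?posrE ?invr_gt0 ?ltr_wpDr //.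
rewrite (bigD1 j) //= addrCA lerDl addr_ge0 // sumr_ge0 // => k _.
by rewrite invr_ge0 ltW.
Qed.

(** If the [k]-th coordinate of a zero lies inside the disc, then shrinking the
    other coordinates a little gives polynomials in that coordinate without
    zeros in the disc, hence by the minimum modulus principle with small values
    on each circle around the old zero; so the limit polynomial vanishes. *)
Lemma push_coordinate f z k : coord_poly f -> lip f ->
  (forall z, (forall j, normc (z j) < 1) -> f z != 0) ->
  (forall j, normc (z j) <= 1) -> f z = 0 ->
  exists2 x, normc x = 1 & f (upd z k x) = 0.
Proof.
move=> pf lf fn0 z1 fz.
have updz : upd z k (z k) = z.
  by apply/funext => j; rewrite /upd; case: eqVneq => [->|].
have [zk|] := leP 1 (normc (z k)).
  by exists (z k); [apply/eqP; rewrite eq_le z1 | rewrite updz].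
move=> zk; have [P PE] := pf z k.
have [P0|Pn0] := eqVneq P 0.
  by exists 1; rewrite ?normc1 // -PE P0 horner0.
exfalso; have [p [r [c [r0 c0 lb]]]] := poly_lower_bound (z k) Pn0.
pose r' : R := Num.min r ((1 - normc (z k)) / 2).
have r'0 : 0 < r' by rewrite lt_min r0 divr_gt0 // subr_gt0.
have r'1 : normc (z k) + r' < 1.
  have : r' <= (1 - normc (z k)) / 2 by rewrite ge_min lexx orbT.
  by lra.
have r'r : r' <= r by rewrite ge_min lexx.
pose m0 : R := c * r' ^+ p.
have m00 : 0 < m0 by rewrite mulr_gt0 ?exprn_gt0.
have [K K0 [_ fK]] := lf 1.
have K1 : 0 < 1 + K by rewrite ltr_wpDr.
pose d : R := Num.min 1 (m0 / (2 * (1 + K))).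
have d0 : 0 < d by rewrite lt_min ltr01 divr_gt0 // mulr_gt0.
have d1 : d <= 1 by rewrite ge_min lexx.
have Kd : 2 * (K * d) < m0.
  have : d <= m0 / (2 * (1 + K)) by rewrite ge_min lexx orbT.
  by rewrite ler_pdivlMr ?mulr_gt0 //; nra.
pose zt j := (1 - d)%:C * z j.
have nzt j : normc (zt j) <= 1 - d.
  rewrite normcM normc_real ger0_norm ?subr_ge0 //.
  by rewrite ler_piMr ?subr_ge0.
have [Q QE] := pf zt k.
have PQ x : normc x <= 1 -> normc (Q.[x] - P.[x]) <= K * d.
  move=> x1; rewrite QE PE; apply: fK; rewrite ?(ltW d0) //.
  - move=> j; rewrite /upd; case: ifP => // _; rewrite (le_trans (nzt j)) //.
    by rewrite gerBl ltW.
  - by move=> j; rewrite /upd; case: ifP.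
  move=> j; rewrite /upd; case: ifP => _; first by rewrite subrr normc0 ltW.
  rewrite /zt rmorphB rmorph1 mulrBl mul1r addrC addKr normcN normcM normc_real.
  by rewrite gtr0_norm // ler_piMr // ltW.
have Q0 x : normc x <= r' -> Q.[z k + x] != 0.
  move=> xr; rewrite QE fn0 // => j; rewrite /upd; case: ifP => _.
    by rewrite (le_lt_trans (normcD _ _)) // (le_lt_trans _ r'1) // lerD2l.
  by rewrite (le_lt_trans (nzt j)) // ltrBlDr ltrDl.
have : m0 - K * d <= normc Q.[z k].
  apply: (poly_minimum_modulus_at r'0 Q0) => x xr.
  have x1 : normc (z k + x) <= 1.
    by rewrite (le_trans (normcD _ _)) // xr ltW.
  have := lb (z k + x); rewrite [z k + x - z k]addrC addKr xr => /(_ r'r) h1.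
  have := PQ _ x1; have := normc_dist P.[z k + x] (P.[z k + x] - Q.[z k + x]).
  by rewrite subKr normcC -/m0 in h1 *; lra.
have := PQ _ (z1 k); rewrite [P.[_]]PE updz fz subr0.
by lra.
Qed.

(** The coordinates are moved to the unit circle one after the other. *)
Lemma push_to_torus f z : coord_poly f -> lip f ->
  (forall z, (forall j, normc (z j) < 1) -> f z != 0) ->
  (forall j, normc (z j) <= 1) -> f z = 0 ->
  exists2 z', (forall j, normc (z' j) = 1) & f z' = 0.
Proof.
move=> pf lf fn0 z1 fz.
suff [z' [_ h h']] : exists z', [/\ forall j, normc (z' j) <= 1,
    forall j, j \in enum J -> normc (z' j) = 1 & f z' = 0].
  by exists z' => // j; rewrite h // mem_enum.
elim: (enum J) => [|k s [w [w1 ws fw]]]; first by exists z.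
have [x x1 fx] := push_coordinate k pf lf fn0 w1 fw.
exists (upd w k x); split=> // j; rewrite /upd; first by case: ifP => // _; rewrite x1.
by rewrite inE; case: eqVneq => //= _ /ws.
Qed.

Lemma pow_lip (k : nat) (M : R) : exists2 K : R, 0 <= K &
  forall a b : R, 0 <= a <= M -> 0 <= b <= M -> a ^+ k - b ^+ k <= K * `|a - b|.
Proof.
have [K K0 [_ h]] := fringX (fring_lip R unit) k (lip_var tt) M.
exists K => // a b /andP[a0 aM] /andP[b0 bM].
have := h (fun _ => a%:C) (fun _ => b%:C) `|a - b| (normr_ge0 _).
rewrite /bdd /nearby /= -!rmorphXn -!rmorphB !normc_real => h'.
by apply: le_trans (ler_norm _) (h' _ _ _) => // _; rewrite ger0_norm.
Qed.

(** The radius is the smallest one whose weighted polydisc contains a zero;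
    the zero can then be moved to the distinguished boundary. *)
Lemma zero_on_weighted_torus f (w : J -> nat) z : coord_poly f -> lip f ->
  (forall j, (0 < w j)%N) -> f (fun _ => 0) != 0 ->
  (forall j, normc (z j) <= 1) -> f z = 0 ->
  exists a : R, exists z', [/\ 0 < a, a <= 1,
    forall j, normc (z' j) = a ^+ w j & f z' = 0].
Proof.
move=> pf lf w0 f0 z1 fz.
pose A : set R := [set a | 0 <= a <= 1 /\
  exists2 z, forall j, normc (z j) <= a ^+ w j & f z = 0].
have A1 : A 1.
  by split; [rewrite ler01 lexx | exists z => // j; rewrite expr1n].
have infA : has_inf A by split; [exists 1 | exists 0 => a [/andP[]]].
pose a := inf A.
have a0 : 0 <= a by apply: lb_le_inf; [exists 1 | move=> b [/andP[]]].
have a1 : a <= 1 by apply: ge_inf => //; case: infA.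
(* the infimum is attained, by compactness *)
have [z' z'a fz'] : exists2 z, forall j, normc (z j) <= a ^+ w j & f z = 0.
  have /choice[u uP] (k : nat) : exists u : J -> R[i],
     f u = 0 /\ exists b : R, [/\ a <= b, b <= 1, b <= a + k.+1%:R^-1 &
       forall j, normc (u j) <= b ^+ w j].
    have k0 : 0 < k.+1%:R^-1 :> R by rewrite invr_gt0.
    have [b [/andP[b0 b1] [v vb fv]] ba] := inf_adherent k0 infA.
    exists v; split=> //; exists b; split=> //; last exact: ltW.
    by apply: ge_inf; [case: infA | split; [rewrite b0 | exists v]].
  have ub k : bdd 1 (u k).
    move=> j; have [_ [b [ab b1 _ h]]] := uP k; rewrite (le_trans (h j)) //.
    by rewrite exprn_ile1 // (le_trans a0).
  have [x x1 xcl] := polydisc_cluster ub.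
  have [K K0 [_ fK]] := lf 1.
  exists x; last first.
    apply/eqP; rewrite -normc_eq0 eq_le normc_ge0 andbT.
    apply/ler_addgt0Pr => e e0; rewrite add0r.
    have K1 : 0 < 1 + K by rewrite ltr_wpDr.
    have d0 : 0 < e / (1 + K) by rewrite divr_gt0.
    have [k _ kx] := xcl _ d0 0%N.
    have := fK _ _ _ (ltW d0) (ub k) x1 kx; rewrite (uP k).1 sub0r normcN.
    move/le_trans; apply; rewrite mulrCA ler_piMr ?(ltW e0) //.
    by rewrite ler_pdivrMr // mul1r lerDr.
  move=> j; apply/ler_addgt0Pr => e e0.
  have [L L0 hL] := pow_lip (w j) 1.
  have e2 : 0 < e / 2 by rewrite divr_gt0.
  have L1 : 0 < 1 + L by rewrite ltr_wpDr.
  have bnd0 : 0 < (1 + L) / (e / 2) by rewrite divr_gt0.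
  have [k kb kx] := xcl _ e2 (Num.bound ((1 + L) / (e / 2))).
  have [_ [b [ab b1 bk h]]] := uP k.
  have := normcD (x j - u k j) (u k j); rewrite subrK normcC => h1.
  have h2 := kx j; have h3 := h j.
  have h4 : b ^+ w j - a ^+ w j <= L * `|b - a|.
    by apply: hL; rewrite ?a0 ?(le_trans a0 ab).
  have h5 : L * `|b - a| <= e / 2.
    have k0 : 0 < k.+1%:R :> R by [].
    have : `|b - a| <= k.+1%:R^-1 by rewrite ger0_norm ?subr_ge0 // lerBlDl.
    have : (1 + L) / (e / 2) <= k.+1%:R.
      rewrite (le_trans (ltW (archi_boundP (ltW bnd0)))) // ler_nat; exact: leqW.
    rewrite ler_pdivrMr // => h6 h7.
    have : L * `|b - a| <= L * k.+1%:R^-1 by rewrite ler_wpM2l.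
    move/le_trans; apply; rewrite ler_pdivrMr // mulrC (le_trans _ h6) //.
    by rewrite lerDr.
  move: h5 h4 h3 h2 h1; clear; lra.
have agt0 : 0 < a.
  rewrite lt_def a0 andbT; apply/eqP => aE; move: f0; rewrite (_ : (fun _ => 0) = z') ?fz' ?eqxx //.
  apply/funext => j; apply/esym/eqP; rewrite -normc_eq0 eq_le normc_ge0 andbT.
  by rewrite (le_trans (z'a j)) // aE expr0n gtn_eqF.
(* a zero with strict inequalities would allow a smaller radius *)
have inter v : (forall j, normc (v j) < a ^+ w j) -> f v != 0.
  move=> va; apply/negP => /eqP fv.
  have /choice[d dP] j : exists d : R, 0 < d /\
     forall e : R, 0 <= e -> e <= d -> e <= a -> normc (v j) <= (a - e) ^+ w j.
    have [L L0 hL] := pow_lip (w j) 1.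
    have L1 : 0 < 1 + L by rewrite ltr_wpDr.
    exists ((a ^+ w j - normc (v j)) / (1 + L)).
    split=> [|e e0]; first by rewrite divr_gt0 // subr_gt0.
    rewrite ler_pdivlMr // => h ea.
    have := hL a (a - e); rewrite a0 a1 subr_ge0 ea lerBlDr.
    rewrite (le_trans a1) ?lerDl // => /(_ isT isT).
    rewrite subKr ger0_norm //.
    by move: h; nra.
  have [e e0 ed] := finite_pos_min (fun j => (dP j).1).
  pose e' : R := Num.min e a.
  have e'0 : 0 < e' by rewrite lt_min e0.
  have e'a : e' <= a by rewrite ge_min lexx orbT.
  have e'e : e' <= e by rewrite ge_min lexx.
  suff : a <= a - e' by rewrite leNgt ltrBlDr ltrDl e'0.
  apply: ge_inf; first by case: infA.
  split; first by rewrite subr_ge0 e'a lerBlDr (le_trans a1) // lerDl ltW.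
  exists v => // j; apply: (dP j).2 => //; first exact: ltW.
  exact: le_trans e'e (ed j).
pose g v := f (fun j => (a ^+ w j)%:C * v j).
have aw j : 0 < a ^+ w j by rewrite exprn_gt0.
have awC j : (a ^+ w j)%:C != 0 :> R[i].
  by rewrite -normc_eq0 normc_real normr_eq0 gt_eqF.
have ng v j : normc ((a ^+ w j)%:C * v j) = a ^+ w j * normc (v j).
  by rewrite normcM normc_real gtr0_norm.
have [|||||v v1 gv] := @push_to_torus g (fun j => z' j / (a ^+ w j)%:C).
- move=> v k; have [P PE] := pf (fun j => (a ^+ w j)%:C * v j) k.
  exists (P \Po ((a ^+ w k)%:C *: 'X)) => x.
  rewrite horner_comp !hornerE PE /g; congr f; apply/funext => j; rewrite /upd.
  by case: eqVneq => [->|].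
- apply: lip_comp => // j; apply: (fringM (fring_lip _ _)); last exact: lip_var.
  exact: (fring_cst (fring_lip _ _)).
- move=> v v1; apply: inter => j; rewrite ng -[ltRHS]mulr1 ltr_pM2l //.
- move=> j; rewrite normcM normcV normc_real gtr0_norm //.
  by rewrite ler_pdivrMr ?mul1r.
- rewrite /g -[RHS]fz'; congr f; apply/funext => j.
  by rewrite mulrCA divff // mulr1.
exists a, (fun j => (a ^+ w j)%:C * v j); split=> // j.
by rewrite ng v1 mulr1.
Qed.

(** Freeing one coordinate at a time gives one-variable polynomials with too
    many roots. *)
Lemma coord_poly_eq0 f (S : R[i] -> Prop) : coord_poly f ->
  (forall k, exists s : seq R[i], [/\ uniq s, size s = k & forall x, x \in s -> S x]) ->
  (forall z, (forall j, S (z j)) -> f z = 0) -> forall z, f z = 0.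
Proof.
move=> pf Sinf f0 z.
suff H (s : seq J) z' : (forall j, j \notin s -> S (z' j)) -> f z' = 0.
  by apply: (H (enum J)) => j; rewrite mem_enum.
elim: s z' => [|k s IH] z' h; first by apply: f0 => j; apply: h.
have [P PE] := pf z' k.
have -> : z' = upd z' k (z' k).
  by apply/funext => j; rewrite /upd; case: eqVneq => [->|].
rewrite -PE; suff -> : P = 0 by rewrite horner0.
have [rs [urs srs rsS]] := Sinf (size P).
apply: (roots_geq_poly_eq0 _ urs); last by rewrite srs.
apply/allP => x xrs; rewrite /root PE; apply/eqP; apply: IH => j js.
rewrite /upd; case: eqVneq => [_|jk]; first exact: rsS.
by apply: h; rewrite inE negb_or jk.
Qed.

End PolydiscZeros.

(** * The transfer function as a rational function of the delay exponentials *)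

Section Pencil.
Variables (R : realType) (n p q m : nat).
Variables (E A0 : 'M[R[i]]_n) (A : 'I_m.+1 -> 'M[R[i]]_n).
Variables (B : 'M[R[i]]_(n, p)) (C : 'M[R[i]]_(q, n)).
Variables (r : nat) (L W : 'M[R[i]]_n).
Implicit Types (s x y : R[i]) (z : 'I_m.+1 -> R[i]).

Definition delay_sum z : 'M[R[i]]_n := A0 + \sum_k z k *: A k.

(** The characteristic matrix, with the exponentials of the delays replaced by
    free variables: both the delay system and its discretization are obtained
    by substitution. *)
Definition exp_mx s z : 'M[R[i]]_n := s *: E - delay_sum z.

Lemma charmxE (theta : 'rV[R]_m.+1) s :
  charmx E A0 A theta s = exp_mx s (fun k => cexp (- ((theta 0 k)%:C * s))).
Proof. by rewrite /charmx /exp_mx /delay_sum opprD addrA. Qed.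

(** In suitable bases, [E] is the partial identity [Pd], and [Pa] projects on
    the algebraic equations. *)
Definition Pd : 'M[R[i]]_n := pid_mx r.
Definition Pa : 'M[R[i]]_n := 1%:M - Pd.
Definition Mid z : 'M[R[i]]_n := invmx L *m delay_sum z *m invmx W.

Hypotheses (uL : L \in unitmx) (uW : W \in unitmx) (rn : (r <= n)%N).
Hypothesis E_bases : E = L *m Pd *m W.

Lemma bases_E : invmx L *m E *m invmx W = Pd.
Proof. by rewrite E_bases !mulmxA mulVmx // mul1mx mulmxK. Qed.

Lemma PdPd : Pd *m Pd = Pd.
Proof. by rewrite /Pd pid_mx_id. Qed.

Lemma PdPa : Pd *m Pa = 0.
Proof. by rewrite mulmxBr mulmx1 PdPd subrr. Qed.

Lemma PaPd : Pa *m Pd = 0.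
Proof. by rewrite mulmxBl mul1mx PdPd subrr. Qed.

Lemma PaPa : Pa *m Pa = Pa.
Proof. by rewrite /Pa mulmxBr mulmx1 -/Pa PaPd subr0. Qed.

(** The weight [x] acts on the differential equations only; with [x = s^-1]
    it compensates the growth of [s E]. *)
Definition scaling x : 'M[R[i]]_n := x *: Pd + Pa.

Lemma scaling_unit x : x != 0 -> scaling x \in unitmx.
Proof.
move=> x0; suff /mulmx1_unit[] : scaling x *m scaling x^-1 = 1%:M by [].
rewrite /scaling mulmxDl (mulmxDr (_ *: _)) (mulmxDr Pa) -!scalemxAl -!scalemxAr PdPd PdPa PaPd PaPa.
by rewrite !scaler0 add0r addr0 scalerA divff // scale1r addrC subrK.
Qed.

(** [sysmx (x * s) x z] is [scaling x] times the pencil [s E - A(z)] in the new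
    bases: at [x = 1] it is the pencil itself, at [x = s^-1] it remains bounded
    when [s] goes to infinity. *)
Definition sysmx y x z : 'M[R[i]]_n := y *: Pd - scaling x *m Mid z.

Lemma sysmxE s x z : sysmx (x * s) x z =
  scaling x *m invmx L *m exp_mx s z *m invmx W.
Proof.
rewrite /sysmx /exp_mx mulmxBr mulmxBl; congr (_ - _); last first.
  by rewrite /Mid !mulmxA.
rewrite -scalemxAr -scalemxAl -!mulmxA [invmx _ *m _]mulmxA bases_E.
by rewrite mulmxDl -scalemxAl PdPd PaPd addr0 scalerA mulrC.
Qed.

Lemma sysmx_unit s x z : x != 0 ->
  (sysmx (x * s) x z \in unitmx) = (exp_mx s z \in unitmx).
Proof.
move=> x0; rewrite sysmxE !unitmx_mul !unitmx_inv scaling_unit //.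
by rewrite uL uW andbT.
Qed.

(** The adjugate makes the entries polynomial in [y], [x] and [z], even where
    the system is singular. At [y = 1], [x = 0] this is the determinant times
    the limit of the transfer function at infinity, the direct feedthrough. *)
Definition numer y x z : 'M[R[i]]_(q, p) :=
  C *m invmx W *m \adj (sysmx y x z) *m scaling x *m
    invmx L *m B.

Lemma invmx_mul k (M N : 'M[R[i]]_k) : M \in unitmx -> N \in unitmx ->
  invmx (M *m N) = invmx N *m invmx M.
Proof.
move=> uM uN; apply: (can_inj (mulKmx (_ : M *m N \in unitmx))).
  by rewrite unitmx_mul uM.
by rewrite mulmxV ?unitmx_mul ?uM // mulmxA mulmxK // mulmxV.
Qed.

Lemma transferE s x z : x != 0 -> exp_mx s z \in unitmx ->
  C *m invmx (exp_mx s z) *m B =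
  (\det (sysmx (x * s) x z))^-1 *: numer (x * s) x z.
Proof.
move=> x0 uM; have uS : sysmx (x * s) x z \in unitmx by rewrite sysmx_unit.
have -> : exp_mx s z = L *m invmx (scaling x) *m sysmx (x * s) x z *m W.
  rewrite sysmxE !mulmxA mulmxKV // mulmxKV ?scaling_unit // mulmxV //.
  by rewrite mul1mx.
rewrite /numer !invmx_mul ?unitmx_mul ?unitmx_inv ?uL ?uW ?uS ?scaling_unit //.
rewrite invmxK [invmx (sysmx _ _ _)]/invmx uS -!(scalemxAr, scalemxAl).
by rewrite !mulmxA.
Qed.

(** The value at infinity of the normalized pencil: up to a factor, the
    determinant of the algebraic equations, a polynomial in the delay factors. *)
Definition alg_det z := \det (sysmx 1 0 z).

(** A vector annihilated by the algebraic part lies in the kernel of [E] and is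
    mapped by [A0] into the range of [E], so that it must vanish. *)
Lemma index_le1_det : index_le1 E A0 -> alg_det (fun _ => 0) != 0.
Proof.
move=> ind; apply/negP; rewrite /alg_det -det_tr => /det0P [v v0 hv].
pose x := v^T.
have sumE : delay_sum (fun _ => 0) = A0.
  by rewrite /delay_sum big1 ?addr0 // => k _; rewrite scale0r.
have {hv} hx : sysmx 1 0 (fun _ => 0) *m x = 0.
  by apply: trmx_inj; rewrite trmx_mul trmxK hv trmx0.
have hx' : Pd *m x = Pa *m Mid (fun _ => 0) *m x.
  apply/eqP; rewrite -subr_eq0 -mulmxBl -hx /sysmx /scaling scale0r add0r.
  by rewrite scale1r.
have Pdx : Pd *m x = 0.
  by rewrite -PdPd -mulmxA hx' !mulmxA PdPa !mul0mx.
have PaMx : Pa *m Mid (fun _ => 0) *m x = 0 by rewrite -hx'.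
pose y := invmx W *m x.
have Ey : E *m y = 0.
  by rewrite E_bases /y !mulmxA mulmxK // -mulmxA Pdx mulmx0.
have ex_base (K : 'M[R[i]]_n) e : \rank K = e ->
    exists2 K' : 'M[R[i]]_(e, n), row_free K' & (K' == K)%MS.
  by move=> <-; exists (row_base K); [exact: row_base_free | apply/eqmxP; exact: eq_row_base].
have [VT freeV eqV] := ex_base (kermx E^T) (n - \rank E)%N
  (etrans (mxrank_ker _) (congr1 _ (mxrank_tr _))).
have [U freeU eqU] := ex_base (kermx E) _ (mxrank_ker _).
have uUAV : U *m A0 *m VT^T \in unitmx.
  apply: ind; rewrite /columns_basis_ker ?trmxK.
    by rewrite freeV.
  by rewrite !map_trmx !trmxK row_free_map freeU -map_kermx !map_submx eqU.
have UE : U *m E = 0 by apply/sub_kermxP; case/andP: eqU.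
have [c yE] : exists c, y = VT^T *m c.
  have : (y^T <= VT)%MS.
    case/andP: eqV => _; apply: submx_trans; apply/sub_kermxP.
    by rewrite -trmx_mul Ey trmx0.
  case/submxP => D yD; exists D^T.
  by apply: trmx_inj; rewrite yD trmx_mul !trmxK.
have ULPd : U *m L *m Pd = 0.
  have h : U *m (L *m Pd *m W) = 0 by rewrite -E_bases.
  rewrite !mulmxA in h.
  by rewrite -[LHS](mulmxK uW) h mul0mx.
have UAy : U *m A0 *m y = 0.
  have -> : U *m A0 *m y = U *m L *m (Mid (fun _ => 0) *m x).
    by rewrite /Mid sumE /y !mulmxA mulmxK.
  rewrite -[U *m _]mulmx1 (_ : 1%:M = Pd + Pa); last by rewrite addrC subrK.
  by rewrite mulmxDr ULPd add0r -mulmxA [Pa *m _]mulmxA PaMx mulmx0.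
have c0 : c = 0.
  have h : U *m A0 *m VT^T *m c = 0 by rewrite -mulmxA -yE.
  by rewrite -(mulKmx uUAV c) h mulmx0.
have x0 : x = 0 by rewrite -[x](mulKVmx uW) -/y yE c0 !mulmx0.
by case/negP: v0; rewrite -[v]trmxK -/x x0 trmx0.
Qed.

Section Regularity.
Variables (T : Type) (S : (T -> R[i]) -> Prop).
Variables (fy fx : T -> R[i]) (fz : T -> 'I_m.+1 -> R[i]).
Hypotheses (fS : fring S) (Sy : S fy) (Sx : S fx) (Sz : forall k, S (fz^~ k)).

Lemma fmx_scaling : fmx S (fun t => scaling (fx t)).
Proof. by apply: (fmxD fS _ (fmx_cst fS _)); apply: (fmxZ fS Sx (fmx_cst fS _)). Qed.

Lemma fmx_delay_sum : fmx S (fun t => delay_sum (fz t)).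
Proof.
apply: (fmxD fS (fmx_cst fS _)); apply: (fmx_sum fS) => k.
exact: (fmxZ fS (Sz k) (fmx_cst fS _)).
Qed.

Lemma fmx_sysmx : fmx S (fun t => sysmx (fy t) (fx t) (fz t)).
Proof.
apply: (fmxB fS); first exact: (fmxZ fS Sy (fmx_cst fS _)).
apply: (fmxM fS); first exact: fmx_scaling.
apply: (fmxM fS _ (fmx_cst fS _)); apply: (fmxM fS (fmx_cst fS _)).
exact: fmx_delay_sum.
Qed.

Lemma fring_sysdet : S (fun t => \det (sysmx (fy t) (fx t) (fz t))).
Proof. exact: (fring_det fS fmx_sysmx). Qed.

Lemma fmx_numer : fmx S (fun t => numer (fy t) (fx t) (fz t)).
Proof.
apply: (fmxM fS _ (fmx_cst fS _)); apply: (fmxM fS _ (fmx_cst fS _)).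
apply: (fmxM fS _ fmx_scaling); apply: (fmxM fS (fmx_cst fS _)).
exact: (fmx_adj fS fmx_sysmx).
Qed.

End Regularity.

End Pencil.

(** * Nonvanishing of the algebraic part on the polydisc *)

Section Phases.
Variable R : realType.
Implicit Types (x y : R) (u : R[i]).

Lemma normc_le_dist (z z' : R[i]) : normc z <= normc z' + normc (z' - z).
Proof. by have := normcB z' (z' - z); rewrite subKr. Qed.

Lemma cexp_2pi_natN (k : nat) : cexp (0 +i* (- (2 * pi * k%:R))) = 1 :> R[i].
Proof.
have -> : 0 +i* (- (2 * pi * k%:R)) = k%:R * (0 +i* (- (2 * pi))) :> R[i].
  by rewrite -(rmorph_nat (real_complex R)); simpc; congr (_ +i* _); ring.
rewrite cexpMn /cexp /= expR0 !mul1r cosN sinN.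
by rewrite mulr_natl cos2pi sin2pi oppr0 expr1n.
Qed.

(** The argument is the arc cosine of the real part, up to sign. *)
Lemma polar u : normc u = 1 -> exists y, u = cexp (0 +i* y).
Proof.
move=> u1; have a1 := Re_le_normc u; have s1 := normc_sqr u.
rewrite u1 expr1n in s1; rewrite u1 ler_norml in a1.
have ca : cos (acos (complex.Re u)) = complex.Re u by apply: acosK; rewrite in_itv.
have sa : sin (acos (complex.Re u)) ^+ 2 = complex.Im u ^+ 2.
  have := cos2Dsin2 (acos (complex.Re u)); rewrite ca {}s1 => /addrI; exact.
case: u {u1 s1 a1} ca sa => a b /= ca /eqP; rewrite eqf_sqr => /orP[] /eqP sa.
  by exists (acos a); rewrite /cexp /= expR0 !mul1r ca sa.
by exists (- acos a); rewrite /cexp /= expR0 !mul1r cosN sinN ca sa opprK.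
Qed.

(** Changing a delay by [2 pi / om] does not change its phase at the frequency
    [om], so that the choice of delays is arbitrarily fine at high frequencies. *)
Lemma delays_with_phases (I : finType) (t phi : I -> R) (e : R) :
  (forall k, 0 < t k) -> 0 < e ->
  exists Om : R, forall om, Om <= om -> exists th : I -> R, forall k,
    `|th k - t k| <= e /\ cexp (0 +i* (- (om * th k))) = cexp (0 +i* (- phi k)).
Proof.
move=> t0 e0; have pi2 : 0 < 2 * pi :> R by rewrite mulr_gt0 ?pi_gt0.
pose Om := 1 + 2 * pi / e + \sum_k `|phi k| / t k; exists Om => om Omom.
have s0 : 0 <= \sum_k `|phi k| / t k.
  by rewrite sumr_ge0 // => k _; rewrite divr_ge0 // ltW.
have pe0 : 0 < 2 * pi / e by rewrite divr_gt0.
have om0 : 0 < om by apply: lt_le_trans Omom; rewrite /Om; lra.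
have pk k : 0 <= (om * t k - phi k) / (2 * pi).
  rewrite divr_ge0 ?(ltW pi2) // subr_ge0 (le_trans (ler_norm _)) // -ler_pdivrMr //.
  apply: le_trans Omom; rewrite /Om (bigD1 k) //= addrCA lerDl.
  rewrite addr_ge0 // ?sumr_ge0 // => [|j _]; first by lra.
  by rewrite divr_ge0 // ltW.
pose j k := Num.truncn ((om * t k - phi k) / (2 * pi)).
exists (fun k => (phi k + 2 * pi * (j k)%:R) / om) => k; split.
  have /andP[h1 h2] := truncn_itv (pk k); rewrite -/(j k) in h1 h2.
  rewrite ler_pdivlMr // in h1; rewrite ltr_pdivrMr // -natr1 in h2.
  have -> : (phi k + 2 * pi * (j k)%:R) / om - t k =
     (phi k + 2 * pi * (j k)%:R - om * t k) / om by field; rewrite gt_eqF.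
  rewrite normrM normfV (gtr0_norm om0) ler_pdivrMr //.
  have : 2 * pi <= e * om.
    rewrite [e * om]mulrC -ler_pdivrMr //; apply: le_trans Omom; rewrite /Om; lra.
  move: h1 h2; move: (j k)%:R => x h1 h2 h3.
  rewrite ler_norml; apply/andP; split; nra.
have -> : om * ((phi k + 2 * pi * (j k)%:R) / om) = phi k + 2 * pi * (j k)%:R.
  by field; rewrite gt_eqF.
set a := 2 * pi * _.
have -> : 0 +i* (- (phi k + a)) = (0 +i* (- phi k)) + (0 +i* (- a)) :> R[i].
  by apply/eqP; rewrite eq_complex /= addr0 opprD !eqxx.
by rewrite cexpD cexp_2pi_natN mulr1.
Qed.

Lemma cexp_sub1 (z : R[i]) : normc z <= 2^-1 ->
  normc z / 2 <= normc (cexp z - 1) /\ normc (cexp z - 1) <= 2 * normc z.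
Proof.
move=> z2; have := cexp_taylor_le 2 z.
rewrite /cexp_taylor big_ord_recr big_ord1 /= expr0 expr1 !fact0 !divr1.
have -> : (2`!)%:R = 2 :> R by [].
have e2 : expR (normc z) <= 2.
  have h : 1 - 2^-1 <= expR (- normc z).
    by apply: le_trans (expR_ge1Dx _); rewrite lerD2l lerN2.
  rewrite expRN in h; rewrite -[leRHS]invrK -[leLHS]invrK lef_pV2 ?posrE ?invr_gt0 ?expR_gt0 //.
  by apply: le_trans h; lra.
move=> h; have {}h : normc (cexp z - (1 + z)) <= normc z ^+ 2.
  rewrite (le_trans h) // ler_pdivrMr // mulrC ler_wpM2l ?exprn_ge0 ?normc_ge0 //.
have z0 := normc_ge0 z.
have h1 : normc (cexp z - 1) <= normc (cexp z - (1 + z)) + normc z.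
  by have := normcD (cexp z - (1 + z)) z; rewrite opprD addrA subrK.
have h2 : normc z <= normc (cexp z - 1) + normc (cexp z - (1 + z)).
  have := normcB (cexp z - 1) (cexp z - (1 + z)).
  by rewrite (_ : cexp z - 1 - (cexp z - (1 + z)) = z) //; ring.
by split; nra.
Qed.

End Phases.

Section DelayBall.
Variables (R : realType) (n p q m : nat).
Variables (E A0 : 'M[R[i]]_n) (A : 'I_m.+1 -> 'M[R[i]]_n).
Implicit Types th tau : 'rV[R]_m.+1.

(** A box is more convenient than the Euclidean ball for changing the delays
    one by one. *)
Lemma delay_ball_box tau (d : R) : 0 < d -> (forall k, 0 < tau 0 k) ->
  exists2 e : R, 0 < e & forall th, (forall k, `|th 0 k - tau 0 k| <= e) ->
    delay_ball tau d th /\ forall k, 0 < th 0 k.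
Proof.
move=> d0 t0.
have [e1 e10 et] := finite_pos_min t0.
pose e : R := Num.min (e1 / 2) (d / m.+2%:R).
have e0 : 0 < e by rewrite lt_min !divr_gt0.
exists e => // th thb.
have th0 k : 0 < th 0 k.
  have : e <= e1 / 2 by rewrite ge_min lexx.
  have := thb k; have := et k; rewrite ler_norml; lra.
split=> //; split=> [k|]; first exact: ltW.
rewrite -[ltRHS](ger0_norm (ltW d0)) -sqrtr_sqr ltr_sqrt ?exprn_gt0 //.
apply: (@le_lt_trans _ _ (\sum_(k < m.+1) (d / m.+2%:R) ^+ 2)).
  apply: ler_sum => k _; rewrite -real_normK ?num_real // lerXn2r ?nnegrE ?divr_ge0 ?(ltW d0) //.
  by rewrite (le_trans (thb k)) // ge_min lexx orbT.
rewrite sumr_const card_ord -[ltLHS]mulr_natl exprMn mulrCA.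
rewrite -[ltRHS]mulr1 ltr_pM2l ?exprn_gt0 // exprVn ltr_pdivrMr ?exprn_gt0 //.
by rewrite mul1r -natrX ltr_nat -mulnn (@leq_trans m.+2) // leq_pmulr.
Qed.

(** The abscissae are bounded by a negative number, so that a whole strip to
    the left of the imaginary axis is free of roots. *)
Lemma stable_zero_free tau : strongly_exp_stable E A0 A tau ->
  exists d e : R, [/\ 0 < d, 0 < e & forall th s, delay_ball tau d th ->
    - e <= complex.Re s -> \det (charmx E A0 A th s) != 0].
Proof.
case=> d d0 sup0.
have [e e0 he] : exists2 e : R, 0 < e &
    (ereal_sup [set abscissa E A0 A theta | theta in delay_ball tau d] < (- e)%:E)%E.
  move: sup0; case: ereal_sup => [x|//|_]; last by exists 1; rewrite ?ltNyr.
  rewrite lte_fin => x0; exists (- x / 2); first by rewrite divr_gt0 ?oppr_gt0.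
  by rewrite lte_fin; lra.
exists d, e; split=> // th s thb sre; apply/negP => /eqP dets.
have : ((complex.Re s)%:E <= ereal_sup [set abscissa E A0 A theta | theta in delay_ball tau d])%E.
  apply: (@le_trans _ _ (abscissa E A0 A th)).
    by apply: ereal_sup_ubound; exists s.
  by apply: ereal_sup_ubound; exists th.
by move=> /le_lt_trans /(_ he); rewrite lte_fin ltNge sre.
Qed.

End DelayBall.

Section AlgebraicPart.
Variables (R : realType) (n m : nat).
Variables (E A0 : 'M[R[i]]_n) (A : 'I_m.+1 -> 'M[R[i]]_n) (tau : 'rV[R]_m.+1).
Variables (r : nat) (L W : 'M[R[i]]_n).
Hypotheses (uL : L \in unitmx) (uW : W \in unitmx) (rn : (r <= n)%N).
Hypothesis E_bases : E = L *m Pd R n r *m W.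
Hypothesis tau0 : forall k, 0 < tau 0 k.

Local Notation sysdet y x z := (\det (sysmx A0 A r L W y x z)).
Local Notation alg := (alg_det A0 A r L W).

Lemma alg_det_coord_poly : coord_poly alg.
Proof.
apply: (fring_sysdet _ _ _ _ _ (fring_coord_poly _ _)).
- exact: (fring_cst (fring_coord_poly _ _)).
- exact: (fring_cst (fring_coord_poly _ _)).
- exact: coord_poly_var.
Qed.

Lemma alg_det_lip : lip alg.
Proof.
apply: (fring_sysdet _ _ _ _ _ (fring_lip _ _)).
- exact: (fring_cst (fring_lip _ _)).
- exact: (fring_cst (fring_lip _ _)).
- exact: lip_var.
Qed.

(** A step [h] below the accuracy, and at most the smallest delay so that all
    weights are positive. *)
Lemma commensurate (e : R) : 0 < e -> exists h : R, exists w : 'I_m.+1 -> nat,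
  [/\ 0 < h, forall k, (0 < w k)%N & forall k, `|(w k)%:R * h - tau 0 k| <= e].
Proof.
move=> e0; have [e1 e10 et] := finite_pos_min tau0.
pose h : R := Num.min e e1.
have h0 : 0 < h by rewrite lt_min e0.
have ht k : h <= tau 0 k by rewrite (le_trans _ (et k)) // ge_min lexx orbT.
have t0 k : 0 <= tau 0 k / h by rewrite divr_ge0 // ltW.
exists h, (fun k => Num.truncn (tau 0 k / h)); split=> // k.
  by rewrite truncn_gt0 ler_pdivlMr // mul1r.
have /andP[] := truncn_itv (t0 k).
rewrite ler_pdivlMr // ltr_pdivrMr // -natr1 => h1 h2.
have he : h <= e by rewrite ge_min lexx.
rewrite ler_norml; apply/andP; split; move: h1 h2; move: (_%:R) => x; lra.
Qed.

(** A zero in the closed polydisc yields one on a torus with radii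
    [exp (- a w k h)], where the commensurate delays [w k h] are close to [tau].
    On a circle around the point [a + i om], for large [om] and delays with the
    right phases, the characteristic function is close to a polynomial in
    [exp (- h lam)] which vanishes at [1] only to finite order; the minimum
    modulus principle forbids this when there are no characteristic roots in
    the disc. *)
Lemma alg_det_polydisc z : strongly_exp_stable E A0 A tau ->
  alg (fun _ => 0) != 0 -> (forall k, normc (z k) <= 1) -> alg z != 0.
Proof.
move=> stable alg0 z1; apply/negP => /eqP algz.
have [d [eps [d0 eps0 zfree]]] := stable_zero_free stable.
have [e e0 box] := delay_ball_box d0 tau0.
have e2 : 0 < e / 2 by rewrite divr_gt0.
have [h [w [h0 w0 wh]]] := commensurate e2.
have [rho [z' [rho0 rho1 nz' algz']]] :=
  zero_on_weighted_torus alg_det_coord_poly alg_det_lip w0 alg0 z1 algz.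
pose t k := (w k)%:R * h.
have t0 k : 0 < t k by rewrite mulr_gt0 // ltr0n.
have [a a0 rhoE] : exists2 a : R, 0 <= a &
    forall k, (rho ^+ w k)%:C = cexp (- (a * t k)%:C).
  pose a := - ln rho / h; exists a => [|k].
    by rewrite divr_ge0 ?(ltW h0) // oppr_ge0 -ln1 ler_ln ?posrE.
  rewrite /cexp -rmorphN /= cos0 sin0 mulr1 mulr0 complexr0; congr _%:C.
  have -> : - (a * t k) = (w k)%:R * ln rho.
    by rewrite /a /t; field; rewrite gt_eqF.
  by rewrite expRM_natl lnK ?posrE.
have rhoC k : (rho ^+ w k)%:C != 0 :> R[i].
  by rewrite -normc_eq0 normc_real normr_eq0 gt_eqF ?exprn_gt0.
have /choice[phi phiE] k : exists phi : R, z' k = cexp (- (a * t k)%:C) * cexp (0 +i* (- phi)).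
  have [|y yE] := @polar R (z' k / (rho ^+ w k)%:C).
    by rewrite normcM normcV nz' normc_real gtr0_norm ?exprn_gt0 // divff // gt_eqF ?exprn_gt0.
  by exists (- y); rewrite opprK -yE -rhoE mulrCA divff // mulr1.
pose u k : R[i] := cexp (0 +i* (- phi k)).
(* the limit function is this polynomial evaluated at the exponential of -h lam *)
have [Q QE] : exists Q : {poly R[i]}, forall x, Q.[x] = alg (fun k => z' k * x ^+ w k).
  have fp := fring_polyfun R.
  apply: (fring_sysdet _ _ _ _ _ fp); [exact: (fring_cst fp)|exact: (fring_cst fp)|].
  move=> k; apply: (fringM fp (fring_cst fp _)).
  by exists ('X^(w k)) => x; rewrite hornerXn.
have Q0 : Q != 0.
  apply/eqP => Q0; move: alg0; rewrite (_ : (fun _ => 0) = (fun k => z' k * 0 ^+ w k)).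
    by rewrite -QE Q0 horner0 eqxx.
  by apply/funext => k; rewrite expr0n gtn_eqF // mulr0.
have [kk [r1 [c [r10 c0 lb]]]] := poly_lower_bound 1 Q0.
have [rr [rr0 rreps rrh rrr1]] : exists rr : R,
    [/\ 0 < rr, rr <= eps, rr * h <= 2^-1 & 2 * (rr * h) <= r1].
  exists (Num.min eps (Num.min (2^-1 / h) (r1 / (2 * h)))); split.
  - by rewrite !lt_min eps0 !divr_gt0 ?mulr_gt0 ?invr_gt0.
  - by rewrite ge_min lexx.
  - by rewrite -ler_pdivlMr // !ge_min lexx orbT.
  - by rewrite mulrCA -ler_pdivlMr ?mulr_gt0 // !ge_min lexx !orbT.
pose g lam := alg (fun k => z' k * cexp (- (lam * (t k)%:C))).
have gE lam : g lam = Q.[cexp (- (lam * h%:C))].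
  rewrite QE /g; congr alg; apply/funext => k; congr (_ * _).
  rewrite -cexpMn /t rmorphM rmorph_nat /=; congr cexp; ring.
have [m0 m00 gm] : exists2 m0 : R, 0 < m0 &
    forall lam, normc lam = rr -> m0 <= normc (g lam).
  exists (c * (rr * h / 2) ^+ kk).
    by rewrite mulr_gt0 // exprn_gt0 // divr_gt0 ?mulr_gt0.
  move=> lam lr; have nlh : normc (- (lam * h%:C)) = rr * h.
    by rewrite normcN normcM lr normc_real gtr0_norm.
  have [h1 h2] := @cexp_sub1 R (- (lam * h%:C)) (eq_ind_r (fun x => x <= 2^-1) rrh nlh).
  rewrite nlh in h1 h2.
  rewrite gE (le_trans _ (lb _ (le_trans h2 rrr1))) // ler_wpM2l ?(ltW c0) //.
  by rewrite lerXn2r ?nnegrE ?normc_ge0 // divr_ge0 ?mulr_ge0 ?ltW.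
have g0 : g 0 = 0.
  rewrite -[RHS]algz' /g; congr alg; apply/funext => k.
  by rewrite mul0r oppr0 cexp0 mulr1.
(* one function of (y, x, lam, theta) containing the approximations and g *)
pose J := option (option (option 'I_m.+1)).
pose F (v : J -> R[i]) : R[i] := sysdet (v None) (v (Some None))
  (fun k => cexp (- ((a%:C + v (Some (Some None))) * v (Some (Some (Some k))))) * u k).
have lF : lip F.
  have fl := fring_lip R J.
  apply: (fring_sysdet _ _ _ _ _ fl); [exact: lip_var|exact: lip_var|move=> k].
  apply: (fringM fl _ (fring_cst fl _)); apply: lip_cexp; apply: (fringN fl).
  apply: (fringM fl _ (lip_var _)); apply: (fringD fl (fring_cst fl _)); exact: lip_var.
pose pt (y x lam : R[i]) (th : 'I_m.+1 -> R) : J -> R[i] := fun j => match j with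
  | None => y | Some None => x | Some (Some None) => lam
  | Some (Some (Some k)) => (th k)%:C end.
have [M [M2 tM]] : exists M : R, 2 + rr <= M /\ forall k, t k + 1 <= M.
  exists (2 + rr + \sum_k (t k + 1)); split=> [|k].
    by rewrite lerDl; apply: sumr_ge0 => k _; rewrite addr_ge0 // ltW.
  rewrite (bigD1 k) //= addrCA lerDl addr_ge0 ?addr_ge0 ?(ltW rr0) //.
  by apply: sumr_ge0 => j _; rewrite addr_ge0 // ltW.
have [K K0 [_ FK]] := lF M.
have K1 : 0 < 1 + K by rewrite ltr_wpDr.
have K4 : 0 < 4 * (1 + K) by rewrite mulr_gt0 // ltr0n.
have [eta [eta0 eta1 etae Keta]] : exists eta : R,
    [/\ 0 < eta, eta <= 1, eta <= e / 2 & K * eta <= m0 / 4].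
  pose eta : R := Num.min (Num.min 1 (e / 2)) (m0 / (4 * (1 + K))).
  exists eta; split.
  - by rewrite !lt_min ltr01 e2 /=; apply: divr_gt0.
  - by rewrite /eta !ge_min lexx.
  - by rewrite /eta !ge_min lexx orbT.
  - have : eta <= m0 / (4 * (1 + K)) by rewrite /eta ge_min lexx orbT.
    by rewrite ler_pdivlMr //; nra.
have [Om OmP] := delays_with_phases phi t0 eta0.
have [om [omOm om1 ometa]] : exists om : R,
    [/\ Om <= om, 1 <= om & (1 + rr) / eta <= om].
  by exists (Num.max Om (Num.max 1 ((1 + rr) / eta))); rewrite !le_max !lexx !orbT.
have om0 : 0 < om by apply: lt_le_trans om1.
have [th thP] := OmP om omOm.
pose s : R[i] := a +i* om.
have ns : om <= normc s.
  by apply: le_trans (Im_le_normc s); rewrite /s /= ler_norm.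
have ns0 : 0 < normc s by apply: lt_le_trans ns.
have s0 : s != 0 by rewrite -normc_gt0.
have nsV : normc s^-1 * (1 + rr) <= eta.
  rewrite normcV mulrC ler_pdivrMr // (le_trans _ (ler_wpM2l (ltW eta0) ns)) //.
  by rewrite mulrC -ler_pdivrMr.
have nsV0 := normc_ge0 s^-1.
pose f lam := F (pt (s^-1 * (s + lam)) s^-1 lam th).
have close lam : normc lam <= rr -> normc (f lam - g lam) <= m0 / 4.
  move=> lr; apply: le_trans Keta.
  have -> : g lam = F (pt 1 0 lam t).
    rewrite /g /F /= /alg_det; congr (sysdet 1 0 _); apply/funext => k.
    by rewrite phiE -/(u k) mulrAC -cexpD rmorphM; congr (cexp _ * _); ring.
  have y1 : normc (s^-1 * (s + lam) - 1) <= eta.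
    rewrite mulrDr mulVf // addrC addKr normcM.
    apply: le_trans nsV; rewrite ler_wpM2l //; lra.
  apply: FK; first exact: ltW.
  - case=> [[[k|]|]|] /=.
    + have [h1 _] := thP k; have h2 := tM k; have h3 := t0 k.
      rewrite normc_real; move: h1; rewrite ler_norml => /andP[h4 h5].
      by rewrite ler_norml; apply/andP; split; lra.
    + by rewrite (le_trans lr) //; lra.
    + by nra.
    + have := normcD (s^-1 * (s + lam) - 1) 1; rewrite subrK normc1; lra.
  - case=> [[[k|]|]|] /=.
    + by rewrite normc_real gtr0_norm // (le_trans _ (tM k)) // lerDl.
    + by rewrite (le_trans lr) //; lra.
    + by rewrite normc0; lra.
    + by rewrite normc1; lra.
  - case=> [[[k|]|]|] //=.
    + by rewrite -rmorphB normc_real; have [] := thP k.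
    + by rewrite subrr normc0 ltW.
    + by rewrite subr0; nra.
have fn0 lam : normc lam <= rr -> f lam != 0.
  move=> lr; pose thv : 'rV[R]_m.+1 := \row_k th k.
  have [|thb _] := box thv.
    move=> k; rewrite mxE; have [h1 _] := thP k; have := wh k; rewrite -/(t k).
    have := ler_normD (th k - t k) (t k - tau 0 k); rewrite addrA subrK; lra.
  have res : - eps <= complex.Re (s + lam).
    have := Re_le_normc lam; rewrite ler_norml => /andP[h1 _].
    have -> : complex.Re (s + lam) = a + complex.Re lam by rewrite /s; case: (lam).
    lra.
  have := zfree thv (s + lam) thb res.
  rewrite charmxE -unitfE -[_ \is a _]/(_ \in unitmx).
  rewrite -(sysmx_unit _ _ uL uW rn E_bases _ _ (invr_neq0 s0)) unitmxE unitfE.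
  rewrite /f /F /=; congr (\det (sysmx _ _ _ _ _ _ _ _) != 0); apply/funext => k.
  rewrite /u /thv mxE; have [_ <-] := thP k; rewrite -cexpD; congr cexp.
  by rewrite /s; case: (lam) => x y; simpc; congr (_ +i* _); ring.
have pf : papp rr f.
  have fp := fring_papp rr0.
  apply: (fring_sysdet _ _ _ _ _ fp).
  - apply: (fringM fp (fring_cst fp _)); apply: (fringD fp (fring_cst fp _)).
    by have := papp_poly rr 'X; under eq_fun do rewrite hornerX.
  - exact: (fring_cst fp).
  move=> k; apply: (fringM fp _ (fring_cst fp _)).
  rewrite (_ : (fun _ => _) = (fun lam => cexp (- (a * th k)%:C) * cexp (- (th k)%:C * lam))).
    by apply: (fringM fp (fring_cst fp _)); apply: papp_cexp.
  apply/funext => lam /=; rewrite -cexpD.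
  have -> : - ((a%:C + lam) * (th k)%:C) = - (a * th k)%:C + - (th k)%:C * lam.
    by rewrite [(a * _)%:C](rmorphM (real_complex R)); ring.
  by [].
have lf : lip (fun x : unit -> R[i] => f (x tt)).
  have fl := fring_lip R unit.
  apply: lip_comp lF _ => -[[[k|]|]|] /=; try exact: (fring_cst fl); first exact: lip_var.
  apply: (fringM fl (fring_cst fl _)); apply: (fringD fl (fring_cst fl _)); exact: lip_var.
clearbody f g.
have : m0 - m0 / 4 <= normc (f 0).
  apply: (papp_minimum_modulus rr0 pf lf fn0) => x xr.
  have := gm x xr; have := close x (eq_ind_r (fun y => y <= rr) (lexx _) xr).
  have := normc_le_dist (g x) (f x).
  move: (normc _) (normc _) (normc _) => ? ? ?; lra.
have := close 0; rewrite normc0 g0 subr0 => /(_ (ltW rr0)).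
by move: (normc _) m00 => ?; lra.
Qed.

End AlgebraicPart.

(** * Continuity along vertical lines *)

Section LineContinuity.
Variable R : realType.
Implicit Types f g : R -> R[i].

(** Continuity of both real components, which is all that measurability needs
    and which the complex operations preserve. *)
Definition ccont f := continuous (fun t => complex.Re (f t)) /\
  continuous (fun t => complex.Im (f t)).

Lemma fring_ccont : fring ccont.
Proof.
split=> [c|f g [f1 f2] [g1 g2]|f g [f1 f2] [g1 g2]].
- by split=> t; apply: cvg_cst.
- have E : (fun t => complex.Re (f t + g t)) = (fun t => complex.Re (f t) + complex.Re (g t)).
    by apply/funext => t; case: (f t) (g t) => [a b] [c d].
  have E' : (fun t => complex.Im (f t + g t)) = (fun t => complex.Im (f t) + complex.Im (g t)).
    by apply/funext => t; case: (f t) (g t) => [a b] [c d].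
  by rewrite /ccont E E'; split=> t; apply: cvgD; [apply: f1|apply: g1|apply: f2|apply: g2].
- have E : (fun t => complex.Re (f t * g t)) =
     (fun t => complex.Re (f t) * complex.Re (g t) - complex.Im (f t) * complex.Im (g t)).
    by apply/funext => t; case: (f t) (g t) => [a b] [c d].
  have E' : (fun t => complex.Im (f t * g t)) =
     (fun t => complex.Re (f t) * complex.Im (g t) + complex.Im (f t) * complex.Re (g t)).
    by apply/funext => t; case: (f t) (g t) => [a b] [c d].
  rewrite /ccont E E'; split=> t.
    by apply: cvgB; apply: cvgM; [apply: f1|apply: g1|apply: f2|apply: g2].
  by apply: cvgD; apply: cvgM; [apply: f1|apply: g2|apply: f2|apply: g1].
Qed.

Lemma ccont_normc2 f : ccont f -> continuous (fun t => normc (f t) ^+ 2).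
Proof.
case=> f1 f2; under eq_fun do rewrite normc_sqr.
by move=> t; apply: cvgD; rewrite !expr2; apply: cvgM; [apply: f1|apply: f1|apply: f2|apply: f2].
Qed.

Lemma ccontV f : ccont f -> (forall t, f t != 0) -> ccont (fun t => (f t)^-1).
Proof.
move=> cf f0; have cn := ccont_normc2 cf; case: cf => f1 f2.
have n0 t : normc (f t) ^+ 2 != 0 by rewrite expf_eq0 /= normc_eq0 f0.
have E : (fun t => complex.Re (f t)^-1) = (fun t => complex.Re (f t) * (normc (f t) ^+ 2)^-1).
  by apply/funext => t; rewrite normc_sqr; case: (f t) => a b.
have E' : (fun t => complex.Im (f t)^-1) = (fun t => - (complex.Im (f t) * (normc (f t) ^+ 2)^-1)).
  by apply/funext => t; rewrite normc_sqr; case: (f t) => a b.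
rewrite /ccont E E'; split=> t.
  by apply: cvgM; [apply: f1 | apply: cvgV; [apply: n0 | apply: cn]].
by apply: cvgN; apply: cvgM; [apply: f2 | apply: cvgV; [apply: n0 | apply: cn]].
Qed.

Lemma ccont_cexp f : ccont f -> ccont (fun t => cexp (f t)).
Proof.
case=> f1 f2; split=> t /=; apply: cvgM.
- by apply: (continuous_comp (f1 t)); apply: continuous_expR.
- by apply: (continuous_comp (f2 t)); apply: continuous_cos.
- by apply: (continuous_comp (f1 t)); apply: continuous_expR.
- by apply: (continuous_comp (f2 t)); apply: continuous_sin.
Qed.

Lemma ccont_line (a : R) : ccont (fun w => a +i* w).
Proof. by split=> t /=; [apply: cvg_cst | apply: cvg_id]. Qed.

End LineContinuity.

Section Frobenius.
Variables (R : realType) (q p : nat).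

Lemma frobenius_sqr (M : 'M[R[i]]_(q, p)) :
  frobenius M ^+ 2 = \sum_i \sum_j normc (M i j) ^+ 2.
Proof.
rewrite sqr_sqrtr //; apply: sumr_ge0 => i _; apply: sumr_ge0 => j _.
exact: sqr_ge0.
Qed.

Lemma continuous_sum (I : Type) (s : seq I) (F : I -> R -> R) :
  (forall k, continuous (F k)) -> continuous (fun t => \sum_(k <- s) F k t).
Proof.
move=> cF; elim: s => [|k s IH].
  have -> : (fun t => \sum_(k <- [::]) F k t) = (fun=> 0) by apply/funext => t; rewrite big_nil.
  by move=> t; apply: cvg_cst.
have -> : (fun t => \sum_(k <- k :: s) F k t) = (fun t => F k t + \sum_(k <- s) F k t).
  by apply/funext => t; rewrite big_cons.
by move=> t; apply: cvgD; [apply: cF | apply: IH].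
Qed.

Lemma continuous_frobenius (M : R -> 'M[R[i]]_(q, p)) :
  fmx (@ccont R) M -> continuous (fun t => frobenius (M t) ^+ 2).
Proof.
move=> cM; under eq_fun do rewrite frobenius_sqr.
apply: continuous_sum => i; apply: continuous_sum => j.
exact/ccont_normc2/cM.
Qed.

End Frobenius.

(** * Vanishing of the direct feedthrough *)

(** Every window contributes at least [c * e], whereas the part of the integral
    outside a large interval is arbitrarily small. *)
Lemma no_far_windows (R : realType) (g : R -> R) (c e : R) :
  continuous g -> (forall t, 0 <= g t) -> 0 < c -> 0 < e ->
  (\int[lebesgue_measure]_t (g t)%:E < +oo)%E ->
  (forall X, exists2 x, X <= x & forall t, x <= t -> t <= x + e -> c <= g t) ->
  False.
Proof.
move=> cg g0 c0 e0 fin win.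
pose mu := @lebesgue_measure R.
have mg (D : set R) : measurable_fun D (EFin \o g).
  apply/measurable_EFinP; apply: (@measurable_funS _ _ _ _ setT) => //.
  exact: continuous_measurable_fun.
have Ig0 (D : set R) : (0 <= \int[mu]_(t in D) (g t)%:E)%E.
  by apply: integral_ge0 => t _; rewrite lee_fin.
have fnum : (\int[mu]_t (g t)%:E)%E \is a fin_num.
  by rewrite ge0_fin_numE.
pose F (k : nat) := `[- k%:R, k%:R]%classic : set R.
have UF : \bigcup_k F k = setT.
  apply/seteqP; split=> // x _; exists (Num.bound `|x|) => //=.
  rewrite /F /= in_itv /= -ler_norml ltW //; exact: archi_boundP.
have cvgF : (\int[mu]_(x in F k) (g x)%:E @[k --> \oo] --> \int[mu]_x (g x)%:E)%E.
  rewrite -UF; apply: ge0_nondecreasing_set_cvg_integral => //.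
  - move=> j k jk; apply/subsetPset => x; rewrite /F /= !in_itv /= -!ler_norml.
    by move/le_trans; apply; rewrite ler_nat.
  - by move=> k; apply: measurable_itv.
  - by move=> k; apply: mg.
  - by move=> k x _; rewrite lee_fin.
have ce0 : 0 < c * e by rewrite mulr_gt0.
have [k kP] : exists k, (\int[mu]_x (g x)%:E - (c * e / 2)%:E < \int[mu]_(x in F k) (g x)%:E)%E.
  have := cvgF; rewrite -(fineK fnum) => /fine_cvgP [[k0 _ fk0] /cvgrPdist_lt].
  move=> /(_ (c * e / 2)); rewrite divr_gt0 // => /(_ isT) [k1 _ h].
  exists (maxn k0 k1).
  have /= := h _ (leq_maxr k0 k1); have /= fk := fk0 _ (leq_maxl k0 k1).
  rewrite -(fineK fnum) -(fineK fk) /= -EFinB lte_fin.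
  by rewrite ltr_norml => /andP[_]; lra.
have [x xk hx] := win (k%:R + 1).
pose D := `[x, x + e]%classic : set R.
have FD : [disjoint F k & D]%classic.
  apply/disj_setPS => y []; rewrite /F /D /= !in_itv /= => /andP[_ h1] /andP[h2 _].
  have : (k%:R : R) + 1 <= k%:R by apply: le_trans xk (le_trans h2 h1).
  by rewrite gerDl ler10.
have : (\int[mu]_(t in F k `|` D) (g t)%:E <= \int[mu]_t (g t)%:E)%E.
  apply: ge0_subset_integral => //.
  - by apply: measurableU; apply: measurable_itv.
  - exact: mg.
  - by move=> t _; rewrite lee_fin.
rewrite ge0_integral_setU; [|exact: measurable_itv|exact: measurable_itv
  |exact: mg|by move=> t _; rewrite lee_fin|exact: FD].
have : ((c * e)%:E <= \int[mu]_(t in D) (g t)%:E)%E.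
  have -> : ((c * e)%:E = \int[mu]_(t in D) (cst c%:E) t)%E.
    rewrite integral_cst; last exact: measurable_itv.
    rewrite [X in (_ * X)%E](_ : _ = e%:E) -?EFinM //.
    apply: etrans (lebesgue_measure_itv `[x, x + e]) _.
    by rewrite /= lte_fin ltrDl e0 -EFinB addrC addKr.
  apply: ge0_le_integral => //.
  - exact: measurable_itv.
  - by move=> t _; rewrite lee_fin ltW.
  - exact: mg.
  - by move=> t; rewrite /D /= in_itv /= lee_fin => /andP[]; apply: hx.
have := fnum; have := Ig0 (F k); have := Ig0 D; move: kP.
case: (integral _ _ _) => [I| |] //; case: (integral _ _ _) => [IF| |] //;
  case: (integral _ _ _) => [ID| |] //.
by rewrite -EFinB -EFinD !lte_fin !lee_fin; lra.
Qed.

Section RootsOfUnity.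
Variable R : realType.

(** Quotients of the phases of roots of unity are rational, so that delays with
    these phases at a common frequency can be taken commensurate. *)
Definition root1 (x : R[i]) := exists b d : nat,
  (0 < d)%N /\ x = cexp (0 +i* (- (2 * pi * b%:R / d%:R))).

Lemma many_root1 (k : nat) : exists s : seq R[i],
  [/\ uniq s, size s = k & forall x, x \in s -> root1 x].
Proof.
pose x (b : nat) : R[i] := cexp (0 +i* (- (2 * pi * b%:R / (2 * k)%:R))).
exists (map x (iota 0 k)); split; last 2 first.
- by rewrite size_map size_iota.
- move=> y /mapP[b]; rewrite mem_iota => /= bk ->; exists b, (2 * k)%N.
  by split=> //; rewrite muln_gt0 /= (leq_ltn_trans _ bk).
rewrite map_inj_in_uniq ?iota_uniq // => a b; rewrite !mem_iota /= => ak bk.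
move/(congr1 (@complex.Re R)); rewrite /x /cexp /= !cosN expR0 !mul1r => h.
have k0 : 0 < k%:R :> R by rewrite ltr0n (leq_ltn_trans _ ak).
have E (c : nat) : 2 * pi * c%:R / (2 * k)%:R = pi * (c%:R / k%:R) :> R.
  by rewrite natrM; field; rewrite gt_eqF.
rewrite !E in h.
have itv (c : nat) : (c < k)%N -> pi * (c%:R / k%:R) \in `[0, pi :> R].
  move=> ck; rewrite in_itv /= mulr_ge0 ?pi_ge0 ?divr_ge0 //=.
  by rewrite ler_piMr ?pi_ge0 // ler_pdivrMr // mul1r ler_nat ltnW.
have := cos_inj (itv _ ak) (itv _ bk) h.
have pin : pi != 0 :> R by rewrite gt_eqF ?pi_gt0.
move/(mulfI pin)/(mulIf (invr_neq0 (lt0r_neq0 k0)))/eqP.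
by rewrite eqr_nat => /eqP.
Qed.

(** The parameter runs over a circle, which contains infinitely many points. *)
Lemma poly_circle_eq0 (P : {poly R[i]}) (a h : R) : 0 < h ->
  (forall w, P.[cexp (- (h%:C * (a +i* w)))] = 0) -> P = 0.
Proof.
move=> h0 P0; have [s [us ss sr]] := many_root1 (size P).
pose c : R[i] := (expR (- (h * a)))%:C.
have c0 : c != 0 by rewrite -normc_eq0 normc_real normr_eq0 gt_eqF ?expR_gt0.
apply: (roots_geq_poly_eq0 (rs := map (fun x => c * x) s)).
- apply/allP => y /mapP[x /sr [b [d [d0 ->]]] ->].
  rewrite /root; apply/eqP; rewrite -[RHS](P0 (2 * pi * b%:R / d%:R / h)); congr _.[_].
  have -> : c = cexp (- (h * a))%:C by rewrite /cexp /= cos0 sin0 mulr1 mulr0.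
  rewrite -cexpD; congr cexp; apply/eqP; rewrite eq_complex /=.
  rewrite !mul0r !subr0 !addr0 add0r eqxx /=; apply/eqP.
  by field; rewrite gt_eqF //= pnatr_eq0 -lt0n.
- by rewrite map_inj_uniq //; apply: mulfI.
- by rewrite size_map ss.
Qed.

End RootsOfUnity.

Lemma frobenius_entry (R : realType) (q p : nat) (M : 'M[R[i]]_(q, p)) i j :
  normc (M i j) ^+ 2 <= frobenius M ^+ 2.
Proof.
rewrite frobenius_sqr (bigD1 i) //= (bigD1 j) //= -addrA lerDl addr_ge0 //.
  by apply: sumr_ge0 => k _; apply: sqr_ge0.
by apply: sumr_ge0 => k _; apply: sumr_ge0 => l _; apply: sqr_ge0.
Qed.

Section Feedthrough.
Variables (R : realType) (n p q m : nat).
Variables (E A0 : 'M[R[i]]_n) (A : 'I_m.+1 -> 'M[R[i]]_n).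
Variables (B : 'M[R[i]]_(n, p)) (C : 'M[R[i]]_(q, n)) (tau : 'rV[R]_m.+1).
Variables (r : nat) (L W : 'M[R[i]]_n).
Hypotheses (uL : L \in unitmx) (uW : W \in unitmx) (rn : (r <= n)%N).
Hypothesis E_bases : E = L *m Pd R n r *m W.
Hypothesis tau0 : forall k, 0 < tau 0 k.

Local Notation sysdet y x z := (\det (sysmx A0 A r L W y x z)).
Local Notation nume y x z := (numer A0 A B C r L W y x z).

(** The suprema over shrinking balls decrease, so that the limit is their
    infimum, and one of them is already finite. *)
Lemma strong_h2norm_lty : (strong_h2norm E A0 A B C tau < +oo)%E ->
  exists2 d : R, 0 < d & forall th, delay_ball tau d th ->
    (delay_h2norm E A0 A B C th < +oo)%E.
Proof.
pose F (d : R) := ereal_sup [set delay_h2norm E A0 A B C theta | theta in delay_ball tau d].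
have ndF : {in `]0, 1[ &, nondecreasing_fun F}.
  move=> x y _ _ xy; apply: ereal_sup_le => _ [th [th0 thx] <-].
  exists th => //.
  by split=> //; apply: lt_le_trans xy.
have cF : F d @[d --> 0^'+] --> ereal_inf (F @` `]0, 1[).
  by apply: (@nondecreasing_at_right_cvge _ F 0 (BLeft 1)) => //; rewrite bnd_simp ltr01.
rewrite /strong_h2norm (cvg_lim _ cF) // => inf_lt.
have [_ [d dI <-] Fd] := ereal_inf_lt inf_lt.
move: dI; rewrite /= in_itv /= => /andP[d0 _]; exists d => // th thb.
by apply: le_lt_trans Fd; apply: ereal_sup_ubound; exists th.
Qed.

Lemma delay_h2norm_line th (a : R) : 0 < a ->
  (delay_h2norm E A0 A B C th < +oo)%E ->
  (\int[lebesgue_measure]_w (frobenius (transfer E A0 A B C th (a +i* w)) ^+ 2)%:E < +oo)%E.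
Proof.
move=> a0; rewrite /delay_h2norm /h2norm; case: ifP => // _ fin.
rewrite ltey; apply/eqP => I; move: fin; rewrite ltNge => /negP; apply.
suff <- : (sqrte ((2 * pi)^-1%:E * \int[lebesgue_measure]_w
    (frobenius (transfer E A0 A B C th (a +i* w)) ^+ 2)%:E) = +oo)%E.
  by apply: ereal_sup_ubound; exists a.
by rewrite I gt0_muley // lte_fin invr_gt0 mulr_gt0 ?pi_gt0.
Qed.

Lemma transfer_quotient s z x i j : x != 0 -> exp_mx E A0 A s z \in unitmx ->
  (C *m invmx (exp_mx E A0 A s z) *m B) i j =
  nume (x * s) x z i j / sysdet (x * s) x z.
Proof. by move=> x0 uM; rewrite (transferE B C uL uW rn E_bases x0 uM) mxE mulrC. Qed.

Lemma pencil_ccont (f : R -> R[i]) (z : R -> 'I_m.+1 -> R[i]) : ccont f ->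
  (forall k, ccont (z^~ k)) -> (forall w, exp_mx E A0 A (f w) (z w) \in unitmx) ->
  fmx (@ccont R) (fun w => C *m invmx (exp_mx E A0 A (f w) (z w)) *m B).
Proof.
move=> cf cz uM i j; have fc := fring_ccont R.
have -> : (fun w => (C *m invmx (exp_mx E A0 A (f w) (z w)) *m B) i j) =
   (fun w => nume (f w) 1 (z w) i j / sysdet (f w) 1 (z w)).
  apply/funext => w; have := transfer_quotient i j (oner_neq0 _) (uM w).
  by rewrite mul1r.
apply: (fringM fc).
  by apply: (fmx_numer _ _ _ _ _ _ _ fc) => //; exact: (fring_cst fc).
apply: ccontV => [|w].
  by apply: (fring_sysdet _ _ _ _ _ fc) => //; exact: (fring_cst fc).
rewrite -unitfE -[_ \is a _]/(_ \in unitmx).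
by have := uM w; rewrite -(sysmx_unit A0 A uL uW rn E_bases _ _ (oner_neq0 _)) mul1r.
Qed.

Lemma transfer_ccont (f : R -> R[i]) th : ccont f ->
  (forall w, \det (charmx E A0 A th (f w)) != 0) ->
  fmx (@ccont R) (fun w => transfer E A0 A B C th (f w)).
Proof.
move=> cf dn0; have fc := fring_ccont R.
under eq_fun do rewrite /transfer charmxE.
apply: pencil_ccont => // [k|w].
  by apply: ccont_cexp; apply: (fringN fc); apply: (fringM fc (fring_cst fc _)).
by have := dn0 w; rewrite charmxE unitmxE unitfE.
Qed.

(** Along delays [w k h] the transfer function tends to a [2 pi / h]-periodic
    function of the frequency. If that were nonzero somewhere, the transfer
    function would stay away from zero on windows of a fixed length arbitrarily
    far away. *)
Lemma feedthrough_commensurate (d : R) (h : R) (w : 'I_m.+1 -> nat) i j :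
  (forall th s, delay_ball tau d th -> 0 <= complex.Re s ->
     \det (charmx E A0 A th s) != 0) ->
  (forall th, delay_ball tau d th -> (delay_h2norm E A0 A B C th < +oo)%E) ->
  0 < h -> delay_ball tau d (\row_k ((w k)%:R * h)) ->
  forall x, nume 1 0 (fun k => x ^+ w k) i j = 0.
Proof.
move=> zfree fin h0 thb; set th := \row_k _ in thb.
have [Q QE] : exists Q : {poly R[i]}, forall x, Q.[x] = nume 1 0 (fun k => x ^+ w k) i j.
  have fp := fring_polyfun R.
  apply: (fmx_numer _ _ _ _ _ _ _ fp); [exact: (fring_cst fp)|exact: (fring_cst fp)|].
  by move=> k; exists ('X^(w k)) => x; rewrite hornerXn.
suff Q0 : Q = 0 by move=> x; rewrite -QE Q0 horner0.
apply: (poly_circle_eq0 (a := 1) h0) => w1; apply/eqP; apply: contraPT isT => Qn0.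
pose J := option 'I_m.+1.
pose Fn (v : J -> R[i]) := nume 1 (v None) (fun k => v (Some k)) i j.
pose Fd (v : J -> R[i]) := sysdet 1 (v None) (fun k => v (Some k)).
have fl := fring_lip R J.
have lFn : lip Fn.
  apply: (fmx_numer _ _ _ _ _ _ _ fl); [exact: (fring_cst fl)|exact: lip_var|].
  by move=> k; exact: lip_var.
have lFd : lip Fd.
  apply: (fring_sysdet _ _ _ _ _ fl); [exact: (fring_cst fl)|exact: lip_var|].
  by move=> k; exact: lip_var.
have [K K0 [_ FnK]] := lFn 1.
have [K' K'0 [FdK _]] := lFd 1.
pose z1 k : R[i] := cexp (- ((th 0 k)%:C * (1 +i* w1))).
pose c0 := normc (nume 1 0 z1 i j).
have c00 : 0 < c0.
  rewrite normc_gt0; move: Qn0; rewrite QE.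
  rewrite (_ : (fun k => _ ^+ _) = z1) //; apply/funext => k.
  rewrite -cexpMn /z1 mxE rmorphM rmorph_nat /=; congr cexp; ring.
have th0 k : 0 <= th 0 k by rewrite mxE mulr_ge0 // ltW.
pose Tm : R := 1 + \sum_k th 0 k.
have thT k : th 0 k <= Tm.
  rewrite /Tm (bigD1 k) //= addrCA lerDl addr_ge0 //.
  by apply: sumr_ge0.
have Tm0 : 0 < Tm by rewrite ltr_wpDr //; apply: sumr_ge0.
have c0E : c0 = normc (nume 1 0 z1 i j) by [].
clearbody c0 Tm.
have K1 : 0 < 1 + K by rewrite ltr_wpDr.
have K'1 : 0 < 1 + K' by rewrite ltr_wpDr.
have [r0 [r00 r01 Kr0]] : exists r0 : R, [/\ 0 < r0, r0 <= 1 & K * r0 <= c0 / 2].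
  exists (Num.min 1 (c0 / 2 / (1 + K))); split.
  - by rewrite lt_min ltr01 !divr_gt0.
  - by rewrite ge_min lexx.
  - rewrite (le_trans (ler_wpM2l K0 (_ : _ <= c0 / 2 / (1 + K)))) ?ge_min ?lexx ?orbT //.
    rewrite mulrCA ler_piMr ?divr_ge0 ?(ltW c00) //.
    by rewrite ler_pdivrMr // mul1r lerDr.
pose e := r0 / (2 * Tm).
have e0 : 0 < e by rewrite divr_gt0 // mulr_gt0.
have Te : 2 * (Tm * e) = r0 by rewrite /e; field; rewrite gt_eqF.
clearbody e.
have charn0 t : \det (charmx E A0 A th (1 +i* t)) != 0 by apply: zfree => //=.
have cg : continuous (fun t : R => frobenius (transfer E A0 A B C th (1 +i* t)) ^+ 2).
  by apply: continuous_frobenius; apply: (transfer_ccont (ccont_line 1)).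
exfalso; apply: (@no_far_windows R _ ((c0 / 2 / (1 + K')) ^+ 2) e cg) => //.
- by move=> t; apply: sqr_ge0.
- by rewrite exprn_gt0 // !divr_gt0.
- exact: delay_h2norm_line (fin _ thb).
move=> X; pose T : R := 2 * pi / h.
have T0 : 0 < T by rewrite divr_gt0 // mulr_gt0 ?pi_gt0.
pose Y : R := `|X| + r0^-1 + `|w1|.
have Y0 : 0 <= Y by rewrite !addr_ge0 ?invr_ge0 ?(ltW r00).
pose jj := Num.bound (Y / T).
have jjY : Y <= jj%:R * T.
  by rewrite -ler_pdivrMr // ltW // archi_boundP // divr_ge0 // ltW.
pose x : R := w1 + jj%:R * T.
have xX : `|X| + r0^-1 <= x.
  have h1 : - `|w1| <= w1 by rewrite lerNl ler_normr lexx orbT.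
  by rewrite /x; move: jjY h1; rewrite /Y; lra.
have r0V : 0 < r0^-1 by rewrite invr_gt0.
exists x; first by apply: le_trans (ler_norm X) (le_trans _ xX); rewrite lerDl ltW.
move=> t xt txe; pose u := t - x.
have u0 : 0 <= u by rewrite subr_ge0.
have ue : u <= e by rewrite lerBlDl.
pose s : R[i] := 1 +i* t.
have tr0 : r0^-1 <= t by apply: le_trans xt; apply: le_trans xX; rewrite lerDr.
have sV : normc s^-1 <= r0.
  rewrite normcV -[leRHS]invrK lef_pV2 ?posrE ?(lt_le_trans r0V) //; last first.
    exact: le_trans tr0 (le_trans (ler_norm _) (Im_le_normc s)).
  exact: le_trans tr0 (le_trans (ler_norm _) (Im_le_normc s)).
have s0 : s != 0 by apply/eqP => /(congr1 (@complex.Re R)) /eqP; rewrite /= oner_eq0.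
pose z k : R[i] := cexp (- ((th 0 k)%:C * s)).
have nexp k (y : R) : normc (cexp (- ((th 0 k)%:C * (1 +i* y))) : R[i]) <= 1.
  by rewrite normc_cexp expR_le1 /= mul0r subr0 mulr1 oppr_le0.
(* the shift by jj periods disappears, leaving the offset u in the window *)
have zE k : z k = z1 k * cexp (0 +i* (- (th 0 k * u))).
  have h1 : th 0 k * (jj%:R * T) = 2 * pi * (w k * jj)%:R.
    by rewrite mxE natrM /T; field; rewrite gt_eqF.
  rewrite -[RHS]mulr1 -(cexp_2pi_natN R (w k * jj)) -h1 /z /z1 -!cexpD; congr cexp.
  apply/eqP; rewrite eq_complex /= /u /x; apply/andP; split; apply/eqP; ring.
have zz1 k : normc (z k - z1 k) <= r0.
  have -> : z k - z1 k = z1 k * (cexp (0 +i* (- (th 0 k * u))) - 1).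
    by rewrite zE; move: (z1 k) (cexp _) => ? ?; ring.
  have hu : th 0 k * u <= Tm * e by apply: ler_pM.
  have nu : normc (0 +i* (- (th 0 k * u)) : R[i]) = th 0 k * u.
    by rewrite /normc /= expr0n add0r sqrtr_sqr normrN ger0_norm // mulr_ge0.
  have [|_ h2] := @cexp_sub1 R (0 +i* (- (th 0 k * u))).
    by rewrite nu (le_trans hu) // -(ler_pM2l (ltr0n _ 2)) Te mulfV ?pnatr_eq0.
  rewrite normcM (le_trans (ler_wpM2l (normc_ge0 _) h2)) // nu -Te.
  rewrite (le_trans (ler_wpM2r _ (nexp k w1))) ?mulr_ge0 // mul1r.
  by rewrite ler_pM2l ?ltr0n.
have uM : exp_mx E A0 A s z \in unitmx.
  by have := charn0 t; rewrite charmxE unitmxE unitfE.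
pose v : J -> R[i] := fun j => if j is Some k then z k else s^-1.
have bv : bdd 1 v.
  by case=> [k|] /=; [exact: nexp | exact: le_trans sV r01].
have Gij : transfer E A0 A B C th s i j = (Fd v)^-1 * Fn v.
  rewrite /transfer charmxE (transferE B C uL uW rn E_bases (invr_neq0 s0) uM).
  by rewrite mulVf // mxE.
pose v1 : J -> R[i] := fun j => if j is Some k then z1 k else 0.
have bv1 : bdd 1 v1 by case=> [k|] /=; [exact: nexp | rewrite normc0].
have vv1 : nearby r0 v v1.
  by case=> [k|] /=; [exact: zz1 | rewrite subr0].
have hd : normc (Fd v) <= 1 + K' by rewrite (le_trans (FdK _ bv)) // lerDr.
have dn0 : Fd v != 0.
  by have := uM; rewrite -(sysmx_unit _ _ uL uW rn E_bases _ _ (invr_neq0 s0)) mulVf // unitmxE unitfE.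
have {}c0E : c0 = normc (Fn v1) by exact: c0E.
clearbody Fn Fd.
have hn : c0 / 2 <= normc (Fn v).
  have := FnK _ _ _ (ltW r00) bv bv1 vv1.
  have := normc_le_dist (Fn v1) (Fn v); rewrite -c0E.
  move: Kr0; set a1 := normc (Fn v); set a2 := normc _; clearbody a1 a2; lra.
apply: le_trans (frobenius_entry _ i j); rewrite Gij normcM normcV.
rewrite lerXn2r ?nnegrE ?mulr_ge0 ?invr_ge0 ?normc_ge0 ?(ltW c00) ?(ltW K'1) //.
rewrite [leRHS]mulrC ler_pM ?divr_ge0 ?invr_ge0 ?(ltW c00) ?(ltW K'1) //.
by rewrite lef_pV2 ?posrE ?normc_gt0.
Qed.

(** Every tuple of roots of unity is of the form [x ^+ w k] for some [x] and
    weights [w] for which the delays [w k h] are close to the given ones; they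
    form a product of infinite sets, which determines a polynomial. *)
Lemma feedthrough_eq0 i j z : strongly_exp_stable E A0 A tau ->
  (strong_h2norm E A0 A B C tau < +oo)%E -> nume 1 0 z i j = 0.
Proof.
move=> /stable_zero_free[d1 [eps [d10 eps0 zfree]]] /strong_h2norm_lty[d2 d20 fin].
pose d : R := Num.min d1 d2.
have d0 : 0 < d by rewrite lt_min d10.
have b1 th : delay_ball tau d th -> delay_ball tau d1 th.
  by case=> h1 h2; split=> //; apply: lt_le_trans h2 _; rewrite ge_min lexx.
have b2 th : delay_ball tau d th -> delay_ball tau d2 th.
  by case=> h1 h2; split=> //; apply: lt_le_trans h2 _; rewrite ge_min lexx orbT.
have fp := fring_coord_poly R 'I_m.+1.
have pf : coord_poly (fun z => nume 1 0 z i j).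
  apply: (fmx_numer _ _ _ _ _ _ _ fp); [exact: (fring_cst fp)|exact: (fring_cst fp)|].
  exact: coord_poly_var.
apply: (coord_poly_eq0 (S := @root1 R) pf (@many_root1 R)) => {}z zr.
have /choice[b /choice[c bcP]] k : exists b c : nat,
    (0 < c)%N /\ z k = cexp (0 +i* (- (2 * pi * b%:R / c%:R))).
  exact: zr.
pose D := (\prod_k c k)%N.
have D0 : (0 < D)%N by apply: prodn_gt0 => k; case: (bcP k).
pose b' k := (b k * (D %/ c k))%N.
have cD k : (c k %| D)%N by rewrite /D (bigD1 k) //= dvdn_mulr.
have zE k : z k = cexp (0 +i* (- (2 * pi / D%:R))) ^+ b' k.
  have [ck0 ->] := bcP k; rewrite -cexpMn; congr cexp.
  rewrite -(rmorph_nat (real_complex R)); apply/eqP; rewrite eq_complex /=.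
  rewrite !mul0r !mulr0 subr0 addr0 eqxx /=; apply/eqP.
  have DE : D%:R = (D %/ c k)%:R * (c k)%:R :> R by rewrite -natrM divnK.
  rewrite /b' natrM DE.
  have h1 : (c k)%:R != 0 :> R by rewrite pnatr_eq0 -lt0n.
  have h2 : (D %/ c k)%:R != 0 :> R.
    by rewrite pnatr_eq0 -lt0n divn_gt0 // dvdn_leq.
  by field; rewrite h1 h2.
have [e e0 box] := delay_ball_box d0 tau0.
(* weights are fixed modulo D, which costs at most (b' k + D) h in the delay *)
pose H : R := 1 + D%:R + \sum_k (b' k)%:R.
have bH k : (b' k)%:R + D%:R <= H.
  rewrite /H (bigD1 k) //=.
  have : 0 <= \sum_(i | i != k) (b' i)%:R :> R by apply: sumr_ge0.
  lra.
have H0 : 0 < H by rewrite /H ltr_wpDr ?sumr_ge0 // ltr_wpDr.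
pose h := e / H.
have h0 : 0 < h by rewrite divr_gt0.
have Dh0 : 0 < D%:R * h by rewrite mulr_gt0 // ltr0n.
pose l k := Num.truncn (tau 0 k / (D%:R * h)).
pose w k := (b' k + D * l k)%N.
have thb : delay_ball tau d (\row_k ((w k)%:R * h)).
  have [|] := box (\row_k ((w k)%:R * h)); last by [].
  move=> k; rewrite mxE /w natrD natrM.
  have /andP[] : (l k)%:R <= tau 0 k / (D%:R * h) < (l k).+1%:R.
    by apply: truncn_itv; rewrite divr_ge0 // ltW.
  rewrite ler_pdivlMr // ltr_pdivrMr // -natr1.
  have : ((b' k)%:R + D%:R) * h <= e.
    by rewrite (le_trans (ler_wpM2r (ltW h0) (bH k))) // /h mulrC divfK ?gt_eqF.
  have : 0 <= (b' k)%:R * h by rewrite mulr_ge0 // ltW.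
  move: (b' k)%:R (l k)%:R D%:R Dh0 => bb ll DD Dh0' h1 h2 h3 h4.
  rewrite ler_norml; apply/andP; split; nra.
have := @feedthrough_commensurate d h w i j _ _ h0 thb (cexp (0 +i* (- (2 * pi / D%:R)))).
rewrite (_ : (fun k => _ ^+ _) = z).
  apply; first by move=> th s /b1 thb' s0; apply: zfree thb' (le_trans _ s0); rewrite oppr_le0 ltW.
  by move=> th /b2; apply: fin.
apply/funext => k; rewrite /w exprD exprM zE.
suff -> : cexp (0 +i* (- (2 * pi / D%:R))) ^+ D = 1 :> R[i] by rewrite expr1n mulr1.
rewrite -cexpMn -[RHS](cexp_2pi_natN R 1); congr cexp.
rewrite -(rmorph_nat (real_complex R)); apply/eqP; rewrite eq_complex /=.
rewrite !mul0r !mulr0 subr0 addr0 eqxx /=; apply/eqP.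
by field; rewrite pnatr_eq0 -lt0n.
Qed.

End Feedthrough.

(** * Integration of polynomials *)

Section Antiderivative.
Variable F : numFieldType.
Implicit Types P Q : {poly F}.

Definition prim P : {poly F} := \poly_(i < (size P).+1) (P`_i.-1 / i%:R).

Lemma coef_prim P i : (prim P)`_i = P`_i.-1 / i%:R.
Proof.
rewrite coef_poly ltnS; case: ltnP => // h; case: i h => [|i] h /=.
  by rewrite invr0 mulr0.
by rewrite nth_default ?mul0r.
Qed.

Lemma deriv_prim P : (prim P)^`() = P.
Proof.
apply/polyP => i; rewrite coef_deriv coef_prim /= -[_ *+ _]mulr_natr.
by rewrite divfK // pnatr_eq0.
Qed.

Lemma prim_deriv P : prim P^`() = P - (P`_0)%:P.
Proof.
apply/polyP => -[|i]; rewrite coef_prim coefB coefC /= ?invr0 ?mulr0 ?subrr //.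
by rewrite coef_deriv -[_ *+ _]mulr_natr mulfK ?pnatr_eq0 // subr0.
Qed.

Lemma primD P Q : prim (P + Q) = prim P + prim Q.
Proof. by apply/polyP => i; rewrite coefD !coef_prim coefD mulrDl. Qed.

Lemma primZ c P : prim (c *: P) = c *: prim P.
Proof. by apply/polyP => i; rewrite coefZ !coef_prim coefZ mulrA. Qed.

(** The integral of a polynomial through its antiderivative, an algebraic
    expression that makes sense with real and with complex coefficients. *)
Definition pint (a b : F) P : F := (prim P).[b] - (prim P).[a].

Lemma pintD a b P Q : pint a b (P + Q) = pint a b P + pint a b Q.
Proof. by rewrite /pint primD !hornerD opprD addrACA. Qed.

Lemma pintZ a b c P : pint a b (c *: P) = c * pint a b P.
Proof. by rewrite /pint primZ !hornerZ mulrBr. Qed.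

Lemma pintN a b P : pint a b (- P) = - pint a b P.
Proof. by rewrite -scaleN1r pintZ mulN1r. Qed.

Lemma pintB a b P Q : pint a b (P - Q) = pint a b P - pint a b Q.
Proof. by rewrite pintD pintN. Qed.

Lemma pint0 a b : pint a b 0 = 0.
Proof. by rewrite -(scale0r 0) pintZ mul0r. Qed.

Lemma pint_deriv a b P : pint a b P^`() = P.[b] - P.[a].
Proof. by rewrite /pint prim_deriv !hornerD !hornerN !hornerC opprB addrA subrK. Qed.

Lemma pint_parts a b P Q :
  pint a b (P^`() * Q) = P.[b] * Q.[b] - P.[a] * Q.[a] - pint a b (P * Q^`()).
Proof. by rewrite -!hornerM -pint_deriv derivM pintD addrK. Qed.

Lemma pint_split a b c P : pint a c P = pint a b P + pint b c P.
Proof. by rewrite /pint [RHS]addrC addrA subrK. Qed.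

End Antiderivative.

Lemma size_derivn_le (F : numFieldType) (P : {poly F}) j : (size P^`(j) <= size P - j)%N.
Proof.
elim: j => [|j IH]; first by rewrite subn0.
rewrite derivnS subnS; have [P0|Pn0] := eqVneq P^`(j) 0.
  by rewrite P0 deriv0 size_poly0.
rewrite -ltnS; apply: leq_trans (lt_size_deriv Pn0) _; rewrite (leq_trans IH) //.
exact: leqSpred.
Qed.


Lemma map_prim (F F' : numFieldType) (f : {rmorphism F -> F'}) (P : {poly F}) :
  map_poly f (prim P) = prim (map_poly f P).
Proof.
by apply/polyP => i; rewrite coef_map !coef_prim coef_map /= rmorphM fmorphV rmorph_nat.
Qed.

Lemma map_pint (F F' : numFieldType) (f : {rmorphism F -> F'}) a b (P : {poly F}) :
  f (pint a b P) = pint (f a) (f b) (map_poly f P).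
Proof. by rewrite /pint rmorphB -map_prim !horner_map. Qed.

Section RealPolynomials.
Variable R : realType.
Implicit Types (p : {poly R}) (a b c : R).

(** The mean value theorem for the antiderivative. *)
Lemma pint_mean a b p : a < b -> exists2 c, c \in `[a, b] & pint a b p = p.[c] * (b - a).
Proof.
move=> ab; have [c cab] := poly_mvt (prim p) ab; rewrite deriv_prim => h.
by exists c => //; apply: subset_itv cab; rewrite bnd_simp.
Qed.

Lemma pint_ge0 a b p : a <= b -> (forall t, a <= t <= b -> 0 <= p.[t]) -> 0 <= pint a b p.
Proof.
rewrite le_eqVlt => /orP[/eqP->|ab] p0; first by rewrite /pint subrr.
have [c + ->] := pint_mean p ab; rewrite in_itv /= => cab.
by rewrite mulr_ge0 ?p0 // subr_ge0 ltW.
Qed.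

(** All partial integrals lie between zero and the total, so that the
    antiderivative is constant on the segment. *)
Lemma pint_eq0 a b p : a < b -> (forall t, a <= t <= b -> 0 <= p.[t]) ->
  pint a b p = 0 -> p = 0.
Proof.
move=> ab p0 ip0.
have Fc t : a <= t <= b -> (prim p - ((prim p).[a])%:P).[t] = 0.
  move=> /andP[at_ tb]; rewrite !hornerE -/(pint a t p).
  have h1 : 0 <= pint a t p.
    apply: pint_ge0 => // u /andP[au ut]; apply: p0; rewrite au.
    exact: le_trans ut tb.
  have h2 : 0 <= pint t b p.
    apply: pint_ge0 => // u /andP[tu ub]; apply: p0; rewrite ub andbT.
    exact: le_trans at_ tu.
  by move: ip0; rewrite (pint_split a t b); lra.
have F0 : prim p - ((prim p).[a])%:P = 0.
  set P := _ - _ in Fc *.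
  pose rs := map (fun k : nat => a + (b - a) * (k%:R / (size P)%:R)) (iota 0 (size P)).
  apply: (roots_geq_poly_eq0 (rs := rs)); last by rewrite size_map size_iota.
    apply/allP => t /mapP[k]; rewrite mem_iota /= => ks ->; rewrite /root Fc //.
    have s0 : 0 < (size P)%:R :> R by rewrite ltr0n (leq_ltn_trans _ ks).
    have k0 : 0 <= k%:R / (size P)%:R :> R by rewrite divr_ge0.
    have k1 : k%:R / (size P)%:R <= 1 :> R by rewrite ler_pdivrMr // mul1r ler_nat ltnW.
    have ba : 0 < b - a by rewrite subr_gt0.
    by apply/andP; split; nra.
  rewrite map_inj_in_uniq ?iota_uniq // => j k; rewrite !mem_iota /= => js _.
  have s0 : (size P)%:R^-1 != 0 :> R by rewrite invr_neq0 // pnatr_eq0 -lt0n (leq_ltn_trans _ js).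
  have ba : b - a != 0 by rewrite subr_eq0 gt_eqF.
  by move/addrI/(mulfI ba)/(mulIf s0)/eqP; rewrite eqr_nat => /eqP.
by rewrite -(deriv_prim p) -[prim p](subrK ((prim p).[a])%:P) F0 add0r derivC.
Qed.

End RealPolynomials.

(** * The tau method on one segment *)

Section Conjugation.
Variable R : realType.
Implicit Type z : R[i].

Lemma mulc_conjc z : z * conjc z = (normc z ^+ 2)%:C.
Proof. by rewrite -mulc_conj. Qed.

Lemma Re_addcJ z : z + conjc z = (2 * complex.Re z)%:C.
Proof.
case: z => a b; apply/eqP; rewrite eq_complex /= subrr eqxx andbT.
by apply/eqP; ring.
Qed.

End Conjugation.

Section SegmentProduct.
Variables (R : realType) (x0 x1 : R).
Hypothesis x01 : x0 < x1.
Implicit Types (u v w e : {poly R[i]}) (s c : R[i]).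

Local Notation jint := (pint x0%:C x1%:C).

(** On the real axis this is complex conjugation of the values, and
    [sqpoly v] below is the squared modulus. *)
Definition cpoly v : {poly R[i]} := map_poly (@conjc R) v.
Definition sqpoly v : {poly R} :=
  map_poly (@complex.Re R) v ^+ 2 + map_poly (@complex.Im R) v ^+ 2.
Definition sqnorm v : R := pint x0 x1 (sqpoly v).

Lemma cpolyK v : cpoly (cpoly v) = v.
Proof. by apply/polyP => i; rewrite !coef_map /= conjcK. Qed.
Lemma cpolyD u v : cpoly (u + v) = cpoly u + cpoly v.
Proof. exact: rmorphD. Qed.
Lemma cpolyM u v : cpoly (u * v) = cpoly u * cpoly v.
Proof. exact: rmorphM. Qed.
Lemma cpolyZ c v : cpoly (c *: v) = conjc c *: cpoly v.
Proof. exact: map_polyZ. Qed.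
Lemma cpoly_deriv v : cpoly v^`() = (cpoly v)^`().
Proof. by rewrite /cpoly deriv_map. Qed.
Lemma size_cpoly v : size (cpoly v) = size v.
Proof. exact: size_map_poly. Qed.
Lemma horner_cpoly v (t : R) : (cpoly v).[t%:C] = conjc v.[t%:C].
Proof. by rewrite -{1}(conjc_real t) horner_map. Qed.

Lemma jint_conj v : jint (cpoly v) = conjc (jint v).
Proof. by rewrite /cpoly [RHS](map_pint (@conjc R)) /= oppr0. Qed.

Lemma polyReIm v : v = map_poly (real_complex R) (map_poly (@complex.Re R) v)
  + 'i *: map_poly (real_complex R) (map_poly (@complex.Im R) v).
Proof.
apply/polyP => i; rewrite coefD coefZ !coef_map_id0 //; try by rewrite /= ?oppr0.
exact: complexE.
Qed.

Lemma mul_cpoly v : v * cpoly v = map_poly (real_complex R) (sqpoly v).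
Proof.
rewrite /sqpoly [in LHS](polyReIm v); set a := map_poly _ v; set b := map_poly _ v.
have cr (p : {poly R}) : cpoly (map_poly (real_complex R) p) = map_poly (real_complex R) p.
  by apply/polyP => i; rewrite !coef_map /= oppr0.
rewrite cpolyD cpolyZ !cr rmorphD !rmorphXn /=.
rewrite (_ : (_ +i* _) = - 'i); last by simpc.
have i2 : 'i * 'i = -1 :> R[i] by simpc.
rewrite mulrDl !mulrDr !scaleNr !mulrN -!scalerAl -!scalerAr scalerA i2.
rewrite scaleN1r opprK [_ * map_poly _ a in X in _ + X]mulrC.
by rewrite addrA -[_ - _ + _]addrA addNr addr0 -!expr2.
Qed.

Lemma jint_sq v : jint (v * cpoly v) = (sqnorm v)%:C.
Proof. by rewrite mul_cpoly /sqnorm map_pint. Qed.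

Lemma sqpoly_ge0 v (t : R) : 0 <= (sqpoly v).[t].
Proof. by rewrite !hornerE addr_ge0 // sqr_ge0. Qed.

Lemma sqpolyE v (t : R) : (sqpoly v).[t] = normc v.[t%:C] ^+ 2.
Proof.
apply: (@complexI R); rewrite -mulc_conjc -horner_cpoly -hornerM mul_cpoly.
by rewrite horner_map.
Qed.

Lemma sqnorm_ge0 v : 0 <= sqnorm v.
Proof. by apply: pint_ge0 => [|t _]; [exact: ltW | exact: sqpoly_ge0]. Qed.

Lemma sqnorm_eq0 v : sqnorm v = 0 -> v = 0.
Proof.
move=> h; have sv0 : sqpoly v = 0 by apply: (pint_eq0 x01 _ h) => t _; exact: sqpoly_ge0.
have := mul_cpoly v; rewrite sv0 rmorph0 => /eqP; rewrite mulf_eq0 => /orP[/eqP //|/eqP cv].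
by rewrite -(cpolyK v) cv /cpoly rmorph0.
Qed.

(** With [e = (x1 - X) v], integration by parts shows that pairing [e'] with [v]
    yields minus half of [|v|^2 + (x1 - x0) |v(x0)|^2], while [s e] paired with
    [v] has nonnegative real part, the weight [x1 - X] being nonnegative. *)
Lemma energy e v g s : e = (x1%:C%:P - 'X) * v -> 0 <= complex.Re s ->
  jint ((e^`() - s *: e - g) * cpoly v) = 0 ->
  sqnorm v + (x1 - x0) * normc v.[x0%:C] ^+ 2 + 2 * complex.Re (jint (g * cpoly v)) <= 0.
Proof.
move=> eE s0; pose L : {poly R[i]} := x1%:C%:P - 'X; rewrite -/L in eE.
pose Y := v * cpoly v.
have dL : L^`() = -1 by rewrite derivB derivC derivX sub0r.
have cL : cpoly L = L.
  rewrite /cpoly /L rmorphB /= map_polyC map_polyX /= oppr0 //.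
have h1 : e^`() * cpoly v + cpoly (e^`() * cpoly v) = (L * Y)^`() - Y.
  rewrite cpolyM cpolyK cpoly_deriv eE cpolyM cL !derivM /Y ?derivM dL.
  ring.
have h2 : 2 * complex.Re (jint (e^`() * cpoly v)) =
    - sqnorm v - (x1 - x0) * normc v.[x0%:C] ^+ 2.
  apply: (@complexI R); rewrite -Re_addcJ -jint_conj -pintD h1 pintB pint_deriv jint_sq.
  rewrite /L !hornerM !hornerD !hornerN !hornerC !hornerX subrr mul0r sub0r.
  rewrite horner_cpoly mulc_conjc -rmorphB -rmorphM -rmorphN -rmorphB; congr _%:C; ring.
have h3 : 0 <= complex.Re (jint (s *: e * cpoly v)).
  rewrite -scalerAl pintZ eE -mulrA.
  have -> : jint (L * (v * cpoly v)) = (pint x0 x1 ((x1%:P - 'X) * sqpoly v))%:C.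
    rewrite mul_cpoly (map_pint (real_complex R)) rmorphM rmorphB /=.
    by rewrite map_polyC map_polyX.
  case: (s) s0 => a b /= a0; simpc => /=; rewrite mulr_ge0 //.
  apply: pint_ge0 => [|t /andP[_ tx]]; first exact: ltW.
  by rewrite hornerM mulr_ge0 ?sqpoly_ge0 // !hornerE subr_ge0.
rewrite !mulrBl !pintB; move: h2 h3.
move: (jint (e^`() * _)) (jint (s *: e * _)) (jint (g * _)) => x y z + + /(congr1 (@complex.Re R)).
rewrite !ReB /=; move: (complex.Re x) (complex.Re y) (complex.Re z) => {}x {}y {}z.
by move: (sqnorm v) (normc _ ^+ 2) => a b *; lra.
Qed.

Lemma sqnormD v w : sqnorm (v + w) = sqnorm v + sqnorm w + 2 * complex.Re (jint (w * cpoly v)).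
Proof.
have h : (sqnorm (v + w))%:C = (sqnorm v)%:C + (sqnorm w)%:C +
    (2 * complex.Re (jint (w * cpoly v)))%:C.
  rewrite -!jint_sq -Re_addcJ -jint_conj -!pintD cpolyM cpolyK cpolyD.
  by congr (pint _ _ _); ring.
exact: (congr1 (@complex.Re R) h).
Qed.

Lemma factor_end e N : (size e <= N.+1)%N -> e.[x1%:C] = 0 ->
  exists2 v, e = (x1%:C%:P - 'X) * v & (size v <= N)%N.
Proof.
move=> se e1; have /factor_theorem[w eE] : root e x1%:C by apply/eqP.
exists (- w); first by rewrite eE mulrN -mulNr opprB mulrC.
have [->|wn0] := eqVneq w 0; first by rewrite oppr0 size_poly0.
by move: se; rewrite eE size_mul ?polyXsubC_eq0 // size_XsubC addn2 size_polyN.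
Qed.

(** Testing against polynomials of degree less than [N] is how the tau equation
    appears here, and [v = e / (x1 - X)] is an admissible test function. In the
    energy inequality, [|v + g|^2 >= 0] absorbs the term with [g], and
    [e(x0) = (x1 - x0) v(x0)]. *)
Lemma tau_error e g s (N : nat) : (size e <= N.+1)%N -> e.[x1%:C] = 0 -> 0 <= complex.Re s ->
  (forall v, (size v <= N)%N -> jint ((e^`() - s *: e - g) * cpoly v) = 0) ->
  normc e.[x0%:C] ^+ 2 <= (x1 - x0) * sqnorm g.
Proof.
move=> se e1 s0 weak.
have [v eE sv] := factor_end se e1.
have := energy eE s0 (weak v sv).
have := sqnorm_ge0 (v + g); rewrite sqnormD => h1 h2.
have h0 : 0 < x1 - x0 by rewrite subr_gt0.
have -> : normc e.[x0%:C] ^+ 2 = (x1 - x0) * ((x1 - x0) * normc v.[x0%:C] ^+ 2).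
  rewrite eE hornerM hornerD hornerN hornerC hornerX -rmorphB.
  by rewrite normcM normc_real gtr0_norm // exprMn; ring.
by rewrite ler_pM2l //; lra.
Qed.

Lemma tau_unique e s (N : nat) : (size e <= N.+1)%N -> e.[x1%:C] = 0 -> 0 <= complex.Re s ->
  (forall v, (size v <= N)%N -> jint ((e^`() - s *: e) * cpoly v) = 0) -> e = 0.
Proof.
move=> se e1 s0 weak.
have [v eE sv] := factor_end se e1.
have := @energy e v 0 s eE s0; rewrite subr0 mul0r pint0 /= mulr0 addr0.
move=> /(_ (weak v sv)) h; have h1 := sqnorm_ge0 v.
have h2 : 0 <= (x1 - x0) * normc v.[x0%:C] ^+ 2.
  by rewrite mulr_ge0 ?sqr_ge0 // subr_ge0 ltW.
have v0 : v = 0 by apply: sqnorm_eq0; lra.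
by rewrite eE v0 mulr0.
Qed.

Section Tau.
Variables (N : nat) (phi : {poly R[i]}).
Hypothesis sphi : size phi = N.+1.
Hypothesis cphi : cpoly phi = phi.
Hypothesis ophi : forall v, (size v <= N)%N -> jint (phi * v) = 0.

(** The tau equation [xi' = s T xi], where [T] removes the component along
    [phi]: the condition on the size is what determines the coefficient [c]. *)
Definition tau_sol s (xi : {poly R[i]}) := (size xi <= N.+1)%N /\
  exists2 c, (size (xi - c *: phi)%R <= N)%N & xi^`() = s *: (xi - c *: phi).

(** The derivative of [|xi|^2] integrates to [2 Re (s) |T xi|^2], because
    [T xi] is orthogonal to the component that [T] removes. *)
Lemma tau_sol_contract s xi : tau_sol s xi -> 0 <= complex.Re s ->
  normc xi.[x0%:C] <= normc xi.[x1%:C].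
Proof.
case=> sxi [c sT dxi] s0; pose eta := xi - c *: phi; rewrite -/eta in sT dxi.
rewrite -ler_sqr ?nnegrE ?normc_ge0 // -subr_ge0.
have -> : normc xi.[x1%:C] ^+ 2 - normc xi.[x0%:C] ^+ 2 =
    2 * complex.Re (jint (xi^`() * cpoly xi)).
  apply: (@complexI R); rewrite -Re_addcJ -jint_conj -pintD cpolyM cpolyK cpoly_deriv.
  have -> : xi^`() * cpoly xi + (cpoly xi)^`() * xi = (xi * cpoly xi)^`().
    by rewrite derivM; ring.
  by rewrite pint_deriv !hornerM !horner_cpoly !mulc_conjc rmorphB.
have -> : jint (xi^`() * cpoly xi) = s * (sqnorm eta)%:C.
  rewrite dxi -scalerAl pintZ -jint_sq; congr (_ * _).
  have -> : cpoly xi = cpoly eta + conjc c *: phi.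
    by rewrite -[phi]cphi -cpolyZ -cpolyD subrK.
  by rewrite mulrDr pintD -scalerAr pintZ [eta * phi]mulrC ophi // mulr0 addr0.
have := sqnorm_ge0 eta; case: (s) s0 => a b /= a0 h; simpc => /=.
by rewrite !mulr_ge0.
Qed.

Lemma tau_sol_eq0 s xi : tau_sol s xi -> 0 <= complex.Re s -> xi.[x1%:C] = 0 -> xi = 0.
Proof.
case=> sxi [c sT dxi] s0 xi1; apply: (tau_unique sxi xi1 s0) => v sv.
by rewrite dxi -scalerBr -scalerAl pintZ addrAC subrr add0r mulNr -scalerAl pintN pintZ ophi ?size_cpoly // mulr0 oppr0 mulr0.
Qed.

(** Solving the tau equation for the successive derivatives of [phi] leads to
    this sum, in which differentiation shifts the index. *)
Definition tau_fun s : {poly R[i]} := \sum_(j < N.+1) s ^+ (N - j) *: phi^`(j).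

Lemma tau_fun_deriv s : (tau_fun s)^`() = s *: (tau_fun s - s ^+ N *: phi).
Proof.
rewrite /tau_fun [in RHS]big_ord_recl /= subn0 addrAC subrr add0r.
rewrite [LHS]linear_sum big_ord_recr /= subnn derivZ -derivnS.
have -> : phi^`(N.+1) = 0 by apply/derivn_poly0; rewrite sphi.
rewrite scaler0 addr0 scaler_sumr; apply: eq_bigr => j _.
rewrite derivZ -derivnS scalerA /bump /= add1n -exprS; congr (_ ^+ _ *: _).
by rewrite subnSK.
Qed.

Lemma size_tau_fun s : (size (tau_fun s) <= N.+1)%N.
Proof.
apply: (leq_trans (size_sum _ _ _)); apply/bigmax_leqP => j _.
rewrite (leq_trans (size_scale_leq _ _)) // (leq_trans (size_derivn_le _ _)) // sphi.
exact: leq_subr.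
Qed.

Lemma size_tau_residual s : (size (tau_fun s - s ^+ N *: phi)%R <= N)%N.
Proof.
rewrite /tau_fun big_ord_recl /= subn0 addrAC subrr add0r.
apply: (leq_trans (size_sum _ _ _)); apply/bigmax_leqP => j _.
rewrite (leq_trans (size_scale_leq _ _)) // (leq_trans (size_derivn_le phi j.+1)) // sphi.
by rewrite subSS leq_subr.
Qed.

Lemma tau_fun_sol s : tau_sol s (tau_fun s).
Proof.
split; first exact: size_tau_fun.
by exists (s ^+ N); [exact: size_tau_residual | exact: tau_fun_deriv].
Qed.

Lemma tau_fun_neq0 s : tau_fun s != 0.
Proof.
have phi0 : phi != 0 by rewrite -size_poly_gt0 sphi.
apply/eqP => h; have [s0|sn0] := eqVneq s 0.
  have := h; rewrite /tau_fun s0 big_ord_recr /= subnn expr0 scale1r big1 ?add0r.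
    move/polyP/(_ 0%N)/eqP; rewrite coef_derivn coef0 addn0 mulrn_eq0.
    by rewrite -[N]/(N.+1.-1) -{3}sphi -lead_coefE lead_coef_eq0 (negbTE phi0) orbF ffactnn -leqn0 leqNgt fact_gt0.
  by move=> j _; rewrite expr0n subn_eq0 leqNgt ltn_ord scale0r.
have := tau_fun_deriv s; rewrite h deriv0 sub0r scalerN scalerA => /esym/eqP.
by rewrite oppr_eq0 scaler_eq0 (negbTE phi0) orbF mulf_eq0 expf_eq0 (negbTE sn0) andbF.
Qed.

Lemma tau_fun1_neq0 s : 0 <= complex.Re s -> (tau_fun s).[x1%:C] != 0.
Proof.
move=> s0; apply: contraNN (tau_fun_neq0 s) => /eqP h.
by apply/eqP; apply: (tau_sol_eq0 (tau_fun_sol s)).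
Qed.

(** The approximation of [exp (- s (x1 - x0))] by the tau method: every solution
    is multiplied by this number from the right end to the left end. *)
Definition tau_ratio s := (tau_fun s).[x0%:C] / (tau_fun s).[x1%:C].

Lemma tau_sol_sub s c xi eta : tau_sol s xi -> tau_sol s eta -> tau_sol s (xi - c *: eta).
Proof.
case=> s1 [c1 t1 d1] [s2 [c2 t2 d2]]; split.
  rewrite (leq_trans (size_polyD _ _)) // geq_max s1 size_polyN.
  by rewrite (leq_trans (size_scale_leq _ _)).
have E : xi - c *: eta - (c1 - c * c2) *: phi = (xi - c1 *: phi) - c *: (eta - c2 *: phi).
  rewrite scalerBl scalerBr scalerA !opprD !opprK; ring.
exists (c1 - c * c2); rewrite E.
  rewrite (leq_trans (size_polyD _ _)) // geq_max t1 size_polyN.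
  by rewrite (leq_trans (size_scale_leq _ _)).
by rewrite derivB derivZ d1 d2 [in RHS]scalerBr !scalerA [c * s]mulrC.
Qed.

Lemma tau_sol_ratio s xi : tau_sol s xi -> 0 <= complex.Re s ->
  xi.[x0%:C] = tau_ratio s * xi.[x1%:C].
Proof.
move=> sxi s0; have n0 := tau_fun1_neq0 s0.
have := tau_sol_eq0 (tau_sol_sub (xi.[x1%:C] / (tau_fun s).[x1%:C]) sxi (tau_fun_sol s)) s0.
rewrite hornerD hornerN hornerZ divfK // subrr => /(_ erefl)/eqP; rewrite subr_eq0 => /eqP ->.
by rewrite hornerZ /tau_ratio hornerZ -!mulrA; field.
Qed.

Lemma tau_ratio_le1 s : 0 <= complex.Re s -> normc (tau_ratio s) <= 1.
Proof.
move=> s0; have n0 := tau_fun1_neq0 s0.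
rewrite /tau_ratio normcM normcV ler_pdivrMr ?normc_gt0 // mul1r.
exact: tau_sol_contract (tau_fun_sol s) s0.
Qed.

(** The normalized solution is compared with the Taylor polynomial of
    [exp (s (t - x1))], which solves the tau equation up to a single monomial. *)
Lemma tau_ratio_error s M : N = M.+1 -> 0 <= complex.Re s ->
  normc (tau_ratio s - cexp (- (s * (x1 - x0)%:C))) <=
  (normc s * (x1 - x0)) ^+ N / M`!%:R +
  expR (normc s * (x1 - x0)) * (normc s * (x1 - x0)) ^+ N / N`!%:R.
Proof.
move=> NM s0; have n0 := tau_fun1_neq0 s0; have h0 : 0 < x1 - x0 by rewrite subr_gt0.
pose c := ((tau_fun s).[x1%:C])^-1; pose L : {poly R[i]} := 'X - x1%:C%:P.
pose q : {poly R[i]} := (s ^+ M / M`!%:R) *: L ^+ M.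
pose p : {poly R[i]} := \sum_(j < N) (s ^+ j / j`!%:R) *: L ^+ j.
have dp : p^`() = s *: (p - q).
  rewrite /p NM [in RHS]big_ord_recr /= addrK linear_sum big_ord_recl /=.
  rewrite (_ : L ^+ 0 = 1%:P) // derivZ derivC scaler0 add0r scaler_sumr.
  apply: eq_bigr => j _; rewrite derivZ deriv_exp derivXsubC mul1r.
  rewrite /bump add1n /= -[L ^+ j *+ _]scaler_nat !scalerA; congr (_ *: _).
  rewrite factS natrM exprS; have := fact_gt0 j.
  by rewrite -(ltr0n R[i]) => j0; field; rewrite gt_eqF //= pnatr_eq0.
have sL k : size (L ^+ k) = k.+1 by rewrite size_exp_XsubC.
have sp : (size p <= N)%N.
  apply: (leq_trans (size_sum _ _ _)); apply/bigmax_leqP => j _.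
  by rewrite (leq_trans (size_scale_leq _ _)) // sL.
have p1 : p.[x1%:C] = 1.
  rewrite /p NM horner_sum big_ord_recl /= big1 ?addr0 => [|j _].
    by rewrite !expr0 fact0 divr1 scale1r hornerC.
  by rewrite hornerZ horner_exp !hornerE subrr expr0n /= mulr0.
have p0 : p.[x0%:C] = cexp_taylor N (- (s * (x1 - x0)%:C)).
  rewrite /p horner_sum; apply: eq_bigr => j _.
  rewrite hornerZ horner_exp !hornerE mulrAC -exprMn; congr (_ ^+ _ / _).
  by rewrite rmorphB; ring.
pose e := c *: tau_fun s - p; pose g := s *: q.
have e0 : e.[x0%:C] = tau_ratio s - p.[x0%:C].
  by rewrite /e hornerD hornerN hornerZ /c /tau_ratio mulrC.
have eN : normc e.[x0%:C] <= (normc s * (x1 - x0)) ^+ N / M`!%:R.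
  rewrite -ler_sqr ?nnegrE ?normc_ge0 //; last first.
    by rewrite divr_ge0 // exprn_ge0 // mulr_ge0 ?normc_ge0 // ltW.
  have se : (size e <= N.+1)%N.
    rewrite (leq_trans (size_polyD _ _)) // geq_max size_polyN (leq_trans sp) // andbT.
    by rewrite (leq_trans (size_scale_leq _ _)) // size_tau_fun.
  have e1 : e.[x1%:C] = 0.
    by rewrite /e hornerD hornerN hornerZ p1 /c mulVf // subrr.
  have weak v : (size v <= N)%N -> jint ((e^`() - s *: e - g) * cpoly v) = 0.
    move=> sv; rewrite (_ : _ - g = - (c * s ^+ N.+1) *: phi).
      by rewrite -scalerAl pintZ ophi ?size_cpoly // mulr0.
    rewrite /g /e derivB derivZ dp tau_fun_deriv !scalerBr !scalerA scaleNr exprS.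
    rewrite [s * c]mulrC !mulrA; ring.
  apply: le_trans (tau_error se e1 s0 weak) _.
  rewrite /sqnorm; have [t /= tI ->] := pint_mean (sqpoly g) x01; rewrite sqpolyE mulrC -mulrA -expr2.
  rewrite -exprMn ler_sqr ?nnegrE ?mulr_ge0 ?normc_ge0 ?divr_ge0 ?exprn_ge0 ?(ltW h0) //; last first.
    by rewrite mulr_ge0 ?normc_ge0 // ltW.
  move: tI; rewrite in_itv /= => /andP[t0 t1].
  rewrite /g /q !hornerZ horner_exp !hornerE -rmorphB !normcM !normcX normcV normc_nat normc_real.
  rewrite -exprS -NM exprMn -[leLHS]mulrA mulrAC.
  apply: ler_wpM2r; first by rewrite invr_ge0.
  apply: ler_wpM2l; first by rewrite exprn_ge0 ?normc_ge0.
  rewrite [in leRHS]NM exprSr ler_wpM2r ?(ltW h0) // lerXn2r ?nnegrE ?(ltW h0) //.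
  by rewrite distrC ger0_norm ?subr_ge0 // lerB.
rewrite -(subrKA p.[x0%:C]) -e0; apply: le_trans (normcD _ _) _.
rewrite lerD // p0 -normcN opprB (le_trans (cexp_taylor_le _ _)) //.
by rewrite normcN normcM normc_real gtr0_norm.
Qed.

End Tau.
End SegmentProduct.

(** * Legendre polynomials *)

Section Rodrigues.
Variables (F : numFieldType) (a b : F).
Implicit Types P Q v : {poly F}.

(** Differentiation lowers the multiplicity of a root by at most one. *)
Lemma multiple_root_deriv x P N : (exists Q, P = Q * ('X - x%:P) ^+ N.+1) ->
  exists Q, P^`() = Q * ('X - x%:P) ^+ N.
Proof.
case=> Q ->; exists (Q^`() * ('X - x%:P) + Q *+ N.+1).
rewrite derivM deriv_exp derivXsubC mul1r mulrDl -mulrA -exprS; congr (_ + _).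
by rewrite mulrnAr mulrnAl.
Qed.

Lemma multiple_root_derivn x P N j : (j < N)%N -> (exists Q, P = Q * ('X - x%:P) ^+ N) ->
  P^`(j).[x] = 0.
Proof.
move=> jN PE; have [Q ->] : exists Q, P^`(j) = Q * ('X - x%:P) ^+ (N - j).
  elim: j jN => [|j IH] jN; first by rewrite subn0.
  by rewrite derivnS; apply: multiple_root_deriv; rewrite subnSK; [apply: IH; exact: ltnW|exact: ltnW].
by rewrite hornerM horner_exp !hornerE subrr expr0n subn_eq0 leqNgt jN mulr0.
Qed.

(** Integrating by parts [N] times moves all derivatives to [v], and the
    boundary terms contain derivatives of order less than [N] of a polynomial
    with roots of multiplicity [N] at both ends. *)
Lemma rodrigues_orthogonal N v : (size v <= N)%N ->
  pint a b (((('X - a%:P) * ('X - b%:P)) ^+ N)^`(N) * v) = 0.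
Proof.
set W := _ ^+ N => sv; suff H j (u : {poly F}) : (j <= N)%N -> (size u <= j)%N -> pint a b (W^`(j) * u) = 0.
  exact: H.
elim: j u => [|j IH] u jN su.
  by move: su; rewrite leqn0 size_poly_eq0 => /eqP ->; rewrite mulr0 pint0.
rewrite derivnS pint_parts IH ?(ltnW jN) //; last first.
  have [->|un0] := eqVneq u 0; first by rewrite deriv0 size_poly0.
  by rewrite -ltnS (leq_trans (lt_size_deriv un0)).
have Wa : W^`(j).[a] = 0.
  by apply: multiple_root_derivn jN _; exists (('X - b%:P) ^+ N); rewrite /W exprMn mulrC.
have Wb : W^`(j).[b] = 0.
  by apply: multiple_root_derivn jN _; exists (('X - a%:P) ^+ N); rewrite /W exprMn.
by rewrite Wa Wb !mul0r !subr0.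
Qed.

End Rodrigues.

Section Legendre.
Variable R : realType.

Lemma derivn_comp_affine (P : {poly R}) (c d : R) N :
  (P \Po (c *: 'X + d%:P))^`(N) = c ^+ N *: (P^`(N) \Po (c *: 'X + d%:P)).
Proof.
elim: N => [|N IH]; first by rewrite scale1r.
rewrite !derivnS IH derivZ deriv_comp derivD derivZ derivX derivC addr0.
by rewrite mulr_algr scalerA -exprSr.
Qed.

Lemma legendre_affine N (a b : R) : a < b -> exists2 c, c != 0 &
  legendre R N \Po ((b - a)^-1 *: (2 *: 'X - (a + b)%:P)) =
  c *: ((('X - a%:P) * ('X - b%:P)) ^+ N)^`(N).
Proof.
move=> ab; have h0 : b - a != 0 by rewrite subr_eq0 gt_eqF.
pose al := (b - a)^-1 * 2; pose be := - ((b - a)^-1 * (a + b)).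
have al0 : al != 0 by rewrite mulf_neq0 ?invr_neq0 ?pnatr_eq0.
have -> : (b - a)^-1 *: (2 *: 'X - (a + b)%:P) = al *: 'X + be%:P.
  by rewrite scalerBr scalerA /be polyCN polyCM mul_polyC.
have e1 : be = - al * ((a + b) / 2) by rewrite /be /al; field.
have e2 : 1 = (al * (b - a) / 2) ^+ 2 by rewrite /al; field.
clearbody al be; exists ((2 ^+ N * N`!%:R)^-1 * al ^- N * al ^+ 2 ^+ N).
  have f0 : (2 ^+ N * N`!%:R)^-1 != 0 :> R.
    by rewrite invr_neq0 // mulf_neq0 ?expf_neq0 ?pnatr_eq0 // -lt0n fact_gt0.
  by rewrite !mulf_neq0 // ?invr_neq0 ?expf_neq0.
rewrite /legendre comp_polyZ -!scalerA; congr (_ *: _).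
have := derivn_comp_affine (('X ^+ 2 - 1) ^+ N) al be N.
move=> /(congr1 (fun p => al ^- N *: p)); rewrite [RHS]scalerA mulVf ?expf_neq0 // scale1r => <-.
congr (_ *: _); rewrite -derivnZ; congr (derivn _ _).
rewrite rmorphXn /= rmorphB rmorphXn /= comp_polyX rmorph1 -exprZn; congr (_ ^+ _).
rewrite -!mul_polyC.
pose g : {poly R} := (2^-1)%:P.
have be' : be%:P = - al%:P * ((a%:P + b%:P) * g) by rewrite e1 !polyCM polyCN polyCD.
have one : 1 = (al%:P * (b%:P - a%:P) * g) ^+ 2.
  by rewrite -polyCB -!polyCM -rmorphXn /= -e2.
have g2 : g * 2 = 1.
  by rewrite -[2](rmorph_nat (@polyC R)) -polyCM mulVf ?pnatr_eq0.
transitivity ((al%:P * 'X + be%:P) ^+ 2 - (al%:P * (b%:P - a%:P) * g) ^+ 2).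
  by rewrite -one.
rewrite be' polyCM.
transitivity (al%:P ^+ 2 * ('X ^+ 2 - (a%:P + b%:P) * 'X * (g * 2) + a%:P * b%:P * (g * 2) ^+ 2)).
  by ring.
by rewrite g2; ring.
Qed.

Lemma size_rodrigues N (a b : R) :
  size ((('X - a%:P) * ('X - b%:P)) ^+ N)^`(N) = N.+1.
Proof.
have W0 : (('X - a%:P) * ('X - b%:P)) ^+ N != 0 by rewrite expf_neq0 // mulf_neq0 // polyXsubC_eq0.
rewrite cauchyreals.size_derivn -(prednK (_ : (0 < size _)%N)) ?size_poly_gt0 //.
rewrite size_exp size_mul ?polyXsubC_eq0 // !size_XsubC /= mul2n -addnn.
by rewrite -addSn addnK.
Qed.

Lemma Rintegral_poly (a b : R) (P : {poly R}) : a < b ->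
  (\int[lebesgue_measure]_(t in `[a, b]) P.[t])%R = pint a b P.
Proof.
move=> ab; rewrite /Rintegral (@continuous_FTC2 _ _ (fun t => (prim P).[t]) a b ab) //.
- by apply: continuous_subspaceT => t; exact: continuous_horner.
- split=> [t _||]; first exact: derivable_horner.
  + by apply: cvg_at_right_filter; exact: continuous_horner.
  + by apply: cvg_at_left_filter; exact: continuous_horner.
- by move=> t _; rewrite -derivE deriv_prim.
Qed.

(** Lebesgue and algebraic integrals agree by the fundamental theorem of
    calculus, for the real and imaginary parts. *)
Lemma l2dot_poly (a b : R) (f g : {poly R[i]}) : a < b ->
  l2dot a b (fun t => f.[t%:C]) (fun t => g.[t%:C]) = pint a%:C b%:C (f * cpoly g).
Proof.
move=> ab; set h := f * cpoly g.
have hE t : f.[t%:C] * conjc (g.[t%:C]) = h.[t%:C] by rewrite /h hornerM horner_cpoly.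
have hR t : complex.Re h.[t%:C] = (map_poly (@complex.Re R) h).[t].
  rewrite [in LHS](polyReIm h) hornerD hornerZ !horner_map /=; by simpc.
have hI t : complex.Im h.[t%:C] = (map_poly (@complex.Im R) h).[t].
  rewrite [in LHS](polyReIm h) hornerD hornerZ !horner_map /=; by simpc.
rewrite [RHS](_ : _ = pint a b (map_poly (@complex.Re R) h) +i* pint a b (map_poly (@complex.Im R) h)).
  rewrite /l2dot -!Rintegral_poly //; congr (_ +i* _).
    by apply: eq_Rintegral => t _; rewrite -hR -hE.
  by apply: eq_Rintegral => t _; rewrite -hI -hE.
rewrite [in LHS](polyReIm h) pintD pintZ -!map_pint /=; by simpc.
Qed.

End Legendre.

Section SegmentLegendre.
Variables (R : realType) (m : nat) (tau : 'rV[R]_m.+1).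
Hypothesis tau_incr : forall k : 'I_m.+1, knot tau k < knot tau k.+1.
Implicit Types (k : 'I_m.+1) (N : nat).

Local Notation x0 k := (- knot tau (nat_of_ord k).+1).
Local Notation x1 k := (- knot tau (nat_of_ord k)).

Lemma seg_lt k : x0 k < x1 k.
Proof. by rewrite ltrN2. Qed.

Lemma seg_legendreE N k : exists2 c : R, c != 0 & seg_legendre tau N k =
  map_poly (real_complex R) (c *: ((('X - (x0 k)%:P) * ('X - (x1 k)%:P)) ^+ N)^`(N)).
Proof.
have [c c0 cE] := legendre_affine N (seg_lt k); exists c => //.
rewrite -cE /seg_legendre; congr (map_poly _ (_ \Po (_ *: (_ + _)))).
  by congr (_^-1); rewrite opprK addrC.
by rewrite -polyCN -opprD opprK.
Qed.

Lemma size_seg_legendre N k : size (seg_legendre tau N k) = N.+1.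
Proof.
have [c c0 ->] := seg_legendreE N k.
by rewrite size_map_poly size_scale // size_rodrigues.
Qed.

Lemma cpoly_seg_legendre N k : cpoly (seg_legendre tau N k) = seg_legendre tau N k.
Proof. by apply/polyP => i; rewrite !coef_map /= oppr0. Qed.

Lemma seg_legendre_orthogonal N k (v : {poly R[i]}) : (size v <= N)%N ->
  pint (x0 k)%:C (x1 k)%:C (seg_legendre tau N k * v) = 0.
Proof.
have [c c0 ->] := seg_legendreE N k => sv.
rewrite map_polyZ -scalerAl pintZ -derivn_map rmorphXn /= rmorphM /=.
by rewrite !rmorphB /= !map_polyX !map_polyC rodrigues_orthogonal // mulr0.
Qed.

Lemma seg_dotE k f g : seg_dot tau k f g = pint (x0 k)%:C (x1 k)%:C (f * cpoly g).
Proof. exact: l2dot_poly (seg_lt k). Qed.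

Lemma seg_legendre_neq0 N k : seg_legendre tau N k != 0.
Proof. by rewrite -size_poly_gt0 size_seg_legendre. Qed.

Lemma seg_legendre_dot_neq0 N k :
  seg_dot tau k (seg_legendre tau N k) (seg_legendre tau N k) != 0.
Proof.
rewrite seg_dotE jint_sq; apply: contra_neq (seg_legendre_neq0 N k).
by move=> /complexI; exact: sqnorm_eq0 (seg_lt k) _.
Qed.

Definition legendre_coef N k (xi : {poly R[i]}) : R[i] :=
  seg_dot tau k xi (seg_legendre tau N k) /
  seg_dot tau k (seg_legendre tau N k) (seg_legendre tau N k).

(** The difference is orthogonal to the Legendre polynomial, so that [c] is the
    projection coefficient and no inner product has to be computed. *)
Lemma legendre_coef_unique N k (xi : {poly R[i]}) c :
  (size (xi - c *: seg_legendre tau N k)%R <= N)%N -> legendre_coef N k xi = c.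
Proof.
set phi := seg_legendre tau N k => sz; rewrite /legendre_coef -/phi.
have p0 : seg_dot tau k phi phi != 0 by exact: seg_legendre_dot_neq0.
have : seg_dot tau k xi phi = c * seg_dot tau k phi phi; last by move=> ->; rewrite mulfK.
rewrite !seg_dotE -pintZ; apply/eqP; rewrite -subr_eq0 -pintB scalerAl -mulrBl mulrC.
by rewrite cpoly_seg_legendre seg_legendre_orthogonal.
Qed.

Lemma size_sub_legendre N k (xi : {poly R[i]}) : (size xi <= N.+1)%N ->
  (size (xi - legendre_coef N k xi *: seg_legendre tau N k)%R <= N)%N.
Proof.
set phi := seg_legendre tau N k => sxi; pose c := xi`_N / phi`_N.
have sc : (size (xi - c *: phi)%R <= N)%N.
  apply/leq_sizeP => j; rewrite leq_eqVlt => /orP[/eqP <-|Nj].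
    rewrite coefB coefZ divfK ?subrr //.
    by rewrite -[N]/(N.+1.-1) -(size_seg_legendre N k) -lead_coefE lead_coef_eq0 seg_legendre_neq0.
  by rewrite coefB coefZ !nth_default ?mulr0 ?subrr ?size_seg_legendre // (leq_trans sxi).
by rewrite (legendre_coef_unique sc).
Qed.

End SegmentLegendre.

(** * The spline discretization *)

Lemma linfun_linear (K : fieldType) (aT rT : vectType K) (f : aT -> rT) :
  linear f -> linfun f =1 f.
Proof.
move=> lf; pose ff : {linear aT -> rT} := HB.pack f (GRing.isLinear.Build _ _ _ _ f lf).
exact: (lfunE ff).
Qed.

Section Spline.
Variables (R : realType) (n p q m : nat).
Variables (E A0 : 'M[R[i]]_n) (A : 'I_m.+1 -> 'M[R[i]]_n).
Variables (B : 'M[R[i]]_(n, p)) (C : 'M[R[i]]_(q, n)).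
Variable tau : 'rV[R]_m.+1.
Hypothesis tau_incr : forall k : 'I_m.+1, knot tau k < knot tau k.+1.
Variable N : nat.
Implicit Types (k : 'I_m.+1) (j : 'I_n) (X Y : spline R n m N) (s : R[i]).

Local Notation x0 k := (- knot tau (nat_of_ord k).+1).
Local Notation x1 k := (- knot tau (nat_of_ord k)).
Local Notation phi k := (seg_legendre tau N k).
Local Notation Spl := (spline R n m N).
Local Notation comp X k j := ((X : {ffun 'I_m.+1 -> {ffun 'I_n -> {poly_(N.+1) R[i]}}}) k j : {poly R[i]}).

Lemma spline_lin (c : R[i]) X Y k j : comp (c *: X + Y) k j = c *: comp X k j + comp Y k j.
Proof. by rewrite !ffunE. Qed.

Lemma vpoly_lin d (c : R[i]) (f g : vpoly R n d) j :
  ((c *: f + g) j : {poly R[i]}) = c *: (f j : {poly R[i]}) + (g j : {poly R[i]}).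
Proof. by rewrite !ffunE. Qed.

Lemma vpoly0 d j : ((0 : vpoly R n d) j : {poly R[i]}) = 0.
Proof. by rewrite ffunE. Qed.

Lemma size_comp X k j : (size (comp X k j) <= N.+1)%N.
Proof. exact: size_npoly. Qed.

Lemma seg_eval_lin k t (c : R[i]) X Y :
  seg_eval k t (c *: X + Y) = c *: seg_eval k t X + seg_eval k t Y.
Proof. by apply/matrixP => a b; rewrite !mxE spline_lin hornerD hornerZ. Qed.

(** The component without its leading Legendre part; it already has degree less
    than [N], so that the cut-off in the discretization changes nothing. *)
Definition trunc_comp X k j : {poly R[i]} :=
  comp X k j - legendre_coef tau N k (comp X k j) *: phi k.

Lemma size_trunc_comp X k j : (size (trunc_comp X k j) <= N)%N.
Proof. exact: size_sub_legendre (size_comp X k j). Qed.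

Lemma seg_truncE X k j : (seg_trunc tau k X j : {poly R[i]}) = trunc_comp X k j.
Proof. by rewrite ffunE npolypK // size_trunc_comp. Qed.

Lemma seg_derivE X k j : (seg_deriv k X j : {poly R[i]}) = (comp X k j)^`().
Proof.
rewrite ffunE npolypK // -ltnS; have [->|n0] := eqVneq (comp X k j) 0.
  by rewrite deriv0 size_poly0.
by rewrite (leq_trans (lt_size_deriv n0)) // size_comp.
Qed.

Lemma trunc_comp_lin (c : R[i]) X Y k j :
  trunc_comp (c *: X + Y) k j = c *: trunc_comp X k j + trunc_comp Y k j.
Proof.
rewrite /trunc_comp spline_lin; set a := legendre_coef _ _ _ (_ + _).
suff -> : a = c * legendre_coef tau N k (comp X k j) + legendre_coef tau N k (comp Y k j).
  by rewrite scalerBr scalerDl !scalerA opprD addrACA.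
apply: legendre_coef_unique => //.
have -> : c *: comp X k j + comp Y k j -
   (c * legendre_coef tau N k (comp X k j) + legendre_coef tau N k (comp Y k j)) *: phi k =
   c *: trunc_comp X k j + trunc_comp Y k j.
  by rewrite /trunc_comp scalerBr scalerDl !scalerA opprD addrACA.
rewrite (leq_trans (size_polyD _ _)) // geq_max size_trunc_comp andbT.
by rewrite (leq_trans (size_scale_leq _ _)) // size_trunc_comp.
Qed.

Lemma seg_trunc_lin k (c : R[i]) X Y :
  seg_trunc tau k (c *: X + Y) = c *: seg_trunc tau k X + seg_trunc tau k Y.
Proof.
apply/ffunP => j; apply/val_inj; rewrite [LHS]seg_truncE trunc_comp_lin -!seg_truncE.
by rewrite -vpoly_lin.
Qed.

Lemma seg_deriv_lin k (c : R[i]) X Y :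
  seg_deriv k (c *: X + Y) = c *: seg_deriv k X + seg_deriv k Y.
Proof.
apply/ffunP => j; apply/val_inj; rewrite [LHS]seg_derivE spline_lin derivD derivZ -!seg_derivE.
by rewrite -vpoly_lin.
Qed.

Local Notation Cod := (spline_cod R n m N).

Lemma cod_lin (c : R[i]) a a' b b' d d' :
  c *: ((a, b, d) : Cod) + ((a', b', d') : Cod) = (c *: a + a', c *: b + b', c *: d + d').
Proof. by []. Qed.

Lemma cod_sub (c : R[i]) a a' b b' d d' :
  c *: ((a, b, d) : Cod) - ((a', b', d') : Cod) = (c *: a - a', c *: b - b', c *: d - d').
Proof. by []. Qed.

Lemma spl_EE X : spl_E E tau N X = (E *m seg_eval ord0 0 X, [ffun k => seg_trunc tau k X], 0).
Proof.
rewrite /spl_E linfun_linear // => c {}X Y.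
rewrite [RHS]cod_lin seg_eval_lin mulmxDr -scalemxAr scaler0 addr0; congr (_, _, _).
by apply/ffunP => k; rewrite !ffunE seg_trunc_lin.
Qed.

Lemma spl_AE X : spl_A A0 A tau N X =
  (A0 *m seg_eval ord0 0 X + \sum_k A k *m seg_eval k (- knot tau k.+1) X,
   [ffun k => seg_deriv k X],
   [ffun k : 'I_m => seg_eval (widen_ord (leqnSn m) k) (- knot tau k.+1) X
                       - seg_eval (lift ord0 k) (- knot tau k.+1) X]).
Proof.
rewrite /spl_A linfun_linear // => c {}X Y.
rewrite [RHS]cod_lin; congr (_, _, _).
- rewrite seg_eval_lin mulmxDr -scalemxAr scalerDr addrACA; congr (_ + _).
  rewrite scaler_sumr -big_split; apply: eq_bigr => k _.
  by rewrite seg_eval_lin mulmxDr -scalemxAr.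
- by apply/ffunP => k; rewrite !ffunE seg_deriv_lin.
- by apply/ffunP => k; rewrite !ffunE !seg_eval_lin scalerBr opprD addrACA.
Qed.

(** The pencil equation couples the segments only through the values at the
    knots; inside a segment it is the scalar tau equation. *)
Lemma spl_pencilP s X (v : 'cV[R[i]]_n) :
  spl_pencil E A0 A tau N s X = (v, 0, 0) <->
  [/\ (s *: E) *m seg_eval ord0 0 X -
        (A0 *m seg_eval ord0 0 X + \sum_k A k *m seg_eval k (- knot tau k.+1) X) = v,
      forall k j, (comp X k j)^`() = s *: trunc_comp X k j &
      forall k : 'I_m, seg_eval (widen_ord (leqnSn m) k) (- knot tau k.+1) X =
                       seg_eval (lift ord0 k) (- knot tau k.+1) X].
Proof.
rewrite /spl_pencil add_lfunE opp_lfunE scale_lfunE spl_EE spl_AE.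
rewrite [X in X = _]cod_sub scaler0 sub0r.
split=> [[e1 e2 e3]|[e1 e2 e3]].
  split=> [|k j|k].
  - by rewrite -e1 -scalemxAl.
  - have e2k : seg_deriv k X = s *: seg_trunc tau k X + 0.
      by apply/esym/eqP; rewrite addr0 -subr_eq0; apply/eqP; move/ffunP: e2 => /(_ k); rewrite !ffunE.
    by rewrite -seg_derivE -seg_truncE e2k vpoly_lin vpoly0 addr0.
  - move/ffunP: e3 => /(_ k); rewrite !ffunE => /eqP.
    by rewrite oppr_eq0 subr_eq0 => /eqP.
have e2k k : seg_deriv k X = s *: seg_trunc tau k X + 0.
  apply/ffunP => j; apply/val_inj; rewrite [LHS]seg_derivE e2 -seg_truncE.
  by apply/esym; apply: etrans (vpoly_lin _ _ _ _) _; rewrite vpoly0 addr0.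
congr (_, _, _).
- by rewrite -e1 -scalemxAl.
- apply/eqP; rewrite subr_eq0; apply/eqP/ffunP => k.
  by rewrite [RHS]ffunE e2k addr0 [LHS]ffunE; congr (_ *: _); rewrite ffunE.
- by apply/ffunP => k; rewrite !ffunE e3 subrr oppr0.
Qed.

Definition seg_ratio k s : R[i] := tau_ratio (x0 k) (x1 k) N (phi k) s.

(** Indexed by all natural numbers in order to allow induction along the knots. *)
Definition knot_mult (i : nat) s : R[i] := \prod_(l < i) seg_ratio (inord l) s.

(** The number that replaces the delay factor [cexp (- tau_k s)]: the product
    of the amplification factors of the segments up to the [k]-th delay. *)
Definition spl_mult s k : R[i] := knot_mult k.+1 s.

Lemma seg_tau_sol s X : (forall k j, (comp X k j)^`() = s *: trunc_comp X k j) ->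
  forall k j, tau_sol N (phi k) s (comp X k j).
Proof.
move=> e k j; split; first exact: size_comp.
by exists (legendre_coef tau N k (comp X k j)); [exact: size_trunc_comp | exact: e].
Qed.

(** From one knot to the next, the segment multiplies by its own factor, and the
    matching conditions carry the value over to the following segment. *)
Lemma knot_mult_values s X : 0 <= complex.Re s ->
  (forall k j, (comp X k j)^`() = s *: trunc_comp X k j) ->
  (forall k : 'I_m, seg_eval (widen_ord (leqnSn m) k) (- knot tau k.+1) X =
                    seg_eval (lift ord0 k) (- knot tau k.+1) X) ->
  (forall k, seg_eval k (x1 k) X = knot_mult k s *: seg_eval ord0 0 X) /\
  (forall k, seg_eval k (x0 k) X = spl_mult s k *: seg_eval ord0 0 X).
Proof.
move=> s0 e2 e3.
have step k : seg_eval k (x0 k) X = seg_ratio k s *: seg_eval k (x1 k) X.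
  apply/matrixP => j l; rewrite !mxE.
  apply: tau_sol_ratio (seg_tau_sol e2 k j) s0; first exact: seg_lt.
    exact: size_seg_legendre.
  exact: seg_legendre_orthogonal.
have multS k : knot_mult k.+1 s = seg_ratio k s * knot_mult k s.
  by rewrite /knot_mult big_ord_recr /= inord_val mulrC.
have left i : (i < m.+1)%N ->
    seg_eval (inord i) (- knot tau i) X = knot_mult i s *: seg_eval ord0 0 X.
  elim: i => [|i IH] im.
    rewrite /knot_mult big_ord0 scale1r oppr0; congr (seg_eval _ _ _).
    by apply/val_inj; rewrite /= inordK.
  have im' : (i < m)%N by [].
  have := e3 (Ordinal im').
  have -> : widen_ord (leqnSn m) (Ordinal im') = inord i.
    by apply/val_inj; rewrite /= inordK // ltnW.
  have -> : lift ord0 (Ordinal im') = inord i.+1 by apply/val_inj; rewrite /= /bump add1n inordK.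
  rewrite [nat_of_ord _]/= => <-.
  have ii : nat_of_ord (inord i : 'I_m.+1) = i by rewrite inordK // ltnW.
  have := step (inord i); rewrite ii => ->; rewrite IH ?(ltnW im) // scalerA.
  by have := multS (inord i); rewrite ii => ->.
have left' k : seg_eval k (x1 k) X = knot_mult k s *: seg_eval ord0 0 X.
  by have := left k (ltn_ord k); rewrite inord_val.
by split=> // k; rewrite step left' scalerA /spl_mult multS.
Qed.

(** The value at the origin of a kernel element is annihilated by an invertible
    matrix; it then vanishes at all knots, and on each segment a solution of
    the tau equation is determined by its value at the right end. *)
Lemma spl_ker0 s : 0 <= complex.Re s -> exp_mx E A0 A s (spl_mult s) \in unitmx ->
  lker (spl_pencil E A0 A tau N s) == 0%VS.
Proof.
move=> s0 uM; rewrite -subv0; apply/subvP => X; rewrite memv_ker memv0 => /eqP.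
move=> /(_ =P (0, 0, 0) :> Cod)/eqP/spl_pencilP[e1 e2 e3].
have [v1 v0] := knot_mult_values s0 e2 e3.
have x00 : seg_eval ord0 0 X = 0.
  have : exp_mx E A0 A s (spl_mult s) *m seg_eval ord0 0 X = 0.
    rewrite -[RHS]e1 /exp_mx /delay_sum mulmxBl mulmxDl mulmx_suml; congr (_ - (_ + _)).
    by apply: eq_bigr => k _; rewrite v0 -scalemxAl -scalemxAr.
  by move=> /(congr1 (mulmx (invmx (exp_mx E A0 A s (spl_mult s))))); rewrite mulKmx // mulmx0.
apply/eqP/ffunP => k; apply/ffunP => j; apply/val_inj.
transitivity (0 : {poly R[i]}); last by rewrite !ffunE.
apply: (tau_sol_eq0 (seg_lt tau_incr k) _ (seg_tau_sol e2 k j) s0).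
  exact: seg_legendre_orthogonal.
by have := v1 k; rewrite x00 scaler0 => /matrixP/(_ j 0); rewrite !mxE.
Qed.

(** The converse construction: each segment carries the multiple of the explicit
    solution that has the prescribed value at its right end. *)
Lemma spl_solution s (x : 'cV[R[i]]_n) : 0 <= complex.Re s -> exists X : Spl,
  seg_eval ord0 0 X = x /\
  spl_pencil E A0 A tau N s X = (exp_mx E A0 A s (spl_mult s) *m x, 0, 0).
Proof.
move=> s0; pose f k := tau_fun N (phi k) s.
pose c k j := knot_mult k s * x j 0 / (f k).[(x1 k)%:C].
pose X : Spl := [ffun k => [ffun j => npolyp N.+1 (c k j *: f k)]].
have f1 k : (f k).[(x1 k)%:C] != 0.
  apply: tau_fun1_neq0 s0; first exact: seg_lt.
    exact: size_seg_legendre.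
  exact: seg_legendre_orthogonal.
have XE k j : comp X k j = c k j *: f k.
  rewrite !ffunE npolypK // (leq_trans (size_scale_leq _ _)) // size_tau_fun //.
  exact: size_seg_legendre.
have e2 k j : (comp X k j)^`() = s *: trunc_comp X k j.
  have lc : legendre_coef tau N k (comp X k j) = c k j * s ^+ N.
    apply: legendre_coef_unique => //; rewrite XE -(scalerA (c k j)) -scalerBr.
    rewrite (leq_trans (size_scale_leq _ _)) // size_tau_residual //.
    exact: size_seg_legendre.
  rewrite /trunc_comp lc XE derivZ tau_fun_deriv ?size_seg_legendre //.
  by rewrite -(scalerA (c k j)) -[in RHS]scalerBr !scalerA [s * _]mulrC.
have v1 k : seg_eval k (x1 k) X = knot_mult k s *: x.
  by apply/matrixP => j l; rewrite !mxE XE hornerZ divfK // ord1.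
have x00 : seg_eval ord0 0 X = x.
  by have := v1 ord0; rewrite /= oppr0 /knot_mult big_ord0 scale1r.
have v0 k : seg_eval k (x0 k) X = spl_mult s k *: x.
  have mE : spl_mult s k = knot_mult k s * seg_ratio k s.
    by rewrite /spl_mult /knot_mult big_ord_recr /= inord_val.
  apply/matrixP => j l; rewrite mxE [RHS]mxE XE hornerZ mE ord1 /c /seg_ratio /tau_ratio -/(f k).
  by move: (f k).[_] (f k).[_] (knot_mult k s) (x j 0) => a b d e; ring.
have e3 (k : 'I_m) : seg_eval (widen_ord (leqnSn m) k) (- knot tau k.+1) X =
    seg_eval (lift ord0 k) (- knot tau k.+1) X.
  have := v0 (widen_ord (leqnSn m) k) => /= ->.
  by have := v1 (lift ord0 k); rewrite lift0 => ->.
exists X; split=> //; apply/spl_pencilP; split=> //.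
rewrite /exp_mx /delay_sum mulmxBl mulmxDl mulmx_suml x00; congr (_ - (_ + _)).
by apply: eq_bigr => k _; rewrite v0 -scalemxAl -scalemxAr.
Qed.

(** The input enters only the equation at the origin, where the pencil acts as
    the characteristic matrix with the delay factors replaced; injectivity
    identifies the solution. *)
Lemma spl_transferE s : 0 <= complex.Re s -> exp_mx E A0 A s (spl_mult s) \in unitmx ->
  spl_transfer E A0 A B C tau N s = C *m invmx (exp_mx E A0 A s (spl_mult s)) *m B.
Proof.
move=> s0 uM; set M := exp_mx _ _ _ _ _ in uM *.
apply/matrixP => i j; rewrite mxE.
have [X [X0 XP]] := spl_solution (invmx M *m (B *m delta_mx j 0)) s0.
have -> : spl_B m B N (delta_mx j 0) = spl_pencil E A0 A tau N s X.
  by rewrite XP -/M mulKVmx.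
by rewrite lker0_lfunK ?spl_ker0 // X0 !mulmxA -colE mxE.
Qed.

End Spline.

(** * Uniform bounds on the right half-plane *)

Lemma quotient_lip (R : realType) (u u' d d' : R[i]) (K c e : R) : 0 < c -> 0 <= K -> 0 <= e ->
  normc u <= K -> normc u' <= K -> normc d <= K -> normc d' <= K ->
  c <= normc d -> c <= normc d' -> normc (u - u') <= K * e -> normc (d - d') <= K * e ->
  `|normc (u / d) ^+ 2 - normc (u' / d') ^+ 2| <= 4 * (K / c) ^+ 3 * e.
Proof.
move=> c0 K0 e0 uK uK' dK dK' cd cd' uu dd.
have d0 : d != 0 by rewrite -normc_gt0 (lt_le_trans c0).
have d0' : d' != 0 by rewrite -normc_gt0 (lt_le_trans c0).
have quo (v w : R[i]) : normc v <= K -> c <= normc w -> normc (v / w) <= K / c.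
  move=> vK cw; rewrite normcM normcV ler_pM ?normc_ge0 ?invr_ge0 ?normc_ge0 //.
  by rewrite lef_pV2 ?posrE // (lt_le_trans c0).
have h1 : normc (u / d - u' / d') <= 2 * (K / c) ^+ 2 * e.
  have -> : u / d - u' / d' = ((u - u') * d' - u' * (d - d')) / (d * d') by field; rewrite d0 d0'.
  rewrite normcM normcV normcM.
  have -> : 2 * (K / c) ^+ 2 * e = (K * e * K + K * (K * e)) / (c * c) by field; rewrite gt_eqF.
  apply: ler_pM; rewrite ?normc_ge0 ?invr_ge0 ?mulr_ge0 ?normc_ge0 //.
    by rewrite (le_trans (normcB _ _)) // !normcM lerD // ler_pM ?normc_ge0.
  by rewrite lef_pV2 ?posrE ?mulr_gt0 ?(lt_le_trans c0) // ler_pM // ltW.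
have kc0 : 0 <= K / c by rewrite divr_ge0 // ltW.
rewrite subr_sqr normrM.
have -> : 4 * (K / c) ^+ 3 * e = (2 * (K / c) ^+ 2 * e) * (K / c + K / c) by ring.
apply: ler_pM; rewrite ?normr_ge0 //.
  rewrite ler_norml; have := normc_dist (u / d) (u' / d'); have := normc_dist (u' / d') (u / d).
  by rewrite [normc (u' / d' - _)]normcC => h2 h3; apply/andP; split; lra.
by rewrite ger0_norm ?addr_ge0 ?normc_ge0 // lerD ?quo.
Qed.

Lemma normc_half (R : realType) (a b : R[i]) (c e : R) :
  c <= normc a -> normc (a - b) <= e -> e <= c / 2 -> c / 2 <= normc b.
Proof. by move=> h1 h2 h3; have := normc_dist a b; lra. Qed.

Lemma normc_leC (R : realType) (a b : R[i]) (e : R) : normc (a - b) <= e -> normc (b - a) <= e.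
Proof. by rewrite normcC. Qed.

Lemma normc_sub_refl (R : realType) (a : R[i]) (e : R) : 0 <= e -> normc (a - a) <= e.
Proof. by rewrite subrr normc0. Qed.

Section UniformBounds.
Variables (R : realType) (n p q m : nat).
Variables (E A0 : 'M[R[i]]_n) (A : 'I_m.+1 -> 'M[R[i]]_n).
Variables (B : 'M[R[i]]_(n, p)) (C : 'M[R[i]]_(q, n)) (tau : 'rV[R]_m.+1).
Variables (r : nat) (L W : 'M[R[i]]_n).
Hypotheses (uL : L \in unitmx) (uW : W \in unitmx) (rn : (r <= n)%N).
Hypothesis E_bases : E = L *m Pd R n r *m W.
Hypothesis tau0 : forall k, 0 < tau 0 k.
Hypothesis index1 : alg_det A0 A r L W (fun _ => 0) != 0.
Hypothesis stable : strongly_exp_stable E A0 A tau.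
Hypothesis finite : (strong_h2norm E A0 A B C tau < +oo)%E.
Implicit Types (s : R[i]) (z : 'I_m.+1 -> R[i]).

Local Notation sysdet y x z := (\det (sysmx A0 A r L W y x z)).
Local Notation nume y x z := (numer A0 A B C r L W y x z).
Local Notation G s z := (C *m invmx (exp_mx E A0 A s z) *m B).
Local Notation dexp s := (fun k => cexp (- ((tau 0 k)%:C * s))).

Lemma lip_sysdet (T : Type) (fy fx : (T -> R[i]) -> R[i]) (fz : (T -> R[i]) -> 'I_m.+1 -> R[i]) :
  lip fy -> lip fx -> (forall k, lip (fz^~ k)) -> lip (fun t => sysdet (fy t) (fx t) (fz t)).
Proof. exact: fring_sysdet (fring_lip R T). Qed.

Lemma lip_numer (T : Type) (fy fx : (T -> R[i]) -> R[i]) (fz : (T -> R[i]) -> 'I_m.+1 -> R[i]) i j :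
  lip fy -> lip fx -> (forall k, lip (fz^~ k)) -> lip (fun t => nume (fy t) (fx t) (fz t) i j).
Proof. by move=> h1 h2 h3; apply: (fmx_numer _ _ _ _ _ _ _ (fring_lip R T)). Qed.

Lemma dexp_le1 s k : 0 <= complex.Re s -> normc (dexp s k) <= 1.
Proof.
move=> s0; rewrite normc_cexp -expR0 ler_expR; case: s s0 => a b /= a0.
by rewrite mul0r subr0 oppr_le0 mulr_ge0 // ltW.
Qed.

Lemma alg_det_lower_bound : exists2 c : R, 0 < c & forall z, (forall k, normc (z k) <= 1) ->
  c <= normc (alg_det A0 A r L W z).
Proof.
have cl x : bdd 1 x -> (forall d : R, 0 < d -> exists2 y : 'I_m.+1 -> R[i],
    forall k, normc (y k) <= 1 & nearby d y x) -> forall k, normc (x k) <= 1 by [].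
have nz x : (forall k, normc (x k) <= 1) -> alg_det A0 A r L W x != 0.
  exact: (alg_det_polydisc uL uW rn E_bases tau0 stable index1).
exact: (lip_min (alg_det_lip A0 A r L W) (fun x h => h) cl nz).
Qed.

(** Far from the origin the differential part dominates: the algebraic part is
    uniformly invertible, and the absence of feedthrough gives decay. *)
Lemma far_field : exists rho K : R, [/\ 0 < rho, 0 <= K &
  forall s z, (forall k, normc (z k) <= 1) -> rho <= normc s ->
    exp_mx E A0 A s z \in unitmx /\ forall i j, normc (G s z i j) <= K / normc s].
Proof.
have [c c0 cP] := alg_det_lower_bound.
pose J := option 'I_m.+1.
have lN : lip (fun x : J -> R[i] => x None) by exact: lip_var.
have l1 : lip (fun x : J -> R[i] => 1) by exact: (fring_cst (fring_lip R J) 1).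
have lS k : lip (fun x : J -> R[i] => x (Some k)) by exact: lip_var.
have [K1 K10 [_ K1P]] := lip_sysdet l1 lN lS 1.
have /choice[K2 K2P] (ij : 'I_q * 'I_p) : exists K : R, 0 <= K /\
    forall x y (d : R), 0 <= d -> bdd 1 x -> bdd 1 y -> nearby d x y ->
    normc (nume 1 (x None) (x \o Some) ij.1 ij.2 - nume 1 (y None) (y \o Some) ij.1 ij.2) <= K * d.
  by have [K K0 [_ KP]] := lip_numer ij.1 ij.2 l1 lN lS 1; exists K.
pose K := \sum_ij K2 ij.
have K2K ij : K2 ij <= K.
  by rewrite /K (bigD1 ij) //= lerDl sumr_ge0 // => l _; case: (K2P l).
have K0 : 0 <= K by apply: sumr_ge0 => l _; case: (K2P l).
pose sg : R := Num.min 1 (c / (2 * (1 + K1))).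
have K11 : 0 < 1 + K1 by rewrite ltr_wpDr.
have sg0 : 0 < sg by rewrite lt_min ltr01 divr_gt0 // mulr_gt0.
exists sg^-1, (K / (c / 2)); rewrite invr_gt0; split; [exact: sg0 | by rewrite divr_ge0 // divr_ge0 // ltW |] => s z z1 ss.
have s0 : s != 0 by rewrite -normc_gt0 (lt_le_trans _ ss) // invr_gt0.
have ns0 : 0 < normc s by rewrite normc_gt0.
have x0 : s^-1 != 0 by rewrite invr_eq0.
have xs : s^-1 * s = 1 by rewrite mulVf.
pose d : R := (normc s)^-1; have d0 : 0 <= d by rewrite invr_ge0 normc_ge0.
have dsg : d <= sg by rewrite -[sg]invrK lef_pV2 ?posrE ?invr_gt0.
have d1 : d <= 1 by rewrite (le_trans dsg) // ge_min lexx.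
pose x (o : J) : R[i] := if o is Some k then z k else s^-1.
pose y (o : J) : R[i] := if o is Some k then z k else 0.
have bx : bdd 1 x by case=> [k|] /=; rewrite ?normcV.
have byy : bdd 1 y by case=> [k|] /=; rewrite ?normc0.
have xy : nearby d x y by case=> [k|] /=; rewrite ?subrr ?subr0 ?normc0 ?normcV.
have det_ge : c / 2 <= normc (sysdet 1 s^-1 z).
  have h1 := K1P y x d d0 byy bx (fun o => normc_leC (xy o)).
  have h4 : K1 * d <= c / 2.
    have dc : d <= c / (2 * (1 + K1)) by rewrite (le_trans dsg) // ge_min lexx orbT.
    rewrite (@le_trans _ _ ((1 + K1) * d)) ?ler_wpM2r ?lerDr //.
    have -> : c / 2 = (1 + K1) * (c / (2 * (1 + K1))) by field; rewrite gt_eqF.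
    by rewrite ler_wpM2l // ltW.
  exact: (normc_half (cP z z1) h1 h4).
have c20 : 0 < c / 2 by rewrite divr_gt0.
have uM : exp_mx E A0 A s z \in unitmx.
  rewrite -(sysmx_unit A0 A uL uW rn E_bases s z x0) xs unitmxE unitfE -normc_gt0.
  exact: lt_le_trans c20 det_ge.
split; first exact: uM.
move=> i j; rewrite (transfer_quotient B C uL uW rn E_bases i j x0 uM) xs normcM normcV.
have num_le : normc (nume 1 s^-1 z i j) <= K * d.
  have [_ KP] := K2P (i, j).
  have h : normc (nume 1 s^-1 z i j - nume 1 0 z i j) <= K2 (i, j) * d := KP x y d d0 bx byy xy.
  rewrite (feedthrough_eq0 uL uW rn E_bases tau0 i j z stable finite) subr0 in h.
  by apply: le_trans h _; rewrite ler_wpM2r.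
have -> : K / (c / 2) / normc s = K * d * (c / 2)^-1 by rewrite /d mulrAC.
apply: ler_pM num_le _; rewrite ?normc_ge0 ?invr_ge0 ?normc_ge0 //.
by rewrite lef_pV2 ?posrE // (lt_le_trans c20).
Qed.

(** On bounded parts of the half-plane the characteristic determinant stays
    away from zero, so that the transfer function is Lipschitz in the factors
    that replace the delays. *)
Lemma near_field (rho eta : R) : 0 < eta -> exists2 d : R, 0 < d &
  forall s z, 0 <= complex.Re s -> normc s <= rho -> (forall k, normc (z k) <= 1) ->
    (forall k, normc (z k - dexp s k) <= d) ->
    exp_mx E A0 A s z \in unitmx /\
    forall i j, `|normc (G s z i j) ^+ 2 - normc (G s (dexp s) i j) ^+ 2| <= eta.
Proof.
move=> eta0.
have [c c0 cP] : exists2 c : R, 0 < c & forall s, 0 <= complex.Re s -> normc s <= rho ->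
    c <= normc (sysdet s 1 (dexp s)).
  have lv : lip (fun x : unit -> R[i] => x tt) by exact: lip_var.
  have l1 : lip (fun x : unit -> R[i] => 1) by exact: (fring_cst (fring_lip R unit) 1).
  have lz k : lip (fun x : unit -> R[i] => dexp (x tt) k).
    apply: lip_cexp; apply: (fringN (fring_lip R unit)).
    exact: (fringM (fring_lip R unit) (fring_cst (fring_lip R unit) _)).
  pose S (x : unit -> R[i]) := 0 <= complex.Re (x tt) /\ normc (x tt) <= rho.
  have [c c0 cP] : exists2 c : R, 0 < c &
      forall x, S x -> c <= normc (sysdet (x tt) 1 (dexp (x tt))).
    apply: (lip_min (M := rho) (lip_sysdet lv l1 lz)).
    - by move=> x [_ h] [].
    - move=> x bx cl; split; last exact: bx.
      apply/ler_addgt0Pr => d d0; have [y [y0 _] /(_ tt) yx] := cl d d0.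
      have := le_trans (Re_le_normc _) yx; rewrite ReB ler_norml => /andP[h1 h2].
      by lra.
    - move=> x [x0 _].
      have [d [e [d0 e0 zf]]] := stable_zero_free stable.
      have tb : delay_ball tau d tau.
        split=> [k|]; first exact: ltW.
        by rewrite big1 ?sqrtr0 // => k _; rewrite subrr expr0n.
      have := zf tau (x tt) tb; rewrite charmxE -unitfE -[_ \is a _]/(_ \in unitmx).
      rewrite -(sysmx_unit A0 A uL uW rn E_bases (x tt) _ (oner_neq0 _)) mul1r unitmxE unitfE.
      by apply; rewrite (le_trans _ x0) // oppr_le0 ltW.
  by exists c => // s s0 sr; apply: (cP (fun _ => s)).
pose J := option 'I_m.+1.
have lN : lip (fun x : J -> R[i] => x None) by exact: lip_var.
have l1 : lip (fun x : J -> R[i] => 1) by exact: (fring_cst (fring_lip R J) 1).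
have lS k : lip (fun x : J -> R[i] => x (Some k)) by exact: lip_var.
pose M : R := 1 + `|rho|.
have [K1 K10 [K1b K1P]] := lip_sysdet lN l1 lS M.
have /choice[K2 K2P] (ij : 'I_q * 'I_p) : exists K : R, [/\ 0 <= K,
    forall x, bdd M x -> normc (nume (x None) 1 (x \o Some) ij.1 ij.2) <= K &
    forall x y (d : R), 0 <= d -> bdd M x -> bdd M y -> nearby d x y ->
    normc (nume (x None) 1 (x \o Some) ij.1 ij.2 - nume (y None) 1 (y \o Some) ij.1 ij.2) <= K * d].
  by have [K K0 [Kb KP]] := lip_numer ij.1 ij.2 lN l1 lS M; exists K.
pose K := K1 + \sum_ij K2 ij.
have K2K ij : K2 ij <= K.
  rewrite /K (bigD1 ij) //= (addrCA K1) lerDl addr_ge0 // sumr_ge0 // => l _.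
  by case: (K2P l).
have K1K : K1 <= K by rewrite /K lerDl sumr_ge0 // => l _; case: (K2P l).
have K0 : 0 <= K := le_trans K10 K1K.
pose ka : R := 4 * (K / (c / 2)) ^+ 3.
have ka0 : 0 <= ka by rewrite mulr_ge0 // exprn_ge0 // divr_ge0 // divr_ge0 // ltW.
have K11 : 0 < 1 + K by rewrite ltr_wpDr.
have ka1 : 0 < 1 + ka by rewrite ltr_wpDr.
pose d : R := Num.min (c / (2 * (1 + K))) (eta / (1 + ka)).
have d0 : 0 < d by rewrite lt_min !divr_gt0 // mulr_gt0.
have dc : d <= c / (2 * (1 + K)) by rewrite ge_min lexx.
have de : d <= eta / (1 + ka) by rewrite ge_min lexx orbT.
exists d => // s z s0 sr z1 zd.
have main w : (forall k, normc (w k) <= 1) -> (forall k, normc (w k - dexp s k) <= d) ->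
    [/\ c / 2 <= normc (sysdet s 1 w), normc (sysdet s 1 w) <= K,
        normc (sysdet s 1 w - sysdet s 1 (dexp s)) <= K * d &
        exp_mx E A0 A s w \in unitmx /\ forall i j, normc (nume s 1 w i j) <= K /\
          normc (nume s 1 w i j - nume s 1 (dexp s) i j) <= K * d].
  move=> w1 wd.
  pose x (o : J) : R[i] := if o is Some k then w k else s.
  pose y (o : J) : R[i] := if o is Some k then dexp s k else s.
  have sM : normc s <= M.
    by rewrite (le_trans sr) // (le_trans (ler_norm _)) // lerDr.
  have oM : 1 <= M by rewrite lerDl.
  have bx : bdd M x by case=> [k|] //=; rewrite (le_trans (w1 k)).
  have byy : bdd M y by case=> [k|] //=; rewrite (le_trans (dexp_le1 k s0)).
  have xy : nearby d x y by case=> [k|] //=; rewrite subrr normc0 ltW.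
  have dd : normc (sysdet s 1 w - sysdet s 1 (dexp s)) <= K * d.
    by rewrite (le_trans (K1P x y d (ltW d0) bx byy xy)) // ler_wpM2r // ltW.
  have dge : c / 2 <= normc (sysdet s 1 w).
    have h4 : K * d <= c / 2.
      rewrite (@le_trans _ _ ((1 + K) * d)) ?ler_wpM2r ?lerDr ?(ltW d0) //.
      have -> : c / 2 = (1 + K) * (c / (2 * (1 + K))) by field; rewrite gt_eqF.
      by rewrite ler_wpM2l // ltW.
    apply: (normc_half (cP s s0 sr) _ h4).
    exact: normc_leC dd.
  split=> //; first by rewrite (le_trans (K1b x bx)).
  split.
    rewrite -(sysmx_unit A0 A uL uW rn E_bases s w (oner_neq0 _)) mul1r unitmxE unitfE -normc_gt0.
    by rewrite (lt_le_trans _ dge) // divr_gt0.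
  move=> i j; have [_ Kb KP] := K2P (i, j); split.
    by rewrite (le_trans (Kb x bx)).
  by rewrite (le_trans (KP x y d (ltW d0) bx byy xy)) // ler_wpM2r // ltW.
have [a1 a2 a3 [a4 a5]] := main z z1 zd.
have [b1 b2 b3 [b4 b5]] := main (dexp s) (fun k => dexp_le1 k s0) (fun k => normc_sub_refl (dexp s k) (ltW d0)).
split; first exact: a4.
move=> i j; rewrite (transfer_quotient B C uL uW rn E_bases i j (oner_neq0 _) a4) (transfer_quotient B C uL uW rn E_bases i j (oner_neq0 _) b4).
rewrite mul1r.
have [h1 h2] := a5 i j; have [h3 _] := b5 i j.
have c20 : 0 < c / 2 by rewrite divr_gt0.
apply: le_trans (quotient_lip c20 K0 (ltW d0) h1 h3 a2 b2 a1 b1 h2 a3) _.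
rewrite -/ka (@le_trans _ _ ((1 + ka) * d)) ?ler_wpM2r ?lerDr ?(ltW d0) //.
by rewrite mulrC -ler_pdivlMr.
Qed.

End UniformBounds.

Section FrobeniusBounds.
Variables (R : realType) (q p : nat).
Implicit Types M N : 'M[R[i]]_(q, p).

Lemma frobenius_dist M N (e : R) :
  (forall i j, `|normc (M i j) ^+ 2 - normc (N i j) ^+ 2| <= e) ->
  `|frobenius M ^+ 2 - frobenius N ^+ 2| <= (q * p)%:R * e.
Proof.
move=> MN; rewrite !frobenius_sqr -sumrB (le_trans (ler_norm_sum _ _ _)) //.
apply: (@le_trans _ _ (\sum_(i < q) p%:R * e)).
  apply: ler_sum => i _; rewrite -sumrB (le_trans (ler_norm_sum _ _ _)) //.
  apply: (@le_trans _ _ (\sum_(j < p) e)); first by apply: ler_sum => j _; exact: MN.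
  by rewrite sumr_const card_ord mulr_natl.
by rewrite sumr_const card_ord natrM -[leRHS]mulrA [leRHS]mulr_natl.
Qed.

Lemma frobenius_le M (b : R) : (forall i j, normc (M i j) <= b) ->
  frobenius M ^+ 2 <= (q * p)%:R * b ^+ 2.
Proof.
move=> Mb; rewrite frobenius_sqr.
apply: (@le_trans _ _ (\sum_(i < q) p%:R * b ^+ 2)).
  apply: ler_sum => i _; apply: (@le_trans _ _ (\sum_(j < p) b ^+ 2)).
    apply: ler_sum => j _; have b0 : 0 <= b := le_trans (normc_ge0 _) (Mb i j).
    by rewrite ler_sqr ?nnegrE ?normc_ge0.
  by rewrite sumr_const card_ord mulr_natl.
by rewrite sumr_const card_ord natrM -[leRHS]mulrA [leRHS]mulr_natl.
Qed.

End FrobeniusBounds.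

(** * Convergence of the delay approximants *)

Section SplineMultipliers.
Variables (R : realType) (m : nat) (tau : 'rV[R]_m.+1).
Hypothesis tau_incr : forall k : 'I_m.+1, knot tau k < knot tau k.+1.
Implicit Types (k : 'I_m.+1) (s : R[i]) (N : nat).

Local Notation kexp i s := (cexp (- ((knot tau i)%:C * s))).

Lemma knot_ge0 i : (i <= m.+1)%N -> 0 <= knot tau i.
Proof.
elim: i => // i IH im; apply: le_trans (IH (ltnW im)) _.
by have := tau_incr (Ordinal im) => /ltW.
Qed.

Lemma seg_ratio_le1 N k s : 0 <= complex.Re s -> normc (seg_ratio tau N k s) <= 1.
Proof.
apply: tau_ratio_le1; first exact: seg_lt.
- exact: size_seg_legendre.
- exact: cpoly_seg_legendre.
- exact: seg_legendre_orthogonal.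
Qed.

Lemma knot_mult_le1 N i s : 0 <= complex.Re s -> normc (knot_mult tau N i s) <= 1.
Proof.
move=> s0; elim: i => [|i IH]; first by rewrite /knot_mult big_ord0 normc1.
rewrite /knot_mult big_ord_recr /= -/(knot_mult tau N i s) normcM.
by rewrite mulr_ile1 ?normc_ge0 // seg_ratio_le1.
Qed.

(** Both terms of the error bound are monotone in [normc s], so that their
    values at [rho] give uniformity on the half-disc. *)
Lemma seg_ratio_cvg k (rho e : R) : 0 <= rho -> 0 < e -> exists N0, forall N s, (N0 <= N)%N ->
  0 <= complex.Re s -> normc s <= rho ->
  normc (seg_ratio tau N k s - cexp (- (s * (knot tau k.+1 - knot tau k)%:C))) <= e.
Proof.
move=> rho0 e0; pose h := knot tau k.+1 - knot tau k.
have h0 : 0 < h by rewrite subr_gt0 tau_incr.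
pose b := rho * h; have b0 : 0 <= b by rewrite mulr_ge0 // ltW.
have eb : 0 < b + expR b by rewrite ltr_wpDl ?expR_gt0.
have [N0 NP] := exp_coeff_small b (divr_gt0 e0 eb).
exists N0.+1 => -[//|M] s; rewrite ltnS => NM s0 sr.
have hE : - knot tau k - - knot tau k.+1 = h by rewrite opprK addrC.
have := tau_ratio_error (seg_lt tau_incr k) (size_seg_legendre tau_incr M.+1 k)
  (@seg_legendre_orthogonal _ _ _ tau_incr M.+1 k) (erefl M.+1) s0.
rewrite hE => /le_trans; apply.
have sb : normc s * h <= b by rewrite ler_wpM2r // ltW.
have sb0 : 0 <= normc s * h by rewrite mulr_ge0 ?normc_ge0 // ltW.
have -> : e = b * (e / (b + expR b)) + expR b * (e / (b + expR b)) by field; rewrite gt_eqF.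
apply: lerD.
  apply: (@le_trans _ _ (b * (b ^+ M / M`!%:R))); last by rewrite ler_wpM2l // NP.
  rewrite mulrA -exprS ler_wpM2r ?invr_ge0 //.
  by rewrite lerXn2r ?nnegrE.
rewrite -mulrA; apply: ler_pM; rewrite ?expR_ge0 ?divr_ge0 ?exprn_ge0 ?ler_expR //.
apply: le_trans (NP M.+1 (leqW NM)).
by rewrite ler_wpM2r ?invr_ge0 // lerXn2r ?nnegrE.
Qed.

Lemma kexp_le1 i s : (i <= m.+1)%N -> 0 <= complex.Re s -> normc (kexp i s) <= 1.
Proof.
move=> im s0; rewrite normc_cexp -expR0 ler_expR; case: s s0 => a b /= a0.
by rewrite mul0r subr0 oppr_le0 mulr_ge0 // knot_ge0.
Qed.

(** Products of numbers of modulus at most one differ by at most the sum of the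
    differences of the factors. *)
Lemma spl_mult_cvg (rho e : R) : 0 <= rho -> 0 < e -> exists N0, forall N s, (N0 <= N)%N ->
  0 <= complex.Re s -> normc s <= rho ->
  forall k, normc (spl_mult tau N s k - cexp (- ((tau 0 k)%:C * s))) <= e.
Proof.
move=> rho0 e0; pose d := e / m.+1%:R; have d0 : 0 < d by rewrite divr_gt0.
have /choice[N0 NP] k := seg_ratio_cvg k rho0 d0.
exists (\max_k N0 k) => N s NN s0 sr k.
have le_k i : (i <= m.+1)%N -> normc (knot_mult tau N i s - kexp i s) <= i%:R * d.
  elim: i => [|i IH] im.
    by rewrite /knot_mult big_ord0 rmorph0 mul0r oppr0 cexp0 subrr normc0 mul0r.
  have iE : nat_of_ord (inord i : 'I_m.+1) = i by rewrite inordK.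
  have := NP (inord i) N s (leq_trans (leq_bigmax _) NN) s0 sr; rewrite iE.
  have -> : kexp i.+1 s = kexp i s * cexp (- (s * (knot tau i.+1 - knot tau i)%:C)).
    by rewrite -cexpD rmorphB; congr cexp; ring.
  set c := cexp (- (s * _)) => rc.
  rewrite /knot_mult big_ord_recr /= -/(knot_mult tau N i s).
  set a := knot_mult _ _ _ _ in IH *; set b := kexp i s in IH *; set r := seg_ratio _ _ _ _ in rc *.
  have -> : a * r - b * c = (a - b) * r + b * (r - c) by ring.
  rewrite (le_trans (normcD _ _)) // (normcM (a - b)) (normcM b) -natr1 mulrDl mul1r lerD //.
    by rewrite -[leRHS]mulr1 ler_pM ?normc_ge0 ?IH ?(ltnW im) // seg_ratio_le1.
  by rewrite -[leRHS]mul1r ler_pM ?normc_ge0 // kexp_le1 // ltnW.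
have tE : tau 0 k = knot tau k.+1 by rewrite /= inord_val.
rewrite tE (le_trans (le_k k.+1 (ltn_ord k))) // /d mulrA ler_pdivrMr // mulrC.
by rewrite ler_wpM2l ?(ltW e0) // ler_nat.
Qed.

Lemma spl_mult_ccont N (f : R -> R[i]) k : ccont f -> (forall w, 0 <= complex.Re (f w)) ->
  ccont (fun w => spl_mult tau N (f w) k).
Proof.
move=> cf f0; have fc := fring_ccont R.
apply: (fring_prod fc) => l; apply: (fringM fc).
  under eq_fun do rewrite /tau_fun horner_sum.
  apply: (fring_sum fc) => j; under eq_fun do rewrite hornerZ.
  exact: (fringM fc (fringX fc _ cf) (fring_cst fc _)).
apply: ccontV => [|w].
  under eq_fun do rewrite /tau_fun horner_sum.
  apply: (fring_sum fc) => j; under eq_fun do rewrite hornerZ.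
  exact: (fringM fc (fringX fc _ cf) (fring_cst fc _)).
apply: tau_fun1_neq0 (f0 w); first exact: seg_lt.
- exact: size_seg_legendre.
- exact: seg_legendre_orthogonal.
Qed.

End SplineMultipliers.

(** * Comparison of Hardy norms *)

Section HardyComparison.
Variable R : realType.

(** The antiderivative on the half-line is [atan (w / rho) / rho]. *)
Lemma integral_cauchy (rho : R) : 0 < rho ->
  (\int[lebesgue_measure]_w ((rho ^+ 2 + w ^+ 2)^-1)%:E = (pi / rho)%:E)%E.
Proof.
move=> rho0; have rn0 : rho != 0 by rewrite gt_eqF.
pose f (w : R) : R := rho ^- 2 * (oneDsqr (rho^-1 * w))^-1.
have fE w : (rho ^+ 2 + w ^+ 2)^-1 = f w.
  rewrite /f /oneDsqr -invfM; congr (_^-1); rewrite exprMn exprVn; field.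
  exact: rn0.
under eq_integral do rewrite fE.
have f0 w : 0 <= f w by rewrite -fE invr_ge0 addr_ge0 // sqr_ge0.
have cl : continuous (fun w : R => rho^-1 * w).
  by move=> w; apply: cvgM; [apply: cvg_cst | apply: cvg_id].
have cf : continuous f.
  move=> w; apply: cvgM; first exact: cvg_cst.
  exact: (continuous_comp (cl w) (@continuous_oneDsqrV R _)).
rewrite ge0_symfun_integralT //; last first.
  by move=> w /=; rewrite /f mulrN /oneDsqr sqrrN.
rewrite -set_itvcy.
pose F (w : R) : R := rho^-1 * atan (rho^-1 * w).
have dF (w : R) : is_derive w 1 F (f w).
  have -> : f w = rho^-1 * ((1 + (rho^-1 * w) ^+ 2)^-1 * rho^-1).
    by rewrite /f -exprVn /oneDsqr; ring.
  apply: is_deriveZ.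
  have d1 : is_derive w 1 (fun x : R => rho^-1 * x) rho^-1.
    by rewrite -[X in is_derive _ _ _ X]mulr1; apply: is_deriveZ.
  have := @is_derive1_comp R (@atan R) (fun x => rho^-1 * x) w _ _ _ d1; exact.
rewrite (@ge0_continuous_FTC2y R f F 0 (rho^-1 * (pi / 2))).
- rewrite /F mulr0 atan0 mulr0 sube0 -EFinM; congr EFin; field; exact: rn0.
- by [].
- by apply: continuous_subspaceT.
- apply: cvgM; first exact: cvg_cst.
  apply: (cvg_comp _ _ _ (@cvgy_atan R)).
  by apply: gt0_cvgMry; [rewrite invr_gt0 | exact: cvg_id].
- by move=> w _; have := dF w => -[].
- apply: cvg_at_right_filter; apply: cvgM; first exact: cvg_cst.
  exact: (continuous_comp (cl 0) (@continuous_atan R _)).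
- by move=> w _; rewrite derive1E; have := dF w => -[].
Qed.

Lemma sqrte_le_add (x : \bar R) (d : R) : (0 <= x)%E -> 0 <= d ->
  (sqrte (x + d%:E) <= sqrte x + (Num.sqrt d)%:E)%E.
Proof.
case: x => [x||] //=; rewrite ?lee_fin => x0 d0.
rewrite -ler_sqr ?nnegrE ?addr_ge0 ?sqrtr_ge0 // sqrrD !sqr_sqrtr ?addr_ge0 //.
by rewrite lerD2r lerDl mulrn_wge0 // mulr_ge0 ?sqrtr_ge0.
Qed.

(** The excess integrates to [2 pi kappa / rho] on every vertical line, and the
    square root is subadditive. *)
Lemma hardy2_le (q p : nat) (H K : R[i] -> 'M[R[i]]_(q, p)) (kappa rho : R) :
  0 <= kappa -> 0 < rho ->
  (forall a : R, 0 < a -> continuous (fun w => frobenius (H (a +i* w)) ^+ 2)) ->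
  (forall a : R, 0 < a -> continuous (fun w => frobenius (K (a +i* w)) ^+ 2)) ->
  (forall a w : R, 0 < a -> frobenius (H (a +i* w)) ^+ 2 <=
     frobenius (K (a +i* w)) ^+ 2 + 2 * kappa * (rho ^+ 2 + w ^+ 2)^-1) ->
  (hardy2 H <= hardy2 K + (Num.sqrt (kappa / rho))%:E)%E.
Proof.
move=> k0 rho0 cH cK HK; apply: ge_ereal_sup => _ [a /= a0 <-].
pose mu := @lebesgue_measure R.
pose f w := frobenius (H (a +i* w)) ^+ 2; pose g w := frobenius (K (a +i* w)) ^+ 2.
pose h (w : R) := 2 * kappa * (rho ^+ 2 + w ^+ 2)^-1.
have mE (u : R -> R) : continuous u -> measurable_fun setT (EFin \o u).
  by move=> cu; apply/measurable_EFinP; exact: continuous_measurable_fun.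
have g0 w : 0 <= g w by rewrite sqr_ge0.
have r0 w : 0 < rho ^+ 2 + w ^+ 2 by rewrite ltr_pwDl ?exprn_gt0 // sqr_ge0.
have h0 w : 0 <= h w by rewrite !mulr_ge0 // invr_ge0 ltW.
have ch : continuous (fun w : R => (rho ^+ 2 + w ^+ 2)^-1).
  move=> w; apply: cvgV; first by rewrite gt_eqF.
  apply: cvgD; first exact: cvg_cst.
  by rewrite expr2; apply: cvgM; exact: cvg_id.
have mh : measurable_fun setT (EFin \o h).
  by apply: mE => w; apply: cvgM; [exact: cvg_cst | exact: ch].
have c0 : 0 < (2 * pi)^-1 :> R by rewrite invr_gt0 mulr_gt0 // pi_gt0.
have Ig0 : (0 <= \int[mu]_w (g w)%:E)%E by apply: integral_ge0 => w _; rewrite lee_fin.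
have Ih : (\int[mu]_w (h w)%:E = (2 * kappa * (pi / rho))%:E)%E.
  under eq_integral do rewrite /h EFinM.
  rewrite ge0_integralZl_EFin ?integral_cauchy ?mulr_ge0 //.
  - by move=> w _; rewrite lee_fin invr_ge0 ltW.
  - exact: mE ch.
have Ifg : (\int[mu]_w (f w)%:E <= \int[mu]_w (g w)%:E + (2 * kappa * (pi / rho))%:E)%E.
  rewrite -Ih -ge0_integralD //; first last.
  - by move=> w _; rewrite lee_fin.
  - exact: mE (cK a a0).
  - by move=> w _; rewrite lee_fin.
  apply: ge0_le_integral => //.
  - by move=> w _; rewrite lee_fin sqr_ge0.
  - exact: mE (cH a a0).
  - by apply: emeasurable_funD => //; exact: mE (cK a a0).
  - by move=> w _; rewrite -EFinD lee_fin HK.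
apply: (@le_trans _ _ (sqrte ((2 * pi)^-1%:E * \int[mu]_w (g w)%:E + (kappa / rho)%:E)%E)).
  rewrite lee_sqrt; last first.
    by rewrite adde_ge0 ?mule_ge0 // lee_fin ?divr_ge0 // ltW.
  have -> : (kappa / rho)%:E = ((2 * pi)^-1%:E * (2 * kappa * (pi / rho))%:E)%E :> \bar R.
    have pn : pi != 0 :> R by rewrite gt_eqF // pi_gt0.
    have rn : rho != 0 by rewrite gt_eqF.
    rewrite -EFinM; congr EFin; move: (pi : R) pn => P pn; field.
    by rewrite rn pn.
  rewrite -ge0_muleDr //; last by rewrite lee_fin !mulr_ge0 ?invr_ge0 ?pi_ge0 ?(ltW rho0).
  by rewrite lee_wpmul2l // lee_fin ltW.
apply: le_trans (sqrte_le_add _ _) _.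
- by rewrite mule_ge0 // lee_fin ltW.
- by rewrite divr_ge0 // ltW.
by rewrite leeD2r //; apply: ereal_sup_ubound; exists a.
Qed.

Lemma hardy2_ge0 (q p : nat) (H : R[i] -> 'M[R[i]]_(q, p)) : (0 <= hardy2 H)%E.
Proof.
by apply: le_trans (sqrte_ge0 _) _; apply: ereal_sup_ubound; exists 1 => //=; exact: ltr01.
Qed.

(** Approximation in both directions up to arbitrarily small errors is
    convergence, the limit being a nonnegative real number. *)
Lemma ereal_cvg_squeeze (u : nat -> \bar R) (l : \bar R) : (0 <= l)%E -> (l < +oo)%E ->
  (forall e : R, 0 < e -> exists N0, forall N, (N0 <= N)%N ->
     (u N <= l + e%:E)%E /\ (l <= u N + e%:E)%E) ->
  u N @[N --> \oo] --> l.
Proof.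
case: l => [l||] // _ _ ul; apply/fine_cvgP; split.
  have [N0 NP] := ul 1 ltr01; exists N0 => // N /= NN; have [h1 h2] := NP N NN.
  by case: (u N) h1 h2.
apply/cvgrPdist_le => e e0; have [N0 NP] := ul e e0; exists N0 => // N /= NN.
have [] := NP N NN; case: (u N) => [x||] //=; rewrite -!EFinD !lee_fin => h1 h2.
by rewrite ler_norml; apply/andP; split; lra.
Qed.

End HardyComparison.

(** * Stability of the discretization *)

Import VectorInternalTheory.

Lemma negative_bound (R : realType) (xs : seq R) :
  exists2 b : R, b < 0 & forall x, x \in xs -> x < 0 -> x <= b.
Proof.
elim: xs => [|x xs [b b0 bP]]; first by exists (- 1); rewrite ?ltrN10.
have [x0|x0] := ltP x 0; last first.
  by exists b => // y; rewrite in_cons => /orP[/eqP-> y0|]; [lra | exact: bP].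
exists (Num.max x b); first by rewrite gt_max x0.
move=> y; rewrite in_cons => /orP[/eqP-> _|yxs y0]; first by rewrite le_max lexx.
by rewrite le_max bP ?orbT.
Qed.

(** If the pencil is injective at [s = 1], its singular points [s] correspond to
    the eigenvalues [1 / (1 - s)] of a single endomorphism, so that they are
    finitely many and none can accumulate at the imaginary axis. *)
Lemma pencil_abscissa_lt0 (R : realType) (vT wT : vectType R[i]) (f g : 'Hom(vT, wT)) :
  (forall s : R[i], 0 <= complex.Re s -> lker (s *: f - g)%R == 0%VS) ->
  (ereal_sup [set (complex.Re s)%:E | s in [set s : R[i] | lker (s *: f - g)%R != 0%VS]] < 0)%E.
Proof.
move=> inj; have inj1 := inj 1 ler01.
pose T : 'End(vT) := ((1 *: f - g)^-1 \o f)%VF.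
pose P := char_poly (f2mx T).
have [rs PE] := closed_field_poly_normal P.
have [b b0 bP] := negative_bound [seq complex.Re (1 - x^-1) | x <- rs].
apply: (@le_lt_trans _ _ b%:E); last by rewrite lte_fin.
apply: ge_ereal_sup => _ [s /= ks <-]; rewrite lee_fin.
have s0 : complex.Re s < 0 by rewrite ltNge; apply: contraNN ks; exact: inj.
have s1 : 1 - s != 0.
  by rewrite subr_eq0; apply: contraTneq s0 => <-; rewrite -leNgt ler01.
have [x /= xk x0] : exists2 x, x \in lker (s *: f - g)%R & x != 0.
  by exists (vpick (lker (s *: f - g)%R)); rewrite ?memv_pick ?vpick0.
have Tx : T x = (1 - s)^-1 *: x.
  have fx : (1 *: f - g)%VF x = (1 - s) *: f x.
    move: xk; rewrite memv_ker !(add_lfunE, opp_lfunE, scale_lfunE) subr_eq0 => /eqP <-.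
    by rewrite scalerBl.
  have h : ((1 *: f - g)^-1)%VF ((1 - s) *: f x) = x by rewrite -fx lker0_lfunK.
  by rewrite comp_lfunE -{2}h linearZ scalerK.
have ev : eigenvalue (f2mx T) (1 - s)^-1.
  apply/eigenvalueP; exists (v2r x); last by apply: contraNneq x0 => vx; apply/eqP/v2r_inj; rewrite vx linear0.
  have := congr1 (@v2r _ vT) Tx; rewrite linearZ => <-.
  by rewrite unlock /= r2vK.
have : (1 - s)^-1 \in rs.
  rewrite eigenvalue_root_char -/P PE in ev.
  rewrite rootZ ?root_prod_XsubC // in ev.
  by rewrite lead_coef_eq0 monic_neq0 // char_poly_monic.
move=> srs; apply: bP => //; apply/mapP; exists (1 - s)^-1 => //.
by rewrite invrK subKr.
Qed.

(** * Convergence *)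

Lemma ger0_dist_le (R : realDomainType) (a b e : R) : 0 <= a -> 0 <= b -> a <= e -> b <= e ->
  `|a - b| <= e.
Proof. by move=> *; rewrite ler_norml; apply/andP; split; lra. Qed.

Section Convergence.
Variables (R : realType) (n p q m : nat).
Variables (E A0 : 'M[R[i]]_n) (A : 'I_m.+1 -> 'M[R[i]]_n).
Variables (B : 'M[R[i]]_(n, p)) (C : 'M[R[i]]_(q, n)) (tau : 'rV[R]_m.+1).
Variables (r : nat) (L W : 'M[R[i]]_n).
Hypotheses (uL : L \in unitmx) (uW : W \in unitmx) (rn : (r <= n)%N).
Hypothesis E_bases : E = L *m Pd R n r *m W.
Hypothesis tau0 : forall k, 0 < tau 0 k.
Hypothesis index1 : alg_det A0 A r L W (fun _ => 0) != 0.
Hypothesis stable : strongly_exp_stable E A0 A tau.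
Hypothesis finite : (strong_h2norm E A0 A B C tau < +oo)%E.
Implicit Types (s : R[i]) (z : 'I_m.+1 -> R[i]).

Local Notation G s z := (C *m invmx (exp_mx E A0 A s z) *m B).
Local Notation dexp s := (fun k => cexp (- ((tau 0 k)%:C * s))).

(** Inside the disc of radius [rho] the factors that replace the delays are
    close to the true ones, and outside it both transfer functions are small. *)
Lemma transfer_close : exists kappa rho0 : R, [/\ 0 < kappa, 0 < rho0 &
  forall rho : R, rho0 <= rho -> exists2 d : R, 0 < d & forall s z, 0 <= complex.Re s ->
    (forall k, normc (z k) <= 1) ->
    (normc s <= rho -> forall k, normc (z k - dexp s k) <= d) ->
    exp_mx E A0 A s z \in unitmx /\
    `|frobenius (G s z) ^+ 2 - frobenius (G s (dexp s)) ^+ 2| <=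
      2 * kappa * (rho ^+ 2 + complex.Im s ^+ 2)^-1].
Proof.
have [rho0 [K [rho00 K0 far]]] :=
  far_field uL uW rn E_bases tau0 index1 stable finite.
pose c : R := (q * p)%:R; have c0 : 0 <= c by [].
pose kappa := c * K ^+ 2 + 1.
have kappa0 : 0 < kappa by rewrite ltr_wpDl // mulr_ge0 // sqr_ge0.
exists kappa, rho0; split=> // rho rr.
have rho_gt0 : 0 < rho := lt_le_trans rho00 rr.
pose eta := kappa / rho ^+ 2 / (c + 1).
have c1 : 0 < c + 1 by rewrite ltr_wpDl.
have eta0 : 0 < eta by rewrite !divr_gt0 // exprn_gt0.
have [d d0 near] := near_field B C uL uW rn E_bases tau0 stable rho eta0.
exists d => // s z s0 z1 zd.
have I0 : 0 < rho ^+ 2 + complex.Im s ^+ 2 by rewrite ltr_pwDl ?exprn_gt0 // sqr_ge0.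
have Is : complex.Im s ^+ 2 <= normc s ^+ 2.
  by rewrite normc_sqr lerDr sqr_ge0.
rewrite ler_pdivlMr //; have [sr|sr] := leP (normc s) rho.
  have [uM close] := near s z s0 sr z1 (zd sr); split=> //.
  have := frobenius_dist close; rewrite -/c => h.
  have ce : c * eta <= kappa / rho ^+ 2.
    have -> : kappa / rho ^+ 2 = (c + 1) * eta by rewrite /eta; field; rewrite !gt_eqF.
    by rewrite ler_wpM2r ?lerDl // ltW.
  have sr2 : normc s ^+ 2 <= rho ^+ 2 by rewrite ler_sqr ?nnegrE ?normc_ge0 // ltW.
  have e2 : kappa / rho ^+ 2 * rho ^+ 2 = kappa by rewrite divfK // gt_eqF // exprn_gt0.
  have k0 : 0 <= kappa / rho ^+ 2 by rewrite divr_ge0 ?(ltW kappa0) // sqr_ge0.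
  have h2 := le_trans h ce.
  apply: le_trans (ler_wpM2r (ltW I0) h2) _.
  rewrite mulrDr e2 mulr_natl mulr2n lerD2l -[leRHS]e2.
  by rewrite ler_wpM2l // (le_trans Is).
have rs : rho0 <= normc s by rewrite (le_trans rr) // ltW.
have [uM Gz] := far s z z1 rs; split=> //.
have [_ Gd] := far s (dexp s) (fun k => dexp_le1 tau0 k s0) rs.
have s_gt0 : 0 < normc s := lt_le_trans rho00 rs.
have small : c * (K / normc s) ^+ 2 <= kappa / normc s ^+ 2.
  by rewrite expr_div_n mulrA ler_wpM2r ?invr_ge0 ?sqr_ge0 // lerDl.
have h1 := le_trans (frobenius_le Gz) small.
have h2 := le_trans (frobenius_le Gd) small.
have h3 : `|frobenius (G s z) ^+ 2 - frobenius (G s (dexp s)) ^+ 2| <= kappa / normc s ^+ 2.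
  exact: ger0_dist_le (sqr_ge0 _) (sqr_ge0 _) h1 h2.
apply: le_trans (ler_wpM2r (ltW I0) h3) _.
have sr2 : rho ^+ 2 <= normc s ^+ 2 by rewrite ler_sqr ?nnegrE ?normc_ge0 // ltW.
rewrite mulrAC ler_pdivrMr ?exprn_gt0 //.
rewrite -[leLHS]/(kappa * (rho ^+ 2 + complex.Im s ^+ 2)) [2 * _]mulrC -mulrA.
by rewrite ler_wpM2l ?(ltW kappa0) // mulr_natl mulr2n lerD.
Qed.

(** Given [e], the radius [rho] is chosen with [sqrt (kappa / rho) <= e]; for
    large [N] the approximants are close to the delay factors inside the disc of
    this radius, and the two Hardy norms differ by at most [e]. *)
Lemma spl_h2norm_cvg : (forall k : 'I_m.+1, knot tau k < knot tau k.+1) ->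
  spl_h2norm E A0 A B C tau N @[N --> \oo] --> delay_h2norm E A0 A B C tau.
Proof.
move=> tau_incr; have [kappa [rho0 [kappa0 rho00 close]]] := transfer_close.
have tb (d : R) : 0 < d -> delay_ball tau d tau.
  move=> d0; split=> [k|]; first exact: ltW.
  by rewrite big1 ?sqrtr0 // => k _; rewrite subrr expr0n.
have unit_dexp s : 0 <= complex.Re s -> exp_mx E A0 A s (dexp s) \in unitmx.
  move=> s0; have [d d0 dP] := close rho0 (lexx _).
  apply: (dP s (dexp s) s0 (fun k => dexp_le1 tau0 k s0) _).1 => _ k.
  exact: normc_sub_refl (ltW d0).
have fin := (fun h => h) finite; have [d' d'0 dfin] := strong_h2norm_lty fin.
have Gfin := dfin tau (tb d' d'0).
have ab0 : (abscissa E A0 A tau < 0)%E.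
  have [d d0] := stable; apply: le_lt_trans.
  by apply: ereal_sup_ubound; exists tau => //; exact: tb.
have GE : delay_h2norm E A0 A B C tau = hardy2 (transfer E A0 A B C tau).
  by rewrite /delay_h2norm /h2norm ab0.
rewrite GE in Gfin *.
have transE s : transfer E A0 A B C tau s = G s (dexp s) by rewrite /transfer charmxE.
have cG (a : R) : 0 < a -> continuous (fun w => frobenius (transfer E A0 A B C tau (a +i* w)) ^+ 2).
  move=> a0; apply: continuous_frobenius.
  apply: (transfer_ccont _ _ uL uW rn E_bases (ccont_line a)) => w.
  by rewrite charmxE -unitfE -[_ \is a _]/(_ \in unitmx) unit_dexp // ltW.
apply: ereal_cvg_squeeze (hardy2_ge0 _) Gfin _ => e e0.
pose rho := Num.max rho0 (kappa / e ^+ 2).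
have rr : rho0 <= rho by rewrite le_max lexx.
have rho_gt0 : 0 < rho := lt_le_trans rho00 rr.
have se : Num.sqrt (kappa / rho) <= e.
  rewrite -[leRHS]gtr0_norm // -sqrtr_sqr ler_sqrt ?sqr_ge0 //.
  by rewrite ler_pdivrMr // mulrC -ler_pdivrMr ?exprn_gt0 // le_max lexx orbT.
have [d d0 dP] := close rho rr.
have [N0 NP] := spl_mult_cvg tau_incr (ltW rho_gt0) d0.
exists N0 => N NN.
have key s : 0 <= complex.Re s -> exp_mx E A0 A s (spl_mult tau N s) \in unitmx /\
    `|frobenius (G s (spl_mult tau N s)) ^+ 2 - frobenius (G s (dexp s)) ^+ 2| <=
      2 * kappa * (rho ^+ 2 + complex.Im s ^+ 2)^-1.
  move=> s0; apply: dP => // [k|sr]; first exact: knot_mult_le1.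
  exact: NP.
have sa0 : (spl_abscissa E A0 A tau N < 0)%E.
  apply: pencil_abscissa_lt0 => s s0.
  by apply: spl_ker0 => //; case: (key s s0).
rewrite /spl_h2norm /h2norm sa0.
have splE (a w : R) : 0 < a -> spl_transfer E A0 A B C tau N (a +i* w) =
    G (a +i* w) (spl_mult tau N (a +i* w)).
  move=> a0; have s0 : 0 <= complex.Re (a +i* w) by exact: ltW.
  by apply: spl_transferE => //; case: (key _ s0).
have cS (a : R) : 0 < a ->
    continuous (fun w => frobenius (spl_transfer E A0 A B C tau N (a +i* w)) ^+ 2).
  move=> a0; apply: continuous_frobenius; under eq_fun do rewrite splE //.
  have s0 w : 0 <= complex.Re (a +i* w) by exact: ltW.
  apply: (pencil_ccont _ _ uL uW rn E_bases) => [|k|w]; first exact: ccont_line.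
    by apply: spl_mult_ccont => //; exact: ccont_line.
  by case: (key _ (s0 w)).
have bound (a w : R) : 0 < a ->
    `|frobenius (spl_transfer E A0 A B C tau N (a +i* w)) ^+ 2 -
      frobenius (transfer E A0 A B C tau (a +i* w)) ^+ 2| <=
      2 * kappa * (rho ^+ 2 + w ^+ 2)^-1.
  move=> a0; rewrite transE splE //.
  have s0 : 0 <= complex.Re (a +i* w) by exact: ltW.
  by case: (key _ s0).
split.
  apply: le_trans (hardy2_le (ltW kappa0) rho_gt0 cS cG _) _; last by rewrite leeD2l // lee_fin.
  by move=> a w a0; have := bound a w a0; rewrite ler_norml => /andP[_]; rewrite lerBlDl.
apply: le_trans (hardy2_le (ltW kappa0) rho_gt0 cG cS _) _; last by rewrite leeD2l // lee_fin.
move=> a w a0; have := bound a w a0; rewrite ler_norml => /andP[+ _].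
by rewrite lerNl opprB lerBlDl.
Qed.

End Convergence.

Theorem corollary5p2 (R : realType) (n p q m : nat)
  (E A0 : 'M[R[i]]_n) (A : 'I_m.+1 -> 'M[R[i]]_n)
  (B : 'M[R[i]]_(n, p)) (C : 'M[R[i]]_(q, n)) (tau : 'rV[R]_m.+1)
  (tau_incr : forall k : 'I_m.+1, knot tau k < knot tau k.+1)
  (index1 : index_le1 E A0)
  (stable : strongly_exp_stable E A0 A tau)
  (finite : (strong_h2norm E A0 A B C tau < +oo)%E) :
  spl_h2norm E A0 A B C tau N @[N --> \oo] --> delay_h2norm E A0 A B C tau.
Proof.
have tau0 k : 0 < tau 0 k.
  have h : 0 <= knot tau k by apply: knot_ge0 => //; exact: ltnW.
  by have := le_lt_trans h (tau_incr k); rewrite /= inord_val.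
have uL := col_ebase_unit E; have uW := row_ebase_unit E; have rn := rank_leq_row E.
have E_bases : E = col_ebase E *m Pd R n (\rank E) *m row_ebase E by rewrite mulmx_ebase.
have alg0 := index_le1_det A uL uW rn E_bases index1.
exact: (spl_h2norm_cvg uL uW rn E_bases tau0 alg0 stable finite tau_incr).
Qed.
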